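(* Let $1<p<\infty$ and let $K\in L^1(\mathbb{T}^\infty)$ be a nonnegative function with $\log K\in L^1(\mathbb{T}^\infty)$ and $\|K\|_1=1$. Put $$S(K)=\inf_{q\in\mathcal{P}_0}\int_{\mathbb{T}^\infty}|1-q|^pK\,dm_\infty .$$ Then the equality $$S(K)=\exp\left(\int_{\mathbb{T}^\infty}\log K\,dm_\infty\right)$$ holds if and only if $K=|h|^p$ (a.e. on $\mathbb{T}^\infty$) for some cyclic vector $h\in H^p(\mathbb{T}^\infty)$.
   Context: $\mathbb{T}^\infty$ is the countably infinite product of unit circles, with Haar probability measure $m_\infty$. $\mathcal{P}_\infty$ is the ring of analytic polynomials, each depending on finitely many of the complex variables $\zeta_1,\zeta_2,\ldots$, and $\mathcal{P}_0=\{q\in\mathcal{P}_\infty:q(0)=0\}$. For $0<p<\infty$, the Hardy space $H^p(\mathbb{T}^\infty)$ is the closure of $\mathcal{P}_\infty$ in $L^p(\mathbb{T}^\infty)=L^p(\mathbb{T}^\infty,m_\infty)$. A closed subspace of $H^p(\mathbb{T}^\infty)$ is invariant if it is closed under multiplication by every $q\in\mathcal{P}_\infty$; $h\in H^p(\mathbb{T}^\infty)$ is cyclic if the invariant subspace generated by $h$ (the closure of $\{qh:q\in\mathcal{P}_\infty\}$) is all of $H^p(\mathbb{T}^\infty)$. *)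

(* Defs.v *)
From HB Require Import structures.
From mathcomp Require Import all_boot all_order all_algebra.
From mathcomp Require Import all_classical all_reals all_analysis.
From mathcomp Require Import complex.
(* The notations of mpoly clash with those of analysis. *)
From mathcomp Require mpoly.
Import -(notations) mpoly.
Import Order.TTheory GRing.Theory Num.Theory.
Import numFieldNormedType.Exports.

Set Implicit Arguments.
Unset Strict Implicit.
Unset Printing Implicit Defensive.

Local Open Scope classical_set_scope.
Local Open Scope ring_scope.
Local Open Scope complex_scope.

(* Real-valued modulus; the norm `|z| of R[i] takes its values in R[i]. *)
Notation cabs := ComplexField.Normc.normc.

Definition circle (R : realType) : Type := {z : R[i] | cabs z == 1}.

Lemma circle1_subproof (R : realType) : cabs (1 : R[i]) == 1.
Proof. by rewrite ComplexField.Normc.normc1. Qed.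

Definition circle1 (R : realType) : circle R :=
  exist _ 1 (circle1_subproof R).

HB.instance Definition _ (R : realType) :=
  Choice.copy (circle R) {z : R[i] | cabs z == 1}.
HB.instance Definition _ (R : realType) :=
  isPointed.Build (circle R) (circle1 R).

Lemma circle_mul_subproof (R : realType) (w z : circle R) :
  cabs (sval w * sval z) == 1.
Proof.
by rewrite ComplexField.Normc.normcM (eqP (svalP w)) (eqP (svalP z)) mulr1.
Qed.

Definition circle_mul (R : realType) (w z : circle R) : circle R :=
  exist _ (sval w * sval z) (circle_mul_subproof w z).

(* The Borel sets of the circle are the traces of those of R * R. *)
Definition cylinder (R : realType) : set (set (nat -> circle R)) :=
  [set A | exists n (B : set (R * R)), measurable B /\
    A = [set z | B (complex.Re (sval (z n)), complex.Im (sval (z n)))]].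

(* The sigma-algebra generated by the cylinders is the Borel sigma-algebra of
   the product topology, since the circle is second countable. *)
Notation torus R := (g_sigma_algebraType (@cylinder R)).

Definition torus_mul (R : realType) (w z : torus R) : torus R :=
  fun n => circle_mul (w n) (z n).

(* By uniqueness of Haar measure, at most one probability satisfies this. *)
Definition is_haar (R : realType) (m : probability (torus R) R) : Prop :=
  forall (w : torus R) (A : set (torus R)), measurable A ->
    m (torus_mul w @^-1` A) = m A.

Definition poly_fun (R : realType) (n : nat) (q : mpoly n R[i]) :
    torus R -> R[i] :=
  fun z => meval (fun i : 'I_n => sval (z i)) q.

Definition analytic_poly (R : realType) : set (torus R -> R[i]) :=
  [set f | exists n (q : mpoly n R[i]), f = poly_fun q].

Definition analytic_poly0 (R : realType) : set (torus R -> R[i]) :=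
  [set f | exists n (q : mpoly n R[i]),
    meval (fun _ : 'I_n => 0) q = 0 /\ f = poly_fun q].

Section complex_Lp.
Context {d : measure_display} {T : measurableType d} {R : realType}.
Variables (mu : {measure set T -> \bar R}) (p : R).
Local Open Scope ereal_scope.

Definition cLnorm (f : T -> R[i]) : \bar R :=
  'N[mu]_(p%:E)[EFin \o (fun x => cabs (f x))].

Definition cLp : set (T -> R[i]) :=
  [set f | [/\ measurable_fun setT (fun x => complex.Re (f x)),
               measurable_fun setT (fun x => complex.Im (f x)) &
               cLnorm f < +oo]].

Definition Lp_closure (S : set (T -> R[i])) : set (T -> R[i]) :=
  [set f | cLp f /\ forall e : R, (0 < e)%R ->
    exists2 g, S g & cLnorm (fun x => f x - g x)%R < e%:E].

End complex_Lp.

Section hardy.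
Context {R : realType}.
Variables (m : probability (torus R) R) (p : R).

Definition hardy : set (torus R -> R[i]) := Lp_closure m p (@analytic_poly R).

Definition invariant_span (h : torus R -> R[i]) : set (torus R -> R[i]) :=
  Lp_closure m p
    [set (fun z => q z * h z) | q in (@analytic_poly R)].

Definition cyclic_vector (h : torus R -> R[i]) : Prop :=
  hardy h /\ invariant_span h = hardy.

Definition szego_inf (K : torus R -> R) : \bar R :=
  ereal_inf [set (\int[m]_z ((cabs (1 - q z) `^ p) * K z)%:E)%E
            | q in (@analytic_poly0 R)].

End hardy.

(* Main.v *)
From HB Require Import structures.
From mathcomp Require Import all_boot all_order all_algebra.
From mathcomp Require Import all_classical all_reals all_analysis.
From mathcomp Require Import measurable_realfun complex ring lra.
From mathcomp Require mpoly.
Import -(notations) mpoly.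
Require Import Defs.
Import Order.TTheory GRing.Theory Num.Theory.
Import numFieldNormedType.Exports HBNNSimple.

Set Implicit Arguments.
Unset Strict Implicit.
Unset Printing Implicit Defensive.

Local Open Scope classical_set_scope.
Local Open Scope ring_scope.

(** Let $L = \int \log K$. The values $\int |1-q|^p K$ never go below $e^L$:
    the frequencies of [q] lie in a half-space, so $\log|1+q|$ has
    nonnegative integral ([jensen]), and the concavity of the logarithm gives
    the bound ([szego_ge]). The theorem is about when $e^L$ is reached. As $K$
    is positive almost everywhere, it may be taken positive everywhere.

    Cyclic implies equality. If $h$ is cyclic and $K = |h|^p$, some analytic
    polynomials $r$ have $r h$ close to $1$ in $L^p$. Integration is
    multiplicative on products of a polynomial and a Hardy function, so
    $\int r \int h$ is close to $1$, and $r / \int r = 1 + q$ gives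
    $\int |1+q|^p K$ close to $|\int h|^p$, which Jensen's inequality for $h$
    bounds by $e^L$ ([cabs_cint_hardy], [szego_le_of_cyclic]).

    Equality implies cyclic. Let $g_k = 1 + q_k$ be a minimising sequence with
    $\int |g_k|^p K \le e^L (1 + 16^{-k})$.
    - Phases converge. By Jensen's inequality for $g_k$, $g_j$ and their
      midpoint, the convexity defects between them have small integrals, and
      these defects bound the distance between the phases $g_k/|g_k|$
      ([phase_le_defect], [phase_cauchy]). The phases tend almost everywhere
      to some $\theta$ ([phase_limit]).
    - Moduli converge: $|g_k|^p K$ tends to $e^L$ in $L^1$, being near equality
      in Jensen's inequality ([weighted_near_cst]). Hence, with
      $h = K^{1/p} \bar\theta$ and $c = e^{L/p}$, $g_k h$ tends to $c$ in $L^p$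
      ([extremal_cvg]).
    - $h$ belongs to the Hardy space. For $f$ with frequencies in the
      lexicographic half-space that looks first at the coordinate $i$,
      $g_k + c f$ still has frequencies in $0$ or this half-space, so the
      geometric mean of $|1 + t f h|$ is at least $1$ for all $t > 0$; the
      derivative at $t = 0$ gives $\mathrm{Re} \int f h \ge 0$, and rotating
      $f$ gives $\int f h = 0$ ([cint_lex_extremal]). Thus $h$ has no Fourier
      coefficient at a frequency with a negative coordinate, and convolution
      with Fejer kernels exhibits $h$ as a limit of analytic polynomials
      ([spectral_approx]).
    - $h$ is cyclic, as its multiples $g_k h / c$ tend to $1$. *)

(** * Integrals of real functions on a probability space *)

Lemma eq_ler {R : numDomainType} (x y : R) : x = y -> x <= y.
Proof. by move->. Qed.

Section real_integral.
Context {d : measure_display} {T : measurableType d} {R : realType}.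
Variable m : probability T R.
Implicit Types f g : T -> R.

Local Notation integ f := (m.-integrable setT (EFin \o f)).
Local Notation int f := (Rintegral m setT f).

Lemma eq_integ f g : f =1 g -> integ f -> integ g.
Proof. by move=> /funext ->. Qed.

Lemma eq_int f g : f =1 g -> int f = int g.
Proof. by move=> /funext ->. Qed.

Lemma integ_meas f : integ f -> measurable_fun setT f.
Proof. by move=> /measurable_int /measurable_EFinP. Qed.

Lemma integrable_ae_eq (f g : T -> \bar R) : m.-integrable setT f ->
  measurable_fun setT g -> {ae m, forall x, f x = g x} -> m.-integrable setT g.
Proof.
move=> /integrableP[mf fi] mg fg; apply/integrableP; split => //.
rewrite (ae_eq_integral (abse \o f))//.
- by apply: measurableT_comp.
- by apply: measurableT_comp.
- by apply: filterS fg => x fgx _; rewrite /= fgx.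
Qed.

Lemma integ_le f g : measurable_fun setT f -> (forall x, `|f x| <= g x) ->
  integ g -> integ f.
Proof.
move=> mf fg ig; apply: le_integrable ig => //; first exact/measurable_EFinP.
by move=> x _; rewrite /= lee_fin (le_trans (fg x))// ler_norm.
Qed.

Lemma integ_cst (c : R) : integ (fun=> c).
Proof.
apply: measurable_bounded_integrable => //.
- by rewrite -ge0_fin_numE// fin_num_measure.
- by exists `|c|; split=> // M cM x _; exact: ltW.
Qed.

Lemma integ_bnd f (C : R) : measurable_fun setT f -> (forall x, `|f x| <= C) ->
  integ f.
Proof. by move=> mf fC; apply: (integ_le mf fC); exact: integ_cst. Qed.

Lemma integ_ge0 f : measurable_fun setT f -> (forall x, 0 <= f x) ->
  (\int[m]_x (f x)%:E < +oo)%E -> integ f.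
Proof.
move=> mf f0 fy; apply/integrableP; split; first exact/measurable_EFinP.
rewrite (eq_integral (EFin \o f))// => x _.
by rewrite gee0_abs// lee_fin.
Qed.

Lemma integD f g : integ f -> integ g -> integ (fun x => f x + g x).
Proof.
move=> fi gi; have := integrableD measurableT fi gi.
by apply: eq_integrable => // x _; rewrite /= EFinD.
Qed.

Lemma integZ (c : R) f : integ f -> integ (fun x => c * f x).
Proof.
move=> fi; have := integrableZl measurableT c fi.
by apply: eq_integrable => // x _; rewrite /= EFinM.
Qed.

Lemma integB f g : integ f -> integ g -> integ (fun x => f x - g x).
Proof.
move=> fi gi; have := integD fi (integZ (-1) gi).
by apply: eq_integrable => // x _; rewrite /= mulN1r.
Qed.

Lemma integ_norm f : integ f -> integ (fun x => `|f x|).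
Proof.
move=> fi; apply: (integ_le (g := fun x => `|f x|)) => //.
- by apply: measurableT_comp => //; exact: integ_meas.
- by move=> x; rewrite normr_id.
- by have := integrable_abse fi; apply: eq_integrable => // x _.
Qed.

Lemma integ_sum (J : Type) (s : seq J) (F : J -> T -> R) :
  (forall j, integ (F j)) -> integ (fun x => \sum_(j <- s) F j x).
Proof.
move=> iF; elim: s => [|j s IH].
  by under eq_fun do rewrite big_nil; exact: integ_cst.
by under eq_fun do rewrite big_cons; exact: integD.
Qed.

Lemma intD f g : integ f -> integ g ->
  int (fun x => f x + g x) = int f + int g.
Proof. by move=> fi gi; rewrite RintegralD. Qed.

Lemma intB f g : integ f -> integ g ->
  int (fun x => f x - g x) = int f - int g.
Proof. by move=> fi gi; rewrite RintegralB. Qed.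

Lemma intZ (c : R) f : integ f -> int (fun x => c * f x) = c * int f.
Proof. by move=> fi; rewrite RintegralZl. Qed.

Lemma int_cst (c : R) : int (fun=> c) = c.
Proof.
have mT : fine (m setT) = 1 by rewrite (_ : m setT = 1%E)//; exact: probability_setT.
by rewrite Rintegral_cst// [X in _ * X]mT mulr1.
Qed.

Lemma int_sum (J : Type) (s : seq J) (F : J -> T -> R) :
  (forall j, integ (F j)) ->
  int (fun x => \sum_(j <- s) F j x) = \sum_(j <- s) int (F j).
Proof.
move=> iF; elim: s => [|j s IH].
  by under eq_fun do rewrite big_nil; rewrite int_cst big_nil.
under eq_fun do rewrite big_cons.
by rewrite intD ?IH ?big_cons//; exact: integ_sum.
Qed.

Lemma int_EFin f : integ f -> (\int[m]_x (f x)%:E = (int f)%:E)%E.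
Proof. by move=> fi; rewrite /Rintegral fineK//; exact: integrable_fin_num. Qed.

Lemma eq_int_ae f g : measurable_fun setT f -> measurable_fun setT g ->
  {ae m, forall x, f x = g x} -> int f = int g.
Proof.
move=> mf mg fg; congr fine; apply: ae_eq_integral => //.
- exact/measurable_EFinP.
- exact/measurable_EFinP.
- by apply: filterS fg => x fgx _; rewrite /= fgx.
Qed.

Lemma int_ge0 f : (forall x, 0 <= f x) -> 0 <= int f.
Proof. by move=> f0; exact: Rintegral_ge0. Qed.

Lemma int_ge0_ae f : measurable_fun setT f -> {ae m, forall x, 0 <= f x} ->
  0 <= int f.
Proof.
move=> mf f0; rewrite (@eq_int_ae f (fun x => Num.max (f x) 0))//.
- by apply: int_ge0 => x; rewrite le_max lexx orbT.
- exact: measurable_maxr.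
- by apply: filterS f0 => x fx; rewrite max_l.
Qed.

Lemma le_int_ae f g : integ f -> integ g ->
  {ae m, forall x, f x <= g x} -> int f <= int g.
Proof.
move=> fi gi fg; rewrite -subr_ge0 -intB//; apply: int_ge0_ae.
  by apply: integ_meas; exact: integB.
by apply: filterS fg => x; rewrite subr_ge0.
Qed.

Lemma le_int f g : integ f -> integ g -> (forall x, f x <= g x) ->
  int f <= int g.
Proof. by move=> fi gi fg; apply: le_int_ae => //; exact: aeW. Qed.

Lemma integ_ae f g : integ f -> measurable_fun setT g ->
  {ae m, forall x, f x = g x} -> integ g.
Proof.
move=> fi mg fg; apply: (integrable_ae_eq fi); first exact/measurable_EFinP.
by apply: filterS fg => x fgx; rewrite /= fgx.
Qed.

Lemma integ_le_ae f g : measurable_fun setT f -> {ae m, forall x, `|f x| <= g x} ->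
  integ g -> integ f.
Proof.
move=> mf fg gi; have mg := integ_meas gi.
pose h x := Num.max (- `|g x|) (Num.min (f x) `|g x|).
apply: (@integ_ae h) => //.
  apply: (@integ_le _ (fun x => `|g x|)); last exact: integ_norm.
    apply: measurable_maxr; last apply: measurable_minr => //.
      by apply: measurableT_comp => //; exact: measurableT_comp.
    exact: measurableT_comp.
  move=> x; rewrite /h ler_norml le_max lexx/= ge_max ge_min lexx orbT andbT.
  by rewrite (le_trans _ (normr_ge0 (g x)))// oppr_le0.
apply: filterS fg => x fg; have /andP[? ?] : - `|g x| <= f x <= `|g x|.
  by rewrite -ler_norml (le_trans fg)// ler_norm.
by rewrite /h min_l// max_r.
Qed.

Lemma dct (f : nat -> T -> R) (f0 g : T -> R) :
  (forall n, measurable_fun setT (f n)) -> measurable_fun setT f0 ->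
  {ae m, forall x, f n x @[n --> \oo] --> f0 x} ->
  (forall n x, `|f n x| <= g x) -> integ g ->
  int (f n) @[n --> \oo] --> int f0.
Proof.
move=> mf mf0 cvf fg gi.
have [|||| f0i _ cv] := @dominated_convergence _ _ _ m setT measurableT
    (fun n x => (f n x)%:E) (EFin \o f0) (EFin \o g) _ _ _ gi.
- by move=> n; exact/measurable_EFinP.
- exact/measurable_EFinP.
- by apply: filterS cvf => x cvx _ /=; apply/fine_cvgP; split => //; exact: nearW.
- by apply: aeW => x n _ /=; rewrite lee_fin.
apply: fine_cvg => /=.
by rewrite -/(int f0) -int_EFin.
Qed.

(** Beppo Levi's theorem: the dominating function is the sum of the series,
    almost everywhere finite. *)
Lemma levi (f : nat -> T -> R) (C : R) :
  (forall k, integ (f k)) -> (forall k x, 0 <= f k x) ->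
  (forall n, \sum_(0 <= k < n) int (f k) <= C) ->
  exists G : T -> R, [/\ integ G, int G <= C &
    {ae m, forall x, forall n, \sum_(0 <= k < n) f k x <= G x}].
Proof.
move=> fi f0 fC.
pose F x := (\sum_(0 <= k <oo) (f k x)%:E)%E.
have F0 x : (0 <= F x)%E by apply: nneseries_ge0 => k _ _; rewrite lee_fin.
have mF : measurable_fun setT F.
  apply: ge0_emeasurable_sum => k.
    by move=> x _ _; rewrite lee_fin.
  by move=> _; apply/measurable_EFinP; exact: integ_meas.
have FC : (\int[m]_x F x <= C%:E)%E.
  rewrite integral_nneseries//; last 2 first.
  - by move=> k; apply/measurable_EFinP; exact: integ_meas.
  - by move=> k x _; rewrite lee_fin.
  apply: lime_le; first by apply: is_cvg_nneseries => k _ _;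
    apply: integral_ge0 => x _; rewrite lee_fin.
  apply: nearW => n; under eq_bigr do rewrite int_EFin//.
  by rewrite sumEFin lee_fin.
have Fi : m.-integrable setT F.
  apply/integrableP; split => //.
  under eq_integral do rewrite gee0_abs//.
  by rewrite (le_lt_trans FC)// ltry.
have Ffin := integrable_ae measurableT Fi.
have FE : {ae m, forall x, F x = (fine (F x))%:E}.
  by apply: filterS Ffin => x Fx; rewrite fineK//; exact: Fx.
have mG : measurable_fun setT (fun x => fine (F x)).
  by apply: measurableT_comp => //; exact: fine_measurable.
have GF : (\int[m]_x (fine (F x))%:E = \int[m]_x F x)%E.
  apply: ae_eq_integral => //; first exact/measurable_EFinP.
  by apply: filterS FE => x Fx _.
have Gi : integ (fun x => fine (F x)).
  by apply: (integrable_ae_eq Fi) => //; exact/measurable_EFinP.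
exists (fun x => fine (F x)); split=> //.
  by rewrite -lee_fin -int_EFin// GF.
apply: filterS FE => x Fx n; rewrite -lee_fin -Fx -sumEFin.
by apply: nneseries_lim_ge => k _; rewrite lee_fin.
Qed.

(** Jensen's inequality for the logarithm, from [ln x <= x / S - 1 + ln S]. *)
Lemma int_ln_le f (S : R) : 0 < S -> {ae m, forall x, 0 < f x} ->
  integ f -> integ (fun x => ln (f x)) -> int f <= S ->
  int (fun x => ln (f x)) <= ln S.
Proof.
move=> S0 f0 fi lfi fS.
have ii : integ (fun x => S^-1 * f x + (ln S - 1)).
  by apply: integD; [exact: integZ|exact: integ_cst].
apply: (@le_trans _ _ (int (fun x => S^-1 * f x + (ln S - 1)))).
  apply: le_int_ae => //; apply: filterS f0 => x fx.
  have /= := @le_ln1Dx R (S^-1 * f x - 1).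
  have Sf0 : 0 < S^-1 * f x by rewrite mulr_gt0// invr_gt0.
  have -> : 1 + (S^-1 * f x - 1) = S^-1 * f x by ring.
  rewrite lnM ?posrE// ?invr_gt0// lnV ?posrE//.
  by move=> H; have := H ltac:(lra); lra.
rewrite intD ?intZ ?int_cst//; last 2 first.
- exact: integZ.
- exact: integ_cst.
suff : S^-1 * int f <= 1 by lra.
by rewrite mulrC ler_pdivrMr// mul1r.
Qed.

Lemma ln_addl_lip (a b r : R) : 0 < r -> 0 <= a -> 0 <= b ->
  ln (a + r) <= ln (b + r) + r^-1 * `|a - b|.
Proof.
move=> r0 a0 b0.
have br : 0 < b + r by lra.
have ar : 0 < a + r by lra.
rewrite -lerBlDl -ln_div ?posrE//.
have -> : (a + r) / (b + r) = 1 + (a - b) / (b + r) by field; lra.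
apply: (le_trans (le_ln1Dx _)).
  by rewrite ltrNl -mulNr ltr_pdivrMr//; lra.
apply: (@le_trans _ _ (`|a - b| / (b + r))).
  by rewrite ler_pM2r ?invr_gt0// ler_norm.
rewrite mulrC; apply: ler_wpM2r => //.
by rewrite lef_pV2 ?posrE//; lra.
Qed.

Lemma integ_lnD f (r : R) : 0 < r -> (forall x, 0 <= f x) -> integ f ->
  integ (fun x => ln (f x + r)).
Proof.
move=> r0 f0 fi.
apply: (@integ_le _ (fun x => `|ln r| + r^-1 * f x)).
- apply: (measurableT_comp (@measurable_ln R)).
  by apply: measurable_funD => //; exact: integ_meas.
- move=> x; have fr : ln r <= ln (f x + r) by rewrite ler_ln ?posrE//; have := f0 x; lra.
  have := ln_addl_lip r0 (f0 x) (lexx 0).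
  rewrite add0r subr0 (ger0_norm (f0 x)) => fr2.
  have rf : 0 <= r^-1 * f x by rewrite mulr_ge0 ?invr_ge0// ltW.
  by rewrite ler_norml; have := ler_norm (ln r); have := ler_norm (- ln r);
    rewrite normrN; lra.
- by apply: integD; [exact: integ_cst|exact: integZ].
Qed.

(** Upper semicontinuity of the geometric mean in $L^1$: adding [r] makes the
    logarithm Lipschitz. *)
Lemma int_ln_usc f (c r : R) : 0 < r -> (forall x, 0 <= f x) -> integ f ->
  (forall e, 0 < e -> exists g, [/\ (forall x, 0 <= g x), {ae m, forall x, 0 < g x},
     integ g, integ (fun x => ln (g x)) &
     int (fun x => `|g x - f x|) <= e /\ c - e <= int (fun x => ln (g x))]) ->
  c <= int (fun x => ln (f x + r)).
Proof.
move=> r0 f0 fi H; apply/ler_addgt0Pr => e e0.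
have e'0 : 0 < e / (1 + r^-1) by rewrite divr_gt0// addr_gt0// invr_gt0.
have [g [g0 gp gi lgi [gf cg]]] := H _ e'0.
have gfi : integ (fun x => `|g x - f x|) by apply/integ_norm/integB.
have : int (fun x => ln (g x)) <=
    int (fun x => ln (f x + r) + r^-1 * `|g x - f x|).
  apply: le_int_ae => //.
    by apply: integD; [exact: integ_lnD|exact: integZ].
  apply: filterS gp => x gx.
  apply: le_trans (ln_addl_lip r0 (g0 x) (f0 x)).
  by rewrite ler_ln ?posrE//; lra.
rewrite intD ?intZ//; last 2 first.
- exact: integ_lnD.
- exact: integZ.
have ri0 : 0 < r^-1 by rewrite invr_gt0.
have : r^-1 * int (fun x => `|g x - f x|) <= r^-1 * (e / (1 + r^-1)).
  by rewrite ler_pM2l.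
have : e / (1 + r^-1) + r^-1 * (e / (1 + r^-1)) = e.
  by field; rewrite gt_eqF//= ; lra.
lra.
Qed.

(** Dominated convergence as [r] tends to [0]: for [r <= 1], the logarithm of
    [f x + r] lies between [ln (f x)] and [f x]. *)
Lemma int_ln_ge f (c : R) : (forall x, 0 < f x) ->
  integ f -> integ (fun x => ln (f x)) ->
  (forall r, 0 < r -> c <= int (fun x => ln (f x + r))) ->
  c <= int (fun x => ln (f x)).
Proof.
move=> f0 fi lfi H.
have rp n : 0 < n.+1%:R^-1 :> R by rewrite invr_gt0.
have mf n : measurable_fun setT (fun x => ln (f x + n.+1%:R^-1)).
  by apply: integ_meas; apply: integ_lnD => // x; exact: ltW.
have cv : int (fun x => ln (f x + n.+1%:R^-1)) @[n --> \oo] --> int (fun x => ln (f x)).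
  apply: (@dct (fun n x => ln (f x + n.+1%:R^-1)) _ (fun x => `|ln (f x)| + f x)) => //.
  - exact: integ_meas.
  - apply: aeW => x; have -> : ln (f x) = ln (f x + 0) by rewrite addr0.
    apply: continuous_cvg; first by apply: continuous_ln; rewrite addr0.
    by apply: cvgD; [exact: cvg_cst|exact: cvg_harmonic].
  - move=> n x; have fx := f0 x; have rn := rp n.
    have rn1 : n.+1%:R^-1 <= 1 :> R by rewrite invf_le1// ler1n.
    move: rn rn1; set e := n.+1%:R^-1 => rn rn1.
    have : ln (f x) <= ln (f x + e) by rewrite ler_ln ?posrE//; lra.
    have : ln (f x + e) <= f x.
      have -> : f x + e = 1 + (f x + e - 1) by ring.
      by apply: (le_trans (le_ln1Dx _)); lra.
    by rewrite ler_norml; have := ler_norm (ln (f x)); have := ler_norm (- ln (f x));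
      rewrite normrN; lra.
  - by apply: integD => //; exact: integ_norm.
rewrite -(cvg_lim _ cv)//; apply: limr_ge; first by apply/cvg_ex; eexists; exact: cv.
by apply: nearW => n; exact: H.
Qed.

End real_integral.

(** * Complex-valued functions *)

Section complex_modulus.
Context {R : realType}.
Implicit Types z w : R[i].

Lemma ReD z w : complex.Re (z + w) = complex.Re z + complex.Re w.
Proof. by case: z => a b; case: w. Qed.

Lemma ImD z w : complex.Im (z + w) = complex.Im z + complex.Im w.
Proof. by case: z => a b; case: w. Qed.

Lemma ReM z w :
  complex.Re (z * w) = complex.Re z * complex.Re w - complex.Im z * complex.Im w.
Proof. by case: z => a b; case: w. Qed.

Lemma ImM z w :
  complex.Im (z * w) = complex.Re z * complex.Im w + complex.Im z * complex.Re w.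
Proof. by case: z => a b; case: w. Qed.

Lemma ReN z : complex.Re (- z) = - complex.Re z.
Proof. by case: z. Qed.

Lemma ImN z : complex.Im (- z) = - complex.Im z.
Proof. by case: z. Qed.

Lemma Re_conj z : complex.Re (z^*)%C = complex.Re z.
Proof. by case: z. Qed.

Lemma Im_conj z : complex.Im (z^*)%C = - complex.Im z.
Proof. by case: z. Qed.

Lemma cabs_ge0 z : 0 <= cabs z.
Proof. by case: z => a b; exact: sqrtr_ge0. Qed.

Lemma cabs_sqr z : cabs z ^+ 2 = complex.Re z ^+ 2 + complex.Im z ^+ 2.
Proof. by case: z => a b /=; rewrite sqr_sqrtr// addr_ge0// sqr_ge0. Qed.

Lemma cabs0 : cabs (0 : R[i]) = 0. Proof. exact: ComplexField.Normc.normc0. Qed.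

Lemma cabs1 : cabs (1 : R[i]) = 1. Proof. exact: ComplexField.Normc.normc1. Qed.

Lemma cabsM z w : cabs (z * w) = cabs z * cabs w.
Proof. exact: ComplexField.Normc.normcM. Qed.

Lemma cabsV z : cabs z^-1 = (cabs z)^-1.
Proof. exact: ComplexField.Normc.normcV. Qed.

Lemma cabs_eq0 z : cabs z = 0 -> z = 0.
Proof. exact: ComplexField.Normc.eq0_normc. Qed.

Lemma cabs_gt0 z : z != 0 -> 0 < cabs z.
Proof.
move=> z0; rewrite lt_def cabs_ge0 andbT.
by apply: contra z0 => /eqP/cabs_eq0 ->.
Qed.

Lemma cabs1_neq0 z : cabs z = 1 -> z != 0.
Proof. by move=> z1; apply: contra_eq_neq z1 => ->; rewrite cabs0 eq_sym oner_eq0. Qed.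

Lemma cabsD z w : cabs (z + w) <= cabs z + cabs w.
Proof. exact: le_normcD. Qed.

Lemma cabsN z : cabs (- z) = cabs z.
Proof. exact: normcN. Qed.

Lemma cabsB z w : cabs (z - w) = cabs (w - z).
Proof. by rewrite -cabsN opprB. Qed.

Lemma cabsX z n : cabs (z ^+ n) = cabs z ^+ n.
Proof. by elim: n => [|n IH]; rewrite ?cabs1// !exprS cabsM IH. Qed.

Lemma cabs_conj z : cabs (z^*)%C = cabs z.
Proof. by case: z => a b /=; rewrite sqrrN. Qed.

Lemma cabs_real (x : R) : cabs (x%:C)%C = `|x|.
Proof. by rewrite /= expr0n addr0 sqrtr_sqr. Qed.

Lemma complexM (x y : R) : ((x * y)%:C = x%:C * y%:C)%C.
Proof. exact: rmorphM. Qed.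

Lemma complexB (x y : R) : ((x - y)%:C = x%:C - y%:C)%C.
Proof. exact: rmorphB. Qed.

Lemma mul_conj z : z * (z^*)%C = ((cabs z ^+ 2)%:C)%C.
Proof.
rewrite cabs_sqr; case: z => a b; apply/eqP; rewrite eq_complex /=.
by apply/andP; split; apply/eqP; ring.
Qed.

Lemma cabs_Re z : `|complex.Re z| <= cabs z.
Proof.
rewrite -(@ler_pXn2r _ 2) ?nnegrE ?cabs_ge0//.
by rewrite cabs_sqr real_normK ?num_real// lerDl sqr_ge0.
Qed.

Lemma cabs_Im z : `|complex.Im z| <= cabs z.
Proof.
rewrite -(@ler_pXn2r _ 2) ?nnegrE ?cabs_ge0//.
by rewrite cabs_sqr real_normK ?num_real// lerDr sqr_ge0.
Qed.

Lemma cabs_le z : cabs z <= `|complex.Re z| + `|complex.Im z|.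
Proof.
rewrite -(@ler_pXn2r _ 2) ?nnegrE ?cabs_ge0 ?addr_ge0//.
rewrite cabs_sqr -(real_normK (num_real (complex.Re z))).
rewrite -(real_normK (num_real (complex.Im z))).
have := normr_ge0 (complex.Re z); have := normr_ge0 (complex.Im z).
by move=> *; rewrite sqrrD -addrA lerD2l lerDr mulrn_wge0// mulr_ge0.
Qed.

Lemma cabsD_sub z w : cabs z <= cabs w + cabs (z - w).
Proof. by have := cabsD w (z - w); rewrite addrC subrK. Qed.

Lemma cabs_dist z w : `|cabs z - cabs w| <= cabs (z - w).
Proof.
have := cabsD_sub z w; have := cabsD_sub w z; rewrite (cabsB w).
by rewrite ler_norml; lra.
Qed.

Lemma rotation z : exists2 w, cabs w = 1 & w * z = ((cabs z)%:C)%C.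
Proof.
have [->|z0] := eqVneq z 0; first by exists 1; rewrite ?cabs1// mulr0 cabs0.
exists ((z^*)%C * ((cabs z)^-1%:C)%C).
  rewrite cabsM cabs_conj cabs_real ger0_norm ?invr_ge0 ?cabs_ge0//.
  by rewrite divff// gt_eqF// cabs_gt0.
rewrite mulrAC [_ * z]mulrC mul_conj -rmorphM/=; congr (_%:C)%C.
by rewrite expr2 -mulrA divff ?mulr1// gt_eqF// cabs_gt0.
Qed.

End complex_modulus.

Section complex_integral.
Context {d : measure_display} {T : measurableType d} {R : realType}.
Variable m : probability T R.
Implicit Types f g : T -> R[i].

Local Notation integ f := (m.-integrable setT (EFin \o f)).
Local Notation int f := (Rintegral m setT f).

Definition cmeas f := measurable_fun setT (fun x => complex.Re (f x)) /\
  measurable_fun setT (fun x => complex.Im (f x)).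

Definition cinteg f := integ (fun x => complex.Re (f x)) /\
  integ (fun x => complex.Im (f x)).

Definition cint f : R[i] := Complex (int (fun x => complex.Re (f x)))
  (int (fun x => complex.Im (f x))).

Lemma eq_cmeas f g : f =1 g -> cmeas g -> cmeas f.
Proof. by move=> /funext ->. Qed.

Lemma eq_cint f g : f =1 g -> cint f = cint g.
Proof. by move=> /funext ->. Qed.

Lemma cmeas_cst (c : R[i]) : cmeas (fun=> c).
Proof. by split; exact: measurable_cst. Qed.

Lemma cmeasD f g : cmeas f -> cmeas g -> cmeas (fun x => f x + g x).
Proof.
move=> [f1 f2] [g1 g2]; split.
  by under eq_fun do rewrite ReD; exact: measurable_funD.
by under eq_fun do rewrite ImD; exact: measurable_funD.
Qed.

Lemma cmeasM f g : cmeas f -> cmeas g -> cmeas (fun x => f x * g x).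
Proof.
move=> [f1 f2] [g1 g2]; split.
  by under eq_fun do rewrite ReM; apply: measurable_funB; exact: measurable_funM.
by under eq_fun do rewrite ImM; apply: measurable_funD; exact: measurable_funM.
Qed.

Lemma cmeasX f n : cmeas f -> cmeas (fun x => f x ^+ n).
Proof.
move=> mf; elim: n => [|n IH]; first by under eq_fun do rewrite expr0;
  exact: cmeas_cst.
by under eq_fun do rewrite exprS; exact: cmeasM.
Qed.

Lemma cmeasN f : cmeas f -> cmeas (fun x => - f x).
Proof.
move=> [f1 f2]; split.
  by under eq_fun do rewrite ReN; exact: measurableT_comp.
by under eq_fun do rewrite ImN; exact: measurableT_comp.
Qed.

Lemma cmeasB f g : cmeas f -> cmeas g -> cmeas (fun x => f x - g x).
Proof. by move=> mf mg; apply: cmeasD => //; exact: cmeasN. Qed.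

Lemma cmeas_conj f : cmeas f -> cmeas (fun x => (f x)^*%C).
Proof.
move=> [f1 f2]; split.
  by under eq_fun do rewrite Re_conj.
by under eq_fun do rewrite Im_conj; exact: measurableT_comp.
Qed.

Lemma cmeas_real (f : T -> R) : measurable_fun setT f -> cmeas (fun x => (f x)%:C%C).
Proof. by move=> mf; split => //=; exact: measurable_cst. Qed.

Lemma cmeas_cabs f : cmeas f -> measurable_fun setT (fun x => cabs (f x)).
Proof.
move=> [f1 f2].
rewrite (_ : (fun x => _) =
  (fun x => Num.sqrt (complex.Re (f x) ^+ 2 + complex.Im (f x) ^+ 2))).
  apply: measurableT_comp; first exact: (continuous_measurable_fun (@sqrt_continuous R)).
  by apply: measurable_funD; exact: measurable_funX.
by apply/funext => x; case: (f x).
Qed.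

Lemma cinteg_meas f : cinteg f -> cmeas f.
Proof. by move=> [f1 f2]; split; [exact: integ_meas f1|exact: integ_meas f2]. Qed.

Lemma cinteg_le f (g : T -> R) : cmeas f -> (forall x, cabs (f x) <= g x) ->
  integ g -> cinteg f.
Proof.
move=> [f1 f2] fg gi; split; apply: integ_le gi => // x.
  exact: le_trans (cabs_Re _) (fg x).
exact: le_trans (cabs_Im _) (fg x).
Qed.

Lemma cinteg_bnd f (B : R) : cmeas f -> (forall x, cabs (f x) <= B) -> cinteg f.
Proof. by move=> mf fB; apply: (cinteg_le mf fB); exact: integ_cst. Qed.

Lemma cinteg_cabs f : cinteg f -> integ (fun x => cabs (f x)).
Proof.
move=> fi; have [f1 f2] := fi.
apply: (integ_le (g := fun x => `|complex.Re (f x)| + `|complex.Im (f x)|)).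
- by apply: cmeas_cabs; exact: cinteg_meas.
- by move=> x; rewrite ger0_norm ?cabs_ge0// cabs_le.
- by apply: integD; exact: integ_norm.
Qed.

Lemma cinteg_cst (c : R[i]) : cinteg (fun=> c).
Proof. by split; exact: integ_cst. Qed.

Lemma cintegD f g : cinteg f -> cinteg g -> cinteg (fun x => f x + g x).
Proof.
move=> [f1 f2] [g1 g2]; split.
  by under eq_fun do rewrite ReD; exact: integD.
by under eq_fun do rewrite ImD; exact: integD.
Qed.

Lemma cintegZ (c : R[i]) f : cinteg f -> cinteg (fun x => c * f x).
Proof.
move=> [f1 f2]; split.
  by under eq_fun do rewrite ReM; apply: integB; exact: integZ.
by under eq_fun do rewrite ImM; apply: integD; exact: integZ.
Qed.

Lemma cintegB f g : cinteg f -> cinteg g -> cinteg (fun x => f x - g x).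
Proof.
move=> fi gi; have := cintegD fi (cintegZ (-1) gi).
by under eq_fun do rewrite mulN1r.
Qed.

Lemma cintD f g : cinteg f -> cinteg g ->
  cint (fun x => f x + g x) = cint f + cint g.
Proof.
move=> [f1 f2] [g1 g2]; apply/eqP; rewrite eq_complex /=.
under eq_fun do rewrite ReD; under [X in _ && (Rintegral _ _ X == _)]eq_fun do rewrite ImD.
by rewrite !intD ?eqxx.
Qed.

Lemma cintZ (c : R[i]) f : cinteg f -> cint (fun x => c * f x) = c * cint f.
Proof.
move=> [f1 f2]; apply/eqP; rewrite eq_complex /= ReM ImM /=.
under eq_fun do rewrite ReM; under [X in _ && (Rintegral _ _ X == _)]eq_fun do rewrite ImM.
by rewrite intB ?intD ?intZ ?eqxx//; exact: integZ.
Qed.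

Lemma cintB f g : cinteg f -> cinteg g ->
  cint (fun x => f x - g x) = cint f - cint g.
Proof.
move=> fi gi; rewrite -[- cint g]mulN1r -cintZ// -cintD//; last exact: cintegZ.
by congr cint; apply/funext => x; rewrite mulN1r.
Qed.

Lemma cint_cst (c : R[i]) : cint (fun=> c) = c.
Proof. by apply/eqP; rewrite eq_complex /= !int_cst !eqxx. Qed.

Lemma cinteg_sum (J : Type) (s : seq J) (F : J -> T -> R[i]) :
  (forall j, cinteg (F j)) -> cinteg (fun x => \sum_(j <- s) F j x).
Proof.
move=> iF; elim: s => [|j s IH].
  by under eq_fun do rewrite big_nil; exact: cinteg_cst.
by under eq_fun do rewrite big_cons; exact: cintegD.
Qed.

Lemma cint_sum (J : Type) (s : seq J) (F : J -> T -> R[i]) :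
  (forall j, cinteg (F j)) ->
  cint (fun x => \sum_(j <- s) F j x) = \sum_(j <- s) cint (F j).
Proof.
move=> iF; elim: s => [|j s IH].
  by under eq_fun do rewrite big_nil; rewrite cint_cst big_nil.
under eq_fun do rewrite big_cons.
by rewrite cintD ?IH ?big_cons//; exact: cinteg_sum.
Qed.

Lemma cabs_cint_le f : cinteg f -> cabs (cint f) <= int (fun x => cabs (f x)).
Proof.
move=> fi; have [w w1 wE] := rotation (cint f).
have -> : cabs (cint f) = complex.Re (w * cint f) by rewrite wE.
rewrite -cintZ//=; have [wf _] := cintegZ w fi.
apply: le_int => //; first exact: cinteg_cabs.
move=> x; apply: le_trans (ler_norm _) _; apply: le_trans (cabs_Re _) _.
by rewrite cabsM w1 mul1r.
Qed.

End complex_integral.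

(** * Haar measure and characters *)

Section torus_measurability.
Context {R : realType}.
Implicit Types z w : torus R.

Definition coord n z : R[i] := sval (z n).

Lemma cabs_coord n z : cabs (coord n z) = 1.
Proof. exact/eqP/(svalP (z n)). Qed.

Lemma coord_neq0 n z : coord n z != 0.
Proof. exact/cabs1_neq0/cabs_coord. Qed.

Lemma coord_mul n w z : coord n (torus_mul w z) = coord n w * coord n z.
Proof. by []. Qed.

Lemma cylinder_measurable n (B : set (R * R)) : measurable B ->
  measurable [set z : torus R | B (complex.Re (sval (z n)), complex.Im (sval (z n)))].
Proof. by move=> mB; apply: sub_gen_smallest; exists n, B. Qed.

Lemma cmeas_coord n : cmeas (coord n).
Proof.
split=> _ Y mY; rewrite setTI.
- apply: (@cylinder_measurable n (fst @^-1` Y)).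
  by rewrite -[X in measurable X]setTI; exact: measurable_fst.
- apply: (@cylinder_measurable n (snd @^-1` Y)).
  by rewrite -[X in measurable X]setTI; exact: measurable_snd.
Qed.

Lemma measurable_to_torus d (T : measurableType d) (f : T -> torus R) :
  (forall n, cmeas (fun x => coord n (f x))) -> measurable_fun setT f.
Proof.
move=> mf; apply: (@measurability _ _ T (torus R) setT f (@cylinder R)) => //.
move=> _ [_ [n [B [mB ->]]]] <-.
have [mf1 mf2] := mf n.
exact: (measurable_fun_pair mf1 mf2 measurableT mB).
Qed.

Lemma measurable_torus_mul w : measurable_fun setT (torus_mul w).
Proof.
apply: measurable_to_torus => n.
exact: (cmeasM (cmeas_cst (coord n w)) (cmeas_coord n)).
Qed.

Lemma measurable_torus_mul2 :
  measurable_fun setT (fun zw : torus R * torus R => torus_mul zw.2 zw.1).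
Proof.
apply: measurable_to_torus => n; have [m1 m2] := cmeas_coord n.
apply: (cmeasM (f := fun zw => coord n zw.2) (g := fun zw => coord n zw.1)); split.
- exact: (measurableT_comp m1 measurable_snd).
- exact: (measurableT_comp m2 measurable_snd).
- exact: (measurableT_comp m1 measurable_fst).
- exact: (measurableT_comp m2 measurable_fst).
Qed.

Lemma torus_mulC z w : torus_mul z w = torus_mul w z.
Proof. by apply/funext => n; apply/val_inj => /=; rewrite mulrC. Qed.

End torus_measurability.

Section haar.
Context {R : realType}.
Variables (m : probability (torus R) R) (hm : is_haar m).
Local Notation integ f := (m.-integrable setT (EFin \o f)).
Local Notation int f := (Rintegral m setT f).

Lemma ge0_integral_mul (w : torus R) (f : torus R -> \bar R) :
  measurable_fun setT f -> (forall z, 0 <= f z)%E ->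
  (\int[m]_z f (torus_mul w z) = \int[m]_z f z)%E.
Proof.
move=> mf f0.
have := ge0_integral_pushforward (measurable_torus_mul w) m measurableT mf (fun z _ => f0 z).
rewrite preimage_setT => <-; apply: eq_measure_integral => [|mw A mA _].
  exact: measurable_torus_mul.
exact: (hm w mA).
Qed.

Lemma integ_mul (w : torus R) (f : torus R -> R) : integ f ->
  integ (fun z => f (torus_mul w z)).
Proof.
move=> /integrableP[mf fi]; apply/integrableP; split.
  exact: (measurableT_comp mf (measurable_torus_mul w)).
rewrite (ge0_integral_mul w (f := fun z => `|(f z)%:E|%E))//.
exact: measurableT_comp.
Qed.

Lemma int_mul (w : torus R) (f : torus R -> R) : integ f ->
  int (fun z => f (torus_mul w z)) = int f.
Proof.
move=> fi; congr fine; have mf := measurable_int _ fi.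
have := integral_pushforward (measurable_torus_mul w) mf (integ_mul w fi) measurableT.
rewrite preimage_setT => <-; apply: eq_measure_integral => [|mw A mA _].
  exact: measurable_torus_mul.
exact: (hm w mA).
Qed.

Lemma cinteg_mul (w : torus R) (f : torus R -> R[i]) : cinteg m f ->
  cinteg m (fun z => f (torus_mul w z)).
Proof. by move=> [f1 f2]; split; [exact: integ_mul f1|exact: integ_mul f2]. Qed.

Lemma cint_mul (w : torus R) (f : torus R -> R[i]) : cinteg m f ->
  cint m (fun z => f (torus_mul w z)) = cint m f.
Proof. by move=> [f1 f2]; congr Complex; [exact: int_mul f1|exact: int_mul f2]. Qed.

End haar.

Section characters.
Context {R : realType}.
Implicit Types (z w : torus R) (a b : nat -> int).

Definition supp_below N a := forall i, (N <= i)%N -> a i = 0.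

(** [N] bounds the support of the exponents, which makes the product finite; by
    [chi_widen] two characters can always be written with a common bound. *)
Definition chi N a z : R[i] := \prod_(0 <= i < N) coord i z ^ a i.

Lemma cabs_expz (x : R[i]) (n : int) : cabs x = 1 -> cabs (x ^ n) = 1.
Proof.
by move=> x1; case: n => n /=; rewrite ?NegzE -?exprnN ?cabsV cabsX x1 expr1n ?invr1.
Qed.

Lemma cabs_chi N a z : cabs (chi N a z) = 1.
Proof.
rewrite /chi; elim/big_rec: _ => [|i x _ x1]; first exact: cabs1.
by rewrite cabsM x1 mulr1 cabs_expz// cabs_coord.
Qed.

Lemma chi_neq0 N a z : chi N a z != 0.
Proof. exact/cabs1_neq0/cabs_chi. Qed.

Lemma chi_widen N M a z : (N <= M)%N -> supp_below N a -> chi M a z = chi N a z.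
Proof.
move=> NM sa; rewrite /chi (big_cat_nat (n := N))//=.
rewrite [X in _ * X](_ : _ = 1) ?mulr1// big_nat big1// => i /andP[Ni _].
by rewrite sa// expr0z.
Qed.

Lemma chiD N a b z : chi N (fun i => a i + b i) z = chi N a z * chi N b z.
Proof.
rewrite /chi -big_split/=; apply: eq_bigr => i _.
by rewrite expfzDr// coord_neq0.
Qed.

Lemma chi0 N a z : (forall i, a i = 0) -> chi N a z = 1.
Proof. by move=> a0; rewrite /chi big1// => i _; rewrite a0 expr0z. Qed.

Lemma chi_mul N a w z : chi N a (torus_mul w z) = chi N a w * chi N a z.
Proof.
rewrite /chi -big_split/=; apply: eq_bigr => i _.
by rewrite coord_mul expfzMl.
Qed.

Lemma chi_conj N a z : (chi N a z)^*%C = chi N (fun i => - a i) z.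
Proof.
apply: (mulfI (chi_neq0 N a z)); rewrite mul_conj cabs_chi expr1n -chiD.
by rewrite chi0// => i; rewrite subrr.
Qed.

Lemma cmeas_chi N a : cmeas (chi N a).
Proof.
elim: N => [|N IH].
  by apply: (eq_cmeas (g := fun=> 1)); [move=> z; rewrite /chi big_nil|exact: cmeas_cst].
apply: (eq_cmeas (g := fun z => chi N a z * coord N z ^ a N)).
  by move=> z; rewrite /chi big_nat_recr.
apply: cmeasM => //; case: (a N) => k.
  by apply: cmeasX; exact: cmeas_coord.
apply: (eq_cmeas (g := fun z => (coord N z ^+ k.+1)^*%C)) => [z|].
  have z1 : cabs (coord N z ^+ k.+1) = 1 by rewrite cabsX cabs_coord expr1n.
  have z0 : coord N z ^+ k.+1 != 0 by rewrite expf_neq0// coord_neq0.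
  by apply: (mulfI z0); rewrite mul_conj z1 expr1n NegzE -exprnN divff.
by apply/cmeas_conj/cmeasX; exact: cmeas_coord.
Qed.

Variables (m : probability (torus R) R) (hm : is_haar m).

Lemma cinteg_chi N a : cinteg m (chi N a).
Proof.
by apply: (@cinteg_bnd _ _ _ _ _ 1); [exact: cmeas_chi|move=> z; rewrite cabs_chi].
Qed.

Definition torus_at i (x : circle R) : torus R :=
  fun j => if j == i then x else circle1 R.

(** Translating coordinate [i] by a root of [-1] of order [`|a i|] changes the
    sign of the character and preserves the integral. *)
Lemma cint_chi0 N a : supp_below N a -> (exists i, a i != 0) ->
  cint m (chi N a) = 0.
Proof.
move=> sa [i ai0].
have iN : (i < N)%N by rewrite ltnNge; apply: contra ai0 => Ni; rewrite sa.
pose k := `|a i|%N; have k0 : (0 < k)%N by rewrite absz_gt0.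
pose x : R[i] := k.-root (-1).
have xk : x ^+ k = -1 by rewrite /x rootCK.
have x1 : cabs x == 1.
  have := congr1 (fun u => cabs u) xk; rewrite cabsX cabsN cabs1 => /eqP.
  by rewrite pexpr_eq1// ?cabs_ge0.
pose w := torus_at i (exist _ x x1).
have cw : chi N a w = -1.
  rewrite /chi (bigD1_seq i)//= ?mem_index_iota ?iota_uniq//.
  rewrite big1 ?mulr1; last first.
    by move=> j ji; rewrite /coord /w /torus_at (negPf ji)/= exp1rz.
  rewrite /coord /w /torus_at eqxx/=.
  by move: xk; rewrite /k; case: (a i) => n //=; rewrite ?NegzE -?exprnN /= => ->;
    rewrite ?invrN ?invr1.
have := cint_mul hm w (cinteg_chi N a).
rewrite (eq_cint m (g := fun z => -1 * chi N a z)); last first.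
  by move=> z; rewrite chi_mul cw.
rewrite cintZ; last exact: cinteg_chi.
move=> /eqP; rewrite mulN1r eq_sym -addr_eq0 -mulr2n mulrn_eq0/= => /eqP //.
Qed.

End characters.

(** * The logarithmic series *)

Section log_series.
Context {R : realType}.
Implicit Types x y : R.

Definition log_series n y : R := \sum_(0 <= k < n) y ^+ k.+1 / k.+1%:R.

Lemma is_derive_log_series n x :
  is_derive x 1 (log_series n) (\sum_(0 <= k < n) x ^+ k).
Proof.
elim: n => [|n IH].
  rewrite big_nil (_ : log_series 0 = cst 0); first exact: is_derive_cst.
  by apply/funext => y; rewrite /log_series big_nil.
rewrite big_nat_recr//=.
rewrite (_ : log_series n.+1 = log_series n + (n.+1%:R^-1 \*: (id ^+ n.+1))).
  apply: is_deriveD => //.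
  have -> : x ^+ n = n.+1%:R^-1 *: ((n.+1%:R * x ^+ n) *: (1 : R)).
    by rewrite /GRing.scale/= mulr1 mulrA mulVf ?mul1r.
  by apply: is_deriveZ; exact: is_deriveX.
apply/funext => y; rewrite [LHS]/log_series big_nat_recr//= mulrC.
rewrite -/(log_series n y) [RHS]/GRing.add/=; congr (_ + _).
by rewrite /GRing.scale/= exprfctE.
Qed.

(** Mean value theorem: the remainder has derivative $x^n/(1-x)$ and vanishes
    at [0]. *)
Lemma log_series_remainder n y : 0 <= y < 1 ->
  exists2 c, 0 <= c <= y & - ln (1 - y) - log_series n y = c ^+ n / (1 - c) * y.
Proof.
move=> /andP[y0 y1].
pose F x := - ln (1 - x) - log_series n x.
have dF x : x < 1 -> is_derive x 1 F (x ^+ n / (1 - x)).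
  move=> x1; have x10 : 0 < 1 - x by lra.
  have -> : x ^+ n / (1 - x) = - ((1 - x)^-1 * (-1)) - \sum_(0 <= k < n) x ^+ k.
    have /(congr1 (fun u => u / (x - 1))) := subrX1 x n.
    rewrite mulrAC divff ?mul1r; last by lra.
    by rewrite big_mkord => <-; field; lra.
  apply: is_deriveB; last exact: is_derive_log_series.
  apply: is_deriveN; apply: (@is_derive1_comp _ (@ln R) (fun x => 1 - x)).
    exact: is_derive1_ln.
  rewrite -[X in is_derive _ _ _ X]add0r.
  by apply: is_deriveB.
have [x /[!in_itv]/= /andP[x0 xy]||c] := @MVT_segment R F (fun x => x ^+ n / (1 - x)) 0 y y0.
- by apply: dF; exact: lt_trans xy y1.
- apply: derivable_within_continuous => x /[!in_itv]/= /andP[x0 xy].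
  by have := dF x (le_lt_trans xy y1); case.
rewrite in_itv/= => /andP[c0 cy] E; exists c; first by rewrite c0 cy.
move: E; rewrite [y - 0]subr0 /F [1 - 0]subr0 ln1 (_ : log_series n 0 = 0).
  by rewrite !(oppr0, addr0).
by rewrite /log_series big1// => k _; rewrite expr0n mul0r.
Qed.

Lemma log_series_le n y : 0 <= y < 1 -> log_series n y <= - ln (1 - y).
Proof.
move=> y01; rewrite -subr_ge0; have [c /andP[c0 cy] ->] := log_series_remainder n y01.
by case/andP: y01 => y0 y1; rewrite !mulr_ge0 ?exprn_ge0 ?invr_ge0//; lra.
Qed.

Lemma log_series_sup y (B : R) : 0 <= y < 1 ->
  (forall n, log_series n y <= B) -> - ln (1 - y) <= B.
Proof.
move=> y01 H; have /andP[y0 y1] := y01.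
have cv : B + y ^+ n / (1 - y) @[n --> \oo] --> B + 0 / (1 - y).
  apply: cvgD; first exact: cvg_cst.
  by apply: cvgMl; apply: cvg_expr; rewrite ger0_norm.
rewrite (_ : B = B + 0 / (1 - y)); last by rewrite mul0r addr0.
rewrite -(cvg_lim _ cv)//.
apply: limr_ge; first by apply/cvg_ex; eexists; exact: cv.
apply: nearW => n; have := H n.
have [c /andP[c0 cy]] := log_series_remainder n y01.
have : c ^+ n / (1 - c) * y <= y ^+ n / (1 - y).
  rewrite -[leRHS]mulr1 ler_pM ?mulr_ge0 ?exprn_ge0 ?invr_ge0//; [lra| |exact: ltW].
  rewrite ler_pM ?exprn_ge0 ?invr_ge0//; [lra| |].
    by rewrite lerXn2r// nnegrE.
  by rewrite lef_pV2 ?posrE; lra.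
lra.
Qed.

(** At [1] the partial sums are those of the divergent harmonic series. *)
Lemma log_series1_unbounded (B : R) : ~ forall n, log_series n 1 <= B.
Proof.
move=> H; apply: (@dvg_harmonic R).
apply: nondecreasing_is_cvgn.
  by apply/nondecreasing_seqP => n; rewrite /series/= big_nat_recr//= lerDl invr_ge0.
exists B => _ [n _ <-]; apply: le_trans (H n); rewrite /series/= /log_series.
by apply: ler_sum => k _; rewrite expr1n mul1r.
Qed.

End log_series.

(** * Half-spaces of frequencies and Jensen's inequality *)

Section span.
Context {R : realType}.
Implicit Types (P Q S : set (nat -> int)) (f g : torus R -> R[i]).

(** The trigonometric polynomials with frequencies in [P], generated from the
    characters so that inductions run over the terms. *)
Inductive span P : (torus R -> R[i]) -> Prop :=
| span_zero : span P (fun=> 0)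
| span_cons c N a f : supp_below N a -> P a -> span P f ->
    span P (fun z => c * chi N a z + f z).

Lemma eq_span P f g : f =1 g -> span P f -> span P g.
Proof. by move=> /funext ->. Qed.

Lemma span_chi P N a : supp_below N a -> P a -> span P (chi N a).
Proof.
move=> sa Pa; apply: eq_span (span_cons 1 sa Pa (span_zero P)) => z.
by rewrite mul1r addr0.
Qed.

Lemma span_sub P Q f : P `<=` Q -> span P f -> span Q f.
Proof.
move=> PQ; elim=> [|c N a g sa Pa _ IH]; first exact: span_zero.
by apply: span_cons => //; exact: PQ.
Qed.

Lemma spanD P f g : span P f -> span P g -> span P (fun z => f z + g z).
Proof.
move=> Pf Pg; elim: Pf => [|c N a h sa Pa _ IH].
  by apply: eq_span Pg => z; rewrite add0r.
by apply: eq_span (span_cons c sa Pa IH) => z; rewrite addrA.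
Qed.

Lemma spanZ P (c : R[i]) f : span P f -> span P (fun z => c * f z).
Proof.
elim=> [|c' N a h sa Pa _ IH].
  by apply: eq_span (span_zero P) => z; rewrite mulr0.
by apply: eq_span (span_cons (c * c') sa Pa IH) => z; rewrite mulrDr mulrA.
Qed.

Lemma spanB P f g : span P f -> span P g -> span P (fun z => f z - g z).
Proof.
move=> Pf Pg; apply: eq_span (spanD Pf (spanZ (-1) Pg)) => z.
by rewrite mulN1r.
Qed.

Lemma span_sum P (J : Type) (s : seq J) (F : J -> torus R -> R[i]) :
  (forall j, span P (F j)) -> span P (fun z => \sum_(j <- s) F j z).
Proof.
move=> PF; elim: s => [|j s IH].
  by apply: eq_span (span_zero P) => z; rewrite big_nil.
by apply: eq_span (spanD (PF j) IH) => z; rewrite big_cons.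
Qed.

Lemma span_cst P (c : R[i]) : P (fun=> 0) -> span P (fun=> c).
Proof.
move=> P0; apply: (eq_span (f := fun z => c * chi 0 (fun=> 0) z)).
  by move=> z; rewrite chi0// mulr1.
by apply/spanZ/span_chi.
Qed.

Lemma spanM P Q S f g : (forall a b, P a -> Q b -> S (fun i => a i + b i)) ->
  span P f -> span Q g -> span S (fun z => f z * g z).
Proof.
move=> PQS Pf Qg; elim: Pf => [|c N a h sa Pa _ IH].
  by apply: eq_span (span_zero S) => z; rewrite mul0r.
apply: (eq_span (f := fun z => c * (chi N a z * g z) + h z * g z)).
  by move=> z; rewrite mulrDl mulrA.
apply: spanD => //; apply: spanZ.
elim: Qg {IH} => [|c' M b k sb Qb _ IH].
  by apply: eq_span (span_zero S) => z; rewrite mulr0.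
apply: (eq_span (f := fun z => c' * chi (maxn N M) (fun i => a i + b i) z + chi N a z * k z)).
  move=> z; rewrite chiD (chi_widen _ (leq_maxl N M) sa) (chi_widen _ (leq_maxr N M) sb).
  by rewrite mulrDr mulrCA.
apply: span_cons => //; last exact: PQS.
move=> i; rewrite geq_max => /andP[Ni Mi].
by rewrite sa// sb// addr0.
Qed.

Lemma span_conj P f : span P f -> span [set a | P (fun i => - a i)] (fun z => (f z)^*%C).
Proof.
elim=> [|c N a h sa Pa _ IH].
  by apply: eq_span (span_zero _) => z; rewrite conjc0.
apply: (eq_span (f := fun z => c^*%C * chi N (fun i => - a i) z + (h z)^*%C)).
  by move=> z; rewrite -chi_conj -rmorphM -rmorphD.
apply: span_cons => //=; first by move=> i Ni; rewrite sa// oppr0.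
by rewrite (_ : (fun i => - - a i) = a)//; apply/funext => i; rewrite opprK.
Qed.

Lemma cmeas_span P f : span P f -> cmeas f.
Proof.
elim=> [|c N a h sa Pa _ IH]; first exact: cmeas_cst.
by apply: cmeasD => //; apply: cmeasM; [exact: cmeas_cst|exact: cmeas_chi].
Qed.

Lemma span_bounded P f : span P f -> exists2 B, 0 < B & forall z, cabs (f z) <= B.
Proof.
elim=> [|c N a h sa Pa _ [B B0 hB]]; first by exists 1 => // z; rewrite cabs0.
exists (cabs c + B); first by rewrite ltr_wpDl// cabs_ge0.
move=> z; apply: le_trans (cabsD _ _) _; apply: lerD => //.
by rewrite cabsM cabs_chi mulr1.
Qed.

Variables (m : probability (torus R) R) (hm : is_haar m).

Lemma cinteg_span P f : span P f -> cinteg m f.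
Proof.
move=> Pf; have [B _ fB] := span_bounded Pf.
exact: cinteg_bnd (cmeas_span Pf) fB.
Qed.

Lemma cint_span0 P f : (forall a, P a -> exists i, a i != 0) -> span P f ->
  cint m f = 0.
Proof.
move=> P0; elim=> [|c N a h sa Pa Ph IH]; first exact: cint_cst.
rewrite cintD; last 2 first.
- by apply/cintegZ/cinteg_chi.
- exact: cinteg_span Ph.
rewrite cintZ; last exact: cinteg_chi.
by rewrite IH cint_chi0 ?mulr0 ?addr0//; exact: P0.
Qed.

End span.

Notation trig := (span setT).

(** On finitely supported exponents, the positive cone of a total order
    compatible with addition. With its frequencies in such a cone, a function
    behaves like an analytic function of one variable vanishing at [0]. *)
Record half_space (P : set (nat -> int)) : Prop := HalfSpace {
  half_spaceD : forall a b, P a -> P b -> P (fun i => a i + b i) ;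
  half_space_neq0 : forall a, P a -> exists i, a i != 0 ;
  half_space_total : forall N a, supp_below N a ->
    [\/ forall i, a i = 0, P a | P (fun i => - a i)] }.

Section jensen.
Context {R : realType}.
Variables (m : probability (torus R) R) (hm : is_haar m).
Variables (P : set (nat -> int)) (hP : half_space P).
Local Notation integ f := (m.-integrable setT (EFin \o f)).
Local Notation int f := (Rintegral m setT f).
Implicit Types (t q phi : torus R -> R[i]).

Lemma cabs_1DX_le (w : R[i]) n : (0 < n)%N ->
  cabs (1 + (n%:R^-1)%:C%C * w) ^+ n <=
  expR (complex.Re w + n%:R^-1 * (cabs w ^+ 2 / 2)).
Proof.
move=> n0; set u := (n%:R^-1)%:C%C * w.
have nR : 0 < n%:R :> R by rewrite ltr0n.
have ReU : complex.Re u = n%:R^-1 * complex.Re w.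
  by rewrite /u ReM /= mul0r subr0.
have cu : cabs u = n%:R^-1 * cabs w.
  by rewrite /u cabsM cabs_real ger0_norm// invr_ge0 ltW.
have : cabs (1 + u) <= expR (complex.Re u + cabs u ^+ 2 / 2).
  rewrite -(@ler_pXn2r _ 2) ?nnegrE ?cabs_ge0 ?expR_ge0// -expRM_natl.
  apply: le_trans (expR_ge1Dx _).
  by rewrite !cabs_sqr ReD ImD/=; lra.
move=> /(@lerXn2r _ n) -/(_ _ _)/=; rewrite !nnegrE cabs_ge0 expR_ge0 => /(_ isT isT).
move=> /le_trans; apply; rewrite -expRM_natl ReU cu ler_expR.
by apply: eq_ler; field; rewrite gt_eqF.
Qed.

Lemma span1M q t : span P q -> span P t ->
  span P (fun z => (1 + q z) * (1 + t z) - 1).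
Proof.
move=> Pq Pt; apply: (eq_span (f := fun z => q z + (t z + q z * t z))).
  by move=> z; ring.
apply: spanD => //; apply: spanD => //; apply: spanM Pq Pt.
exact: half_spaceD hP.
Qed.

Lemma cint_1D q : span P q -> cint m (fun z => 1 + q z) = 1.
Proof.
move=> Pq; rewrite cintD; [|exact: cinteg_cst|exact: cinteg_span Pq].
rewrite cint_cst (cint_span0 hm _ Pq) ?addr0//; exact: half_space_neq0 hP.
Qed.

(** The product [(1 + q) (1 + phi / n) ^+ n] has integral [1], and
    [`|1 + phi / n| ^+ n] is at most [expR (Re phi)] in the limit. *)
Lemma int_exp_ge1 q phi : span P q -> span P phi ->
  1 <= int (fun z => cabs (1 + q z) * expR (complex.Re (phi z))).
Proof.
move=> Pq Pphi; have [B B0 phiB] := span_bounded Pphi.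
have [D D0 qD] := span_bounded Pq.
set X := int _.
have mphi : measurable_fun setT (fun z => expR (complex.Re (phi z))).
  by have [mr _] := cmeas_span Pphi; apply: measurableT_comp.
have mq : measurable_fun setT (fun z => cabs (1 + q z)).
  by apply/cmeas_cabs/cmeasD; [exact: cmeas_cst|exact: cmeas_span Pq].
have iX : integ (fun z => cabs (1 + q z) * expR (complex.Re (phi z))).
  apply: (@integ_bnd _ _ _ _ _ ((1 + D) * expR B)); first exact: measurable_funM.
  move=> z; rewrite ger0_norm ?mulr_ge0 ?cabs_ge0 ?expR_ge0//.
  apply: ler_pM; rewrite ?cabs_ge0 ?expR_ge0//.
    by rewrite (le_trans (cabsD _ _))// cabs1 lerD2l.
  by rewrite ler_expR (le_trans (ler_norm _))// (le_trans (cabs_Re _)).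
have key n : (0 < n)%N -> 1 <= expR (n%:R^-1 * (B ^+ 2 / 2)) * X.
  move=> n0; have nR : 0 < n%:R :> R by rewrite ltr0n.
  pose u z := (n%:R^-1)%:C%C * phi z.
  have Pu k : span P (fun z => (1 + q z) * (1 + u z) ^+ k - 1).
    elim: k => [|k IH].
      by apply: eq_span Pq => z; rewrite expr0 mulr1 addrAC subrr add0r.
    apply: eq_span (span1M IH (spanZ (n%:R^-1)%:C%C Pphi)) => z.
    by rewrite /u exprSr; ring.
  have E : cint m (fun z => (1 + q z) * (1 + u z) ^+ n) = 1.
    rewrite -[RHS](cint_1D (Pu n)); apply: eq_cint => z.
    by rewrite [RHS]addrC subrK.
  have iE : cinteg m (fun z => (1 + q z) * (1 + u z) ^+ n).
    have := cintegD (cinteg_cst m 1) (cinteg_span m (Pu n)).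
    by congr cinteg; apply/funext => z /=; rewrite addrC subrK.
  have := cabs_cint_le iE; rewrite E cabs1 => /le_trans; apply.
  rewrite -intZ//; apply: le_int; [exact: cinteg_cabs|exact: integZ|] => z.
  rewrite cabsM cabsX mulrCA ler_wpM2l ?cabs_ge0// -expRD.
  apply: le_trans (cabs_1DX_le (phi z) n0) _.
  rewrite ler_expR addrC lerD2r ler_pM2l ?invr_gt0// ler_pM2r// lerXn2r//.
  - by rewrite nnegrE cabs_ge0.
  - by rewrite nnegrE ltW.
have X0 : 0 < X.
  by have := lt_le_trans ltr01 (key 1%N isT); rewrite pmulr_rgt0 ?expR_gt0.
apply/ler_addgt0Pr => e e0.
pose b := B ^+ 2 / 2; have b0 : 0 <= b by rewrite divr_ge0// sqr_ge0.
(* Large enough for the factor [expR (b / n)] to be at most [expR e]. *)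
pose n := (Num.truncn (b / e)).+1.
have nR : 0 < n%:R :> R by rewrite ltr0n.
have bn : b / e < n%:R by rewrite truncnS_gt.
have be : n%:R^-1 * b <= e.
  by rewrite mulrC ler_pdivrMr// mulrC -ler_pdivrMr// ltW.
have : expR (- (n%:R^-1 * b)) <= X.
  rewrite expRN -[leRHS]mul1r -[leRHS]mulrC.
  by rewrite -[leLHS]mul1r ler_pdivrMr ?expR_gt0// mulr1 mulrC key.
have := expR_ge1Dx (- (n%:R^-1 * b)); lra.
Qed.

(** Conjugation exchanges a frequency with its opposite without changing real
    parts, so negative frequencies can be moved into the half-space. *)
Lemma Re_trig t : trig t -> exists2 phi, span P phi &
  forall z, complex.Re (t z) = complex.Re (cint m t) + complex.Re (phi z).
Proof.
move=> Tt; have [c [phi Pphi E]] : exists c : R, exists2 phi, span P phi &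
    forall z, complex.Re (t z) = c + complex.Re (phi z).
  elim: Tt => [|c N a h sa _ _ [c' [phi Pphi E]]].
    by exists 0, (fun=> 0); [exact: span_zero|move=> z; rewrite add0r].
  have [a0|Pa|Pa] := half_space_total hP sa.
  - exists (complex.Re c + c'), phi => // z.
    by rewrite chi0// mulr1 ReD E addrA.
  - exists c', (fun z => c * chi N a z + phi z); first exact: span_cons.
    by move=> z; rewrite !ReD E addrCA.
  - exists c', (fun z => c^*%C * chi N (fun i => - a i) z + phi z).
      by apply: span_cons => // i Ni; rewrite sa// oppr0.
    by move=> z; rewrite -chi_conj -rmorphM !ReD Re_conj E addrCA.
exists phi => // z; rewrite E; congr (_ + _).
rewrite /cint/= (_ : (fun z => _) = (fun z => c + complex.Re (phi z))); last exact/funext.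
have [i1 _] := cinteg_span m Pphi.
rewrite intD//; last exact: integ_cst.
rewrite int_cst; have := cint_span0 hm (half_space_neq0 hP) Pphi.
by move=> /(congr1 (fun u => complex.Re u))/= ->; rewrite addr0.
Qed.

(** Up to the constant [c] the polynomial [t] has the same real part as some
    [phi] in the half-space, and [int_exp_ge1] forces [expR c <= 1]. *)
Lemma int_trig_le0 q t : span P q -> trig t ->
  (forall z, cabs (1 + q z) * expR (complex.Re (t z)) <= 1) ->
  int (fun z => complex.Re (t z)) <= 0.
Proof.
move=> Pq Tt H; have [phi Pphi E] := Re_trig Tt.
change (complex.Re (cint m t) <= 0); set c := complex.Re (cint m t) in E *.
suff : expR c <= 1 by rewrite -expR0 ler_expR.
have mphi : measurable_fun setT (fun z => expR (complex.Re (phi z))).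
  by have [mr _] := cmeas_span Pphi; apply: measurableT_comp.
have mq : measurable_fun setT (fun z => cabs (1 + q z)).
  by apply/cmeas_cabs/cmeasD; [exact: cmeas_cst|exact: cmeas_span Pq].
have le z : cabs (1 + q z) * expR (complex.Re (phi z)) <= expR (- c).
  rewrite expRN -[leRHS]mul1r ler_pdivlMr ?expR_gt0// -mulrA -expRD [_ + c]addrC -E.
  exact: H.
rewrite -[leRHS](divff (_ : expR (- c) != 0)) ?gt_eqF ?expR_gt0// -[expR c]mul1r.
rewrite ler_pdivlMr ?expR_gt0// -mulrA -expRD subrr expR0 mulr1.
apply: le_trans (int_exp_ge1 Pq Pphi) _.
rewrite -[leRHS](int_cst m); apply: le_int => //; last exact: integ_cst.
apply: (@integ_bnd _ _ _ _ _ (expR (- c))); first exact: measurable_funM.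
by move=> z; rewrite ger0_norm ?mulr_ge0 ?cabs_ge0 ?expR_ge0.
Qed.

(** With [y = 1 - `|1 + q|^2 / B] in [0, 1], the trigonometric polynomials
    [(log_series n y - ln B) / 2] increase to [- ln `|1 + q|], so that
    [int_trig_le0] applies to them. *)
Lemma jensen q : span P q ->
  [/\ {ae m, forall z, 0 < cabs (1 + q z)},
      integ (fun z => ln (cabs (1 + q z))) &
      0 <= int (fun z => ln (cabs (1 + q z)))].
Proof.
move=> Pq; have [D D0 qD] := span_bounded Pq.
pose B := (1 + D) ^+ 2; have B0 : 0 < B by rewrite exprn_gt0// addr_gt0.
pose g z := 1 + q z.
have Tg : trig g.
  apply: spanD; first exact: span_cst.
  by apply: span_sub Pq.
have gB z : cabs (g z) ^+ 2 <= B.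
  rewrite lerXn2r ?nnegrE ?cabs_ge0 ?addr_ge0 ?(ltW D0)//.
  by rewrite (le_trans (cabsD _ _))// cabs1 lerD2l.
have mg : measurable_fun setT (fun z => cabs (g z)) by apply/cmeas_cabs/(cmeas_span Tg).
pose y z := 1 - cabs (g z) ^+ 2 / B.
have y0 z : 0 <= y z by rewrite subr_ge0 ler_pdivrMr// mul1r.
have y1 z : y z <= 1 by rewrite gerBl divr_ge0// ?sqr_ge0// ltW.
have yE z : 1 - y z = cabs (g z) ^+ 2 / B by rewrite subKr.
have my : measurable_fun setT y.
  apply: measurable_funB => //; apply: measurable_funM => //.
  exact: measurable_funX.
have Ty : trig (fun z => (y z)%:C%C).
  apply: (eq_span (f := fun z => 1 - (B^-1)%:C%C * (g z * (g z)^*%C))).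
    by move=> z; rewrite mul_conj -rmorphM mulrC -[1](rmorph1 (real_complex R)) -rmorphB.
  apply: spanB; first exact: span_cst.
  by apply: spanZ; apply: (spanM _ Tg (span_conj Tg)).
pose f k z := y z ^+ k.+1 / k.+1%:R.
have f0 k z : 0 <= f k z by rewrite divr_ge0// exprn_ge0.
have fi k : integ (f k).
  apply: (@integ_bnd _ _ _ _ _ 1).
    by apply: measurable_funM => //; exact: measurable_funX.
  move=> z; rewrite ger0_norm// ler_pdivrMr// mul1r (@le_trans _ _ 1) ?ler1n//.
  exact: exprn_ile1.
have sumf n : \sum_(0 <= k < n) int (f k) = int (fun z => log_series n (y z)).
  by rewrite int_sum.
have iS n : integ (fun z => log_series n (y z)) by exact: integ_sum.
have fB n : \sum_(0 <= k < n) int (f k) <= ln B.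
  rewrite sumf; pose t z := (2^-1 * (log_series n (y z) - ln B))%:C%C : R[i].
  have Tt : trig t.
    apply: (eq_span (f := fun z => (2^-1)%:C%C *
        (\sum_(0 <= k < n) (k.+1%:R^-1)%:C%C * (y z)%:C%C ^+ k.+1 - (ln B)%:C%C))).
      move=> z; rewrite /t /log_series [RHS]rmorphM [X in _ = _ * X]rmorphB rmorph_sum; congr (_ * (_ - _)).
      by apply: eq_bigr => k _; rewrite [RHS]rmorphM [LHS]mulrC rmorphXn.
    apply: spanZ; apply: spanB; last exact: span_cst.
    apply: span_sum => k; apply: spanZ; elim: k.+1 => [|j IH].
      by apply: (eq_span (f := fun=> 1)) => [z|]; rewrite ?expr0//; exact: span_cst.
    apply: (eq_span (f := fun z => (y z)%:C%C * (y z)%:C%C ^+ j)) => [z|].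
      by rewrite exprS.
    exact: (spanM _ Ty IH).
  have : int (fun z => complex.Re (t z)) <= 0.
    apply: (int_trig_le0 Pq Tt) => z; rewrite -/(g z) /t/=.
    have [g0|g0] := eqVneq (g z) 0; first by rewrite g0 cabs0 mul0r.
    have gp : 0 < cabs (g z) by exact: cabs_gt0.
    have yz1 : y z < 1 by rewrite ltrBlDl ltrDr divr_gt0// exprn_gt0.
    have : log_series n (y z) <= - ln (1 - y z).
      by apply: log_series_le; rewrite y0.
    rewrite yE ln_div ?posrE ?(exprn_gt0 _ gp)// lnXn// => le.
    rewrite -[cabs (g z)]lnK ?posrE// -expRD -[leRHS]expR0 ler_expR; lra.
  rewrite intZ; last by apply: integB => //; exact: integ_cst.
  by rewrite intB ?int_cst//; [lra|exact: integ_cst].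
have [G [Gi GB fG]] := levi fi f0 fB.
have gp : {ae m, forall z, 0 < cabs (g z)}.
  apply: filterS fG => z fGz; apply: cabs_gt0; apply/eqP => gz0.
  apply: (@log_series1_unbounded R (G z)) => n; move: (fGz n).
  by rewrite /f /y gz0 cabs0 expr0n/= mul0r subr0.
pose v z := ln B - 2 * ln (cabs (g z)).
have mlg : measurable_fun setT (fun z => ln (cabs (g z))).
  exact: (measurableT_comp (@measurable_ln R)).
have mv : measurable_fun setT v.
  by apply: measurable_funB => //; exact: measurable_funM.
have vE z : 0 < cabs (g z) -> v z = - ln (1 - y z).
  move=> gz0; rewrite yE ln_div ?posrE ?(exprn_gt0 _ gz0)// lnXn//.
  by rewrite /v; ring.
have vG : {ae m, forall z, v z <= G z}.
  apply: filterS2 gp fG => z gz0 fGz; rewrite vE//.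
  apply: log_series_sup; last exact: fGz.
  by rewrite y0/= ltrBlDl ltrDr divr_gt0// exprn_gt0.
have vi : integ v.
  apply: (integ_le_ae mv _ Gi); apply: filterS2 gp vG => z gz0 vGz.
  rewrite ger0_norm// vE// oppr_ge0 ln_le0//.
  by have := y0 z; lra.
have lgi : integ (fun z => ln (cabs (g z))).
  have := integZ (- 2^-1) (integB vi (integ_cst m (ln B))).
  by apply: eq_integrable => // z _ /=; congr EFin; rewrite /v; field.
split=> //.
have : int v <= ln B by apply: le_trans GB; exact: le_int_ae.
rewrite intB; [|exact: integ_cst|exact: integZ].
by rewrite int_cst intZ//; lra.
Qed.

End jensen.

(** * The $L^p$ distance *)

Section Lp_distance.
Context {d : measure_display} {T : measurableType d} {R : realType}.
Variables (m : probability T R) (p : R) (p0 : 0 < p).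
Implicit Types (f g h : T -> R[i]) (S : set (T -> R[i])).
Local Notation integ f := (m.-integrable setT (EFin \o f)).
Local Notation int f := (Rintegral m setT f).

Lemma powR_le (a b : R) : 0 <= a -> a <= b -> a `^ p <= b `^ p.
Proof.
move=> a0 ab; apply: ge0_ler_powR; rewrite ?nnegrE ?(ltW p0)//.
exact: le_trans ab.
Qed.

Lemma powRD_le (a b : R) : 0 <= a -> 0 <= b ->
  (a + b) `^ p <= 2 `^ p * (a `^ p + b `^ p).
Proof.
move=> a0 b0.
have H c : 0 <= c -> a <= c -> b <= c -> (a + b) `^ p <= 2 `^ p * c `^ p.
  move=> c0 ac bc; rewrite -powRM//; apply: powR_le; [exact: addr_ge0|lra].
have p20 : 0 <= 2 `^ p :> R by exact: powR_ge0.
have [ab|ba] := lerP a b.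
  by apply: le_trans (H _ b0 ab (lexx _)) _; rewrite ler_wpM2l// lerDr powR_ge0.
by apply: le_trans (H _ a0 (lexx _) (ltW ba)) _; rewrite ler_wpM2l// lerDl powR_ge0.
Qed.

Lemma cvg0_powR (a : nat -> R) : (forall n, 0 <= a n) ->
  a n @[n --> \oo] --> (0 : R) -> a n `^ p @[n --> \oo] --> (0 : R).
Proof.
move=> a0 acv; apply/cvgrPdist_lt => e e0.
have d0 : 0 < e `^ p^-1 by exact: powR_gt0.
have /cvgrPdist_lt/(_ _ d0) := acv; apply: filterS => n.
rewrite !sub0r !normrN !ger0_norm ?powR_ge0// => ane.
rewrite -[ltRHS](powRr1 (ltW e0)) -(mulVf (lt0r_neq0 p0)) powRrM.
by rewrite gt0_ltr_powR ?nnegrE ?powR_ge0.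
Qed.

Definition inLp f := cmeas f /\ integ (fun x => cabs (f x) `^ p).

Definition pdist f g := int (fun x => cabs (f x - g x) `^ p).

Lemma meas_powR (r : T -> R) : measurable_fun setT r ->
  measurable_fun setT (fun x => r x `^ p).
Proof. by move=> mr; exact: (measurableT_comp (measurable_powR p)). Qed.

Lemma meas_cabs_powR f : cmeas f -> measurable_fun setT (fun x => cabs (f x) `^ p).
Proof. by move=> mf; apply: meas_powR; exact: cmeas_cabs. Qed.

Lemma inLp_le f (r : T -> R) : cmeas f -> (forall x, cabs (f x) `^ p <= r x) ->
  integ r -> inLp f.
Proof.
move=> mf fr ir; split => //; apply: integ_le ir; first exact: meas_cabs_powR.
by move=> x; rewrite ger0_norm ?powR_ge0.
Qed.

Lemma inLp_bnd f (B : R) : cmeas f -> (forall x, cabs (f x) <= B) -> inLp f.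
Proof.
move=> mf fB; apply: (inLp_le mf _ (integ_cst m (B `^ p))) => x.
by apply: powR_le => //; exact: cabs_ge0.
Qed.

Lemma inLpD f g : inLp f -> inLp g -> inLp (fun x => f x + g x).
Proof.
move=> [mf fi] [mg gi]; apply: (inLp_le (cmeasD mf mg) _
  (integZ (2 `^ p) (integD fi gi))) => x.
apply: le_trans (powRD_le (cabs_ge0 _) (cabs_ge0 _)).
by apply: powR_le; [exact: cabs_ge0|exact: cabsD].
Qed.

Lemma inLpM f g (B : R) : cmeas f -> (forall x, cabs (f x) <= B) -> inLp g ->
  inLp (fun x => f x * g x).
Proof.
move=> mf fB [mg gi]; apply: (inLp_le (cmeasM mf mg) _ (integZ (B `^ p) gi)) => x.
have B0 : 0 <= B by exact: le_trans (cabs_ge0 (f x)) (fB x).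
rewrite cabsM powRM ?cabs_ge0// ler_wpM2r ?powR_ge0//.
by apply: powR_le => //; exact: cabs_ge0.
Qed.

Lemma inLpZ (c : R[i]) f : inLp f -> inLp (fun x => c * f x).
Proof. by move=> fi; apply: (@inLpM (fun=> c) f (cabs c)) => //; exact: cmeas_cst. Qed.

Lemma inLpB f g : inLp f -> inLp g -> inLp (fun x => f x - g x).
Proof.
move=> fi gi; have := inLpD fi (inLpZ (-1) gi).
by under eq_fun do rewrite mulN1r.
Qed.

Lemma pdist_ge0 f g : 0 <= pdist f g.
Proof. by apply: int_ge0 => x; exact: powR_ge0. Qed.

Lemma integ_pdist f g : inLp f -> inLp g -> integ (fun x => cabs (f x - g x) `^ p).
Proof. by move=> fi gi; have [] := inLpB fi gi. Qed.

Lemma pdistC f g : pdist f g = pdist g f.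
Proof. by congr Rintegral; apply/funext => x; rewrite cabsB. Qed.

Lemma pdist_tri g f h : inLp f -> inLp g -> inLp h ->
  pdist f h <= 2 `^ p * (pdist f g + pdist g h).
Proof.
move=> fi gi hi; have fg := integ_pdist fi gi; have gh := integ_pdist gi hi.
rewrite -intD// -intZ; last exact: integD.
apply: le_int; [exact: integ_pdist|by apply/integZ/integD|] => x.
apply: le_trans (powRD_le (cabs_ge0 _) (cabs_ge0 _)).
apply: powR_le; first exact: cabs_ge0.
by rewrite -[f x - h x](subrKA (g x)) cabsD.
Qed.

Lemma pdistM f g h (B : R) : cmeas f -> (forall x, cabs (f x) <= B) ->
  inLp g -> inLp h ->
  pdist (fun x => f x * g x) (fun x => f x * h x) <= B `^ p * pdist g h.
Proof.
move=> mf fB gi hi; rewrite -intZ; last exact: integ_pdist.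
apply: le_int.
- by apply: integ_pdist; exact: inLpM fB _.
- by apply/integZ; exact: integ_pdist.
- move=> x; have B0 : 0 <= B by exact: le_trans (cabs_ge0 (f x)) (fB x).
  rewrite -mulrBr cabsM powRM ?cabs_ge0// ler_wpM2r ?powR_ge0//.
  by apply: powR_le => //; exact: cabs_ge0.
Qed.

Lemma pdistZ (c : R[i]) g h : inLp g -> inLp h ->
  pdist (fun x => c * g x) (fun x => c * h x) <= cabs c `^ p * pdist g h.
Proof. by move=> gi hi; apply: (@pdistM (fun=> c)) => //; exact: cmeas_cst. Qed.

Lemma pdist_dct (u : nat -> T -> R[i]) f (r : T -> R) :
  (forall n, inLp (u n)) -> inLp f -> integ r ->
  (forall n x, cabs (u n x - f x) `^ p <= r x) ->
  {ae m, forall x, cabs (u n x - f x) @[n --> \oo] --> (0 : R)} ->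
  pdist (u n) f @[n --> \oo] --> (0 : R).
Proof.
move=> ui fi ir ur cv; rewrite -(int_cst m 0); apply: (dct _ _ _ _ ir).
- by move=> n; apply: integ_meas; exact: integ_pdist.
- exact: measurable_cst.
- by apply: filterS cv => x cvx; apply: cvg0_powR => // n; exact: cabs_ge0.
- by move=> n x; rewrite ger0_norm ?powR_ge0.
Qed.

(** Membership in the $L^p$ closure, through the $p$-th power of the norm. *)
Definition approx S f := forall e : R, 0 < e -> exists2 g, S g & pdist f g <= e.

Lemma approx_self S f : S f -> approx S f.
Proof.
move=> Sf e e0; exists f => //; rewrite /pdist.
under eq_Rintegral do rewrite subrr cabs0 powR0 ?gt_eqF//.
by rewrite int_cst ltW.
Qed.

Let two_p0 : 0 < 2 `^ p :> R. Proof. by rewrite powR_gt0. Qed.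

Lemma approx_trans S f : S `<=` inLp -> inLp f ->
  (forall e : R, 0 < e -> exists g, [/\ inLp g, approx S g & pdist f g <= e]) ->
  approx S f.
Proof.
move=> Si fi H e e0.
have e'0 : 0 < e / (2 `^ p * 2) by rewrite divr_gt0// mulr_gt0.
have [g [gi Sg fg]] := H _ e'0.
have [h Sh gh] := Sg _ e'0.
exists h => //; apply: le_trans (pdist_tri fi gi (Si _ Sh)) _.
rewrite (_ : e = 2 `^ p * (e / (2 `^ p * 2) + e / (2 `^ p * 2))).
  by rewrite (ler_pM2l two_p0); exact: lerD fg gh.
by field; rewrite gt_eqF.
Qed.

Lemma approx_lim S f (u : nat -> T -> R[i]) : S `<=` inLp -> inLp f ->
  (forall n, inLp (u n)) -> (forall n, approx S (u n)) ->
  pdist (u n) f @[n --> \oo] --> (0 : R) -> approx S f.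
Proof.
move=> Si fi ui Su cv; apply: approx_trans => // e e0.
have /cvgrPdist_lt/(_ _ e0) [N _ /(_ N (leqnn N))] := cv.
rewrite /= sub0r normrN ger0_norm ?pdist_ge0// => uN.
exists (u N); split; [exact: ui|exact: Su|].
by rewrite pdistC; exact: ltW uN.
Qed.

Lemma approxD S f g : (forall u v, S u -> S v -> S (fun x => u x + v x)) ->
  S `<=` inLp -> inLp f -> inLp g -> approx S f -> approx S g ->
  approx S (fun x => f x + g x).
Proof.
move=> SD Si fi gi Sf Sg e e0.
have e'0 : 0 < e / (2 `^ p * 2) by rewrite divr_gt0// mulr_gt0.
have [u Su fu] := Sf _ e'0; have [v Sv gv] := Sg _ e'0.
exists (fun x => u x + v x); first exact: SD.
have fui := integ_pdist fi (Si _ Su); have gvi := integ_pdist gi (Si _ Sv).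
have -> : e = 2 `^ p * (e / (2 `^ p * 2) + e / (2 `^ p * 2)).
  by field; rewrite gt_eqF.
apply: (@le_trans _ _ (2 `^ p * (pdist f u + pdist g v))); last first.
  by rewrite (ler_pM2l two_p0); exact: lerD fu gv.
rewrite -intD// -intZ; last exact: integD.
apply: le_int; [|by apply/integZ/integD|] => [|x].
  by apply: integ_pdist; apply: inLpD => //; exact: Si.
apply: le_trans (powRD_le (cabs_ge0 _) (cabs_ge0 _)).
apply: powR_le; first exact: cabs_ge0.
by rewrite opprD addrACA cabsD.
Qed.

Lemma approxZ S (c : R[i]) f : (forall u, S u -> S (fun x => c * u x)) ->
  S `<=` inLp -> inLp f -> approx S f -> approx S (fun x => c * f x).
Proof.
move=> SZ Si fi Sf e e0.
have c0 : 0 < cabs c `^ p + 1 by rewrite ltr_wpDl ?powR_ge0.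
have [u Su fu] := Sf (e / (cabs c `^ p + 1)) (divr_gt0 e0 c0).
exists (fun x => c * u x); first exact: SZ.
apply: le_trans (pdistZ c fi (Si _ Su)) _.
apply: (@le_trans _ _ ((cabs c `^ p + 1) * (e / (cabs c `^ p + 1)))).
  by rewrite ler_pM ?powR_ge0 ?pdist_ge0// lerDl.
by rewrite mulrC divfK// gt_eqF.
Qed.

End Lp_distance.

(** * Density of trigonometric polynomials *)

Section threshold.
Context {R : realType}.
Implicit Types x y s : R.

Lemma bernoulli x n : 0 <= 1 + x -> 1 + n%:R * x <= (1 + x) ^+ n.
Proof.
move=> x1; elim: n => [|n IH]; first by rewrite expr0 mul0r addr0.
rewrite exprS; apply: le_trans (ler_wpM2l x1 IH).
have : 0 <= n%:R * (x * x) by rewrite mulr_ge0// -expr2 sqr_ge0.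
by rewrite -natr1; lra.
Qed.

Lemma cvg_natM_expr x : 0 <= x < 1 -> n%:R * x ^+ n @[n --> \oo] --> (0 : R).
Proof.
move=> /andP[x0 x1]; pose y := Num.sqrt x.
have y0 : 0 <= y by exact: sqrtr_ge0.
have y1 : y < 1 by rewrite -sqrtr1 ltr_sqrt.
have xE : x = y ^+ 2 by rewrite sqr_sqrtr.
apply: (@squeeze_cvgr _ _ _ _ (fun=> 0) (fun n => (1 - y)^-1 * y ^+ n)).
- apply: nearW => n; rewrite mulr_ge0 ?exprn_ge0//=.
  rewrite xE -exprM mulnC exprM expr2 mulrA ler_wpM2r ?exprn_ge0//.
  rewrite -[leRHS]mul1r ler_pdivlMr ?subr_gt0//.
  apply: (@le_trans _ _ ((1 - y) * \sum_(i < n) y ^+ i)).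
    rewrite mulrC ler_wpM2l ?subr_ge0 ?(ltW y1)//.
    rewrite -[X in X%:R * _](card_ord n) mulr_natl -sumr_const.
    by apply: ler_sum => i _; apply: ler_wiXn2l; rewrite ?(ltW y1) ?(ltnW (ltn_ord i)).
  by rewrite -opprB mulNr -subrX1 opprB lerBlDr lerDl exprn_ge0.
- exact: cvg_cst.
- rewrite -[X in _ --> X](mulr0 (1 - y)^-1).
  by apply: cvgMr; apply: cvg_expr; rewrite ger0_norm.
Qed.

(** Polynomials in [s] converging on [0, 1] to the indicator of [s < 1/2]. *)
Definition step n s : R := (1 - s ^+ n) ^+ (n * 2 ^ n).

Lemma step01 n s : 0 <= s <= 1 -> 0 <= step n s <= 1.
Proof.
move=> /andP[s0 s1]; have sn0 : 0 <= s ^+ n by rewrite exprn_ge0.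
have sn1 : s ^+ n <= 1 by rewrite exprn_ile1.
by rewrite exprn_ge0 ?exprn_ile1 ?subr_ge0// gerBl.
Qed.

Lemma cvg_step s : 0 <= s <= 1 -> step n s @[n --> \oo] --> ((s < 2^-1)%R%:R : R).
Proof.
move=> /andP[s0 s1].
have sn01 n : 0 <= s ^+ n <= 1 by rewrite exprn_ge0// exprn_ile1.
have st01 n : 0 <= step n s <= 1 by rewrite step01// s0.
case: ltP => [s2|s2].
- have cv : 1 - n%:R * (2 * s) ^+ n @[n --> \oo] --> (1 : R).
    rewrite -[X in _ --> X]subr0; apply: cvgB; first exact: cvg_cst.
    by apply: cvg_natM_expr; lra.
  apply: (squeeze_cvgr _ cv (cvg_cst _)); apply: nearW => n.
  apply/andP; split; last by case/andP: (st01 n).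
  have sn1 : 0 <= 1 - s ^+ n by have := sn01 n; lra.
  apply: le_trans (bernoulli _ sn1).
  by rewrite mulrN natrM natrX -mulrA -exprMn.
- have cv := @cvg_harmonic R.
  apply: (squeeze_cvgr _ (cvg_cst _) cv); apply: nearW => n.
  apply/andP; split; first by case/andP: (st01 n).
  rewrite /harmonic/= -[leRHS]mul1r ler_pdivlMr//.
  apply: (@le_trans _ _ (step n s * (1 + s ^+ n) ^+ (n * 2 ^ n))).
    have /andP[st0 _] := st01 n.
    rewrite ler_wpM2l//; have /andP[sn0 _] := sn01 n.
    apply: le_trans (bernoulli _ (addr_ge0 ler01 sn0)); rewrite -natr1 addrC lerD2l.
    rewrite natrM natrX -mulrA -exprMn ler_peMr// exprn_ege1//; lra.
  have /andP[sn0 sn1] := sn01 n.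
  rewrite -exprMn exprn_ile1 ?mulr_ge0 ?subr_ge0 ?addr_ge0//.
  have : 0 <= s ^+ n * s ^+ n by rewrite mulr_ge0.
  lra.
Qed.

End threshold.

Section trig_dense.
Context {R : realType}.
Variables (m : probability (torus R) R) (p : R) (p0 : 0 < p).
Implicit Types (f g : torus R -> R[i]) (A : set (torus R)).
Local Notation approx_trig := (approx m p trig).

Lemma trig_inLp : trig `<=` inLp m p.
Proof.
move=> f Tf; have [B _ fB] := span_bounded Tf.
exact: (inLp_bnd m p0 (cmeas_span Tf) fB).
Qed.

Lemma trigM f g : trig f -> trig g -> trig (fun z => f z * g z).
Proof. by move=> Tf Tg; apply: (spanM _ Tf Tg). Qed.

Lemma trigX f n : trig f -> trig (fun z => f z ^+ n).
Proof.
move=> Tf; elim: n => [|n IH].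
  by apply: (eq_span (f := fun=> 1)) => [z|]; [rewrite expr0|exact: span_cst].
by apply: eq_span (trigM Tf IH) => z; rewrite exprS.
Qed.

Definition cindic A : torus R -> R[i] := fun z => (\1_A z)%:C%C.

Lemma cabs_cindic A z : cabs (cindic A z) <= 1.
Proof.
rewrite cabs_real indicE ger0_norm ?ler0n//.
by case: (_ \in _); rewrite ?ler01.
Qed.

Lemma cmeas_cindic A : measurable A -> cmeas (cindic A).
Proof. by move=> mA; apply: cmeas_real; exact: measurable_indic. Qed.

Lemma inLp_cindic A : measurable A -> inLp m p (cindic A).
Proof.
move=> mA; apply: (inLp_bnd m p0 (cmeas_cindic mA)); exact: cabs_cindic.
Qed.

(** These sets form a sigma-algebra because bounded approximable functions form
    an algebra closed under bounded limits. *)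
Definition trig_set A := measurable A /\ approx_trig (cindic A).

Lemma trig_setC A : trig_set A -> trig_set (~` A).
Proof.
move=> [mA TA]; split; first exact: measurableC.
have E z : cindic (~` A) z = 1 + (-1) * cindic A z.
  rewrite /cindic !indicE in_setC; case: (_ \in _) => /=.
    by rewrite mulN1r subrr.
  by rewrite mulr0 addr0.
rewrite (_ : cindic _ = fun z => 1 + (-1) * cindic A z); last exact/funext.
have iA := inLp_cindic mA.
apply: (approxD p0 (S := trig) (f := fun=> 1) (g := fun z => (-1) * cindic A z)).
- by move=> u v; exact: spanD.
- exact: trig_inLp.
- exact: (trig_inLp (span_cst _ _)).
- exact: inLpZ.
- by apply: approx_self; [|exact: span_cst].
- by apply: (approxZ p0 (S := trig)); [move=> u; exact: spanZ|exact: trig_inLp| |].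
Qed.

(** Approximate one factor, then the other: trigonometric polynomials are
    bounded, so multiplying by them is continuous in $L^p$. *)
Lemma trig_setI A B : trig_set A -> trig_set B -> trig_set (A `&` B).
Proof.
move=> [mA TA] [mB TB]; split; first exact: measurableI.
rewrite (_ : cindic _ = fun z => cindic A z * cindic B z); last first.
  apply/funext => z; rewrite /cindic indicI/= !indicE.
  by rewrite rmorphM.
have iA := inLp_cindic mA; have iB := inLp_cindic mB.
have iAB : inLp m p (fun z => cindic A z * cindic B z).
  exact: (inLpM p0 (cmeas_cindic mA) (@cabs_cindic A) iB).
apply: approx_trans => //; first exact: trig_inLp.
move=> e e0; have [t Tt At] := TA _ e0.
have [D _ tD] := span_bounded Tt; have mt := cmeas_span Tt.
have itB : inLp m p (fun z => t z * cindic B z) by exact: (inLpM p0 mt tD iB).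
exists (fun z => t z * cindic B z); split; [exact: itB| |].
  move=> e' e'0; have c0 : 0 < D `^ p + 1 by rewrite ltr_wpDl ?powR_ge0.
  have [s Ts Bs] := TB (e' / (D `^ p + 1)) (divr_gt0 e'0 c0).
  exists (fun z => t z * s z); first exact: trigM.
  apply: le_trans (pdistM p0 mt tD iB (trig_inLp Ts)) _.
  apply: (@le_trans _ _ ((D `^ p + 1) * (e' / (D `^ p + 1)))).
    by rewrite ler_pM ?powR_ge0 ?pdist_ge0// lerDl.
  by rewrite mulrC divfK// gt_eqF.
- have E f : (fun z => f z * cindic B z) = (fun z => cindic B z * f z).
    by apply/funext => z; rewrite mulrC.
  rewrite (E (cindic A)) (E t).
  apply: le_trans (pdistM p0 (cmeas_cindic mB) (@cabs_cindic B) iA (trig_inLp Tt)) _.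
  by rewrite powR1 mul1r.
Qed.

Lemma trig_set0 : trig_set set0.
Proof.
split=> //; apply: approx_self => //.
apply: eq_span (span_zero _) => z; by rewrite /cindic indicE in_set0.
Qed.

Lemma trig_set_lim A (u : nat -> torus R -> R[i]) : measurable A ->
  (forall n, cmeas (u n)) -> (forall n z, cabs (u n z) <= 1) ->
  (forall n, approx_trig (u n)) ->
  (forall z, cabs (u n z - cindic A z) @[n --> \oo] --> (0 : R)) -> trig_set A.
Proof.
move=> mA mu u1 Tu cv; split => //.
have iu n : inLp m p (u n) by exact: inLp_bnd (u1 n).
have iA := inLp_cindic mA.
apply: (approx_lim p0 trig_inLp iA iu Tu).
apply: (pdist_dct p0 iu iA (integ_cst m (2 `^ p))).
- move=> n z; apply: powR_le => //; first exact: cabs_ge0.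
  by rewrite (le_trans (cabsD _ _))// cabsN (natrD _ 1 1) lerD// cabs_cindic.
- exact: aeW.
Qed.

Lemma trig_set_bigcup (F : nat -> set (torus R)) :
  (forall n, trig_set (F n)) -> trig_set (\bigcup_n F n).
Proof.
move=> TF.
pose U n := \big[setU/set0]_(i < n) F i.
have TU n : trig_set (U n).
  elim: n => [|n IH]; first by rewrite /U big_ord0; exact: trig_set0.
  rewrite /U big_ord_recr/= -/(U n) -[X in trig_set X]setCK setCU.
  have UF := trig_setI (trig_setC IH) (trig_setC (TF n)).
  exact: trig_setC UF.
apply: (@trig_set_lim _ (fun n => cindic (U n))).
- by apply: bigcupT_measurable => n; case: (TF n).
- by move=> n; apply: cmeas_cindic; case: (TU n).
- by move=> n; exact: cabs_cindic.
- by move=> n; case: (TU n).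
move=> z; have [[k _ Fkz]|nF] := pselect ((\bigcup_n F n) z).
- apply: cvg_near_cst; exists k.+1 => // n kn.
  have Uz : U n z by rewrite /U -bigcup_mkord; exists k.
  have Fz : (\bigcup_n F n) z by exists k.
  change (cabs (cindic (U n) z - cindic (\bigcup_n F n) z) = 0).
  have -> : cindic (U n) z = cindic (\bigcup_n F n) z.
    by rewrite /cindic !indicE (mem_set Uz) (mem_set Fz).
  by rewrite subrr cabs0.
- apply: cvg_near_cst; apply: nearW => n.
  have nU : ~ U n z by rewrite /U -bigcup_mkord => -[k _ Fkz]; apply: nF; exists k.
  change (cabs (cindic (U n) z - cindic (\bigcup_n F n) z) = 0).
  have -> : cindic (U n) z = cindic (\bigcup_n F n) z.
    by rewrite /cindic !indicE (memNset nU) (memNset nF).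
  by rewrite subrr cabs0.
Qed.

Lemma trig_set_sigma_algebra : sigma_algebra setT trig_set.
Proof.
split; [exact: trig_set0|by move=> A TA; rewrite setTD; exact: trig_setC|].
exact: trig_set_bigcup.
Qed.

(** The indicator is the limit of [step n] applied to an affine function of
    [t] with values in [0, 1], which stays a trigonometric polynomial. *)
Lemma trig_set_gt (t : torus R -> R) (a : R) : trig (fun z => (t z)%:C%C) ->
  (forall z, `|t z| <= 1) -> trig_set [set z | a < t z].
Proof.
move=> Tt t1; pose c := 2 * (1 + `|a|).
have c0 : 0 < c by rewrite mulr_gt0// ltr_wpDr.
pose s z := 2^-1 + c^-1 * (a - t z).
have mt : measurable_fun setT t by have [] := cmeas_span Tt.
have s01 z : 0 <= s z <= 1.
  have : `|c^-1 * (a - t z)| <= 2^-1.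
    rewrite normrM ger0_norm ?invr_ge0 ?(ltW c0)// ler_pdivrMl//.
    rewrite /c (le_trans (ler_normB _ _))//; have := t1 z; lra.
  by rewrite ler_norml /s; lra.
have sE z : (s z < 2^-1) = (a < t z).
  by rewrite -ltrBrDl subrr pmulr_rlt0 ?invr_gt0// subr_lt0.
have Ts : trig (fun z => (s z)%:C%C).
  apply: (eq_span (f := fun z => (2^-1)%:C%C + (c^-1)%:C%C * (a%:C%C - (t z)%:C%C))).
    by move=> z; rewrite /s rmorphD rmorphM rmorphB.
  apply: spanD; first exact: span_cst.
  by apply: spanZ; apply: spanB => //; exact: span_cst.
have Tst n : trig (fun z => (step n (s z))%:C%C).
  apply: (eq_span (f := fun z => (1 - (s z)%:C%C ^+ n) ^+ (n * 2 ^ n))).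
    by move=> z; rewrite /step rmorphXn rmorphB rmorph1 rmorphXn.
  by apply: trigX; apply: spanB; [exact: span_cst|exact: trigX].
apply: (@trig_set_lim _ (fun n z => (step n (s z))%:C%C)).
- rewrite -[X in measurable X]setTI; have := mt measurableT _ (measurable_itv `]a, +oo[).
  by congr measurable; apply/seteqP; split=> z /=; rewrite in_itv/= andbT.
- by move=> n; exact: cmeas_span (Tst n).
- by move=> n z; rewrite cabs_real; have /andP[? ?] := step01 n (s01 z);
    rewrite ger0_norm.
- by move=> n; apply: approx_self.
- move=> z; rewrite /cindic indicE.
  have -> : (z \in [set z | a < t z]) = (a < t z) by apply/idP/idP; rewrite inE.
  rewrite -sE; have := cvg_step (s01 z).
  move=> /subr_cvg0 /cvg_norm; rewrite normr0.
  suff -> : (fun n => cabs ((step n (s z))%:C%C - ((s z < 2^-1)%R%:R : R)%:C%C)) =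
    (fun n => `|step n (s z) - (s z < 2^-1)%R%:R|) by [].
  by apply/funext => n; rewrite -cabs_real rmorphB.
Qed.

Lemma trig_set_preimage (t : torus R -> R) (Y : set R) :
  trig (fun z => (t z)%:C%C) -> (forall z, `|t z| <= 1) -> measurable Y ->
  trig_set (t @^-1` Y).
Proof.
move=> Tt t1; have [s0 sC sU] := trig_set_sigma_algebra.
move=> mY; have {mY} : (RGenOInfty.G (R:=R)).-sigma.-measurable Y.
  by rewrite -RGenOInfty.measurableE; exact: mY.
move: Y; apply: (@smallest_sub _ _ _ [set Y | trig_set (t @^-1` Y)]).
  split => /=.
  - by rewrite preimage_set0.
  - by move=> A TA; rewrite setTD preimage_setC; exact: trig_setC.
  - by move=> F TF; rewrite preimage_bigcup; exact: sU.
move=> _ [a ->] /=.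
rewrite (_ : _ @^-1` _ = [set z | a < t z]); first exact: trig_set_gt.
by apply/seteqP; split=> z /=; rewrite in_itv/= andbT.
Qed.

Lemma trig_coord n : trig (@coord R n).
Proof.
pose a i : int := (i == n)%:R.
apply: (eq_span (f := chi n.+1 a)) => [z|].
  rewrite /chi big_nat_recr//= {2}/a eqxx expr1z big_nat big1 ?mul1r// => j /andP[_ jn].
  by rewrite /a ltn_eqF// expr0z.
apply: (@span_chi R setT n.+1 a) => // i ni.
by rewrite /a gtn_eqF.
Qed.

Lemma trig_setT A : measurable A -> trig_set A.
Proof.
move: A; apply: smallest_sub; first exact: trig_set_sigma_algebra.
move=> _ [n [B [mB ->]]]; have [s0 sC sU] := trig_set_sigma_algebra.
have Tc := trig_coord n; have Tcc := span_conj Tc.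
have TRe : trig (fun z : torus R => (complex.Re (coord n z))%:C%C).
  apply: (eq_span (f := fun z : torus R => 2^-1 * (coord n z + (coord n z)^*%C))).
    by move=> z; rewrite addcJ mulKf// pnatr_eq0.
  by apply: spanZ; exact: spanD.
have TIm : trig (fun z : torus R => (complex.Im (coord n z))%:C%C).
  apply: (eq_span (f := fun z : torus R => (2^-1 * - 'i%C) * (coord n z - (coord n z)^*%C))).
    move=> z; rewrite subcJ.
    transitivity (2^-1 * 2 * (complex.Im (coord n z))%:C%C * - ('i%C * 'i%C)).
      by ring.
    by rewrite -expr2 sqr_i opprK mulr1 mulVf ?mul1r// pnatr_eq0.
  by apply: spanZ; exact: spanB.
move: B mB; apply: (@smallest_sub _ _ _
  [set B | trig_set [set z | B (complex.Re (sval (z n)), complex.Im (sval (z n)))]]).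
  split; [exact: s0|move=> B TB; rewrite setTD|].
    exact: (trig_setC TB).
  by move=> F TF; exact: (sU _ TF).
move=> _ [[Y mY <-]|[Y mY <-]] /=.
- rewrite (_ : [set z | _] = (fun z => complex.Re (coord n z)) @^-1` Y).
    apply: trig_set_preimage => // z.
    by rewrite (le_trans (cabs_Re _))// cabs_coord.
  by apply/seteqP; split=> z /=; [case|].
- rewrite (_ : [set z | _] = (fun z => complex.Im (coord n z)) @^-1` Y).
    apply: trig_set_preimage => // z.
    by rewrite (le_trans (cabs_Im _))// cabs_coord.
  by apply/seteqP; split=> z /=; [case|].
Qed.

Lemma approx_trigD f g : inLp m p f -> inLp m p g -> approx_trig f ->
  approx_trig g -> approx_trig (fun z => f z + g z).
Proof.
move=> fi gi Tf Tg; apply: (approxD p0 (S := trig) _ trig_inLp fi gi Tf Tg).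
by move=> u v; exact: spanD.
Qed.

Lemma approx_trigZ (c : R[i]) f : inLp m p f -> approx_trig f ->
  approx_trig (fun z => c * f z).
Proof.
move=> fi Tf; apply: (approxZ p0 (S := trig) _ trig_inLp fi Tf).
by move=> u; exact: spanZ.
Qed.

Lemma approx_trig_sum (J : Type) (s : seq J) (F : J -> torus R -> R[i]) :
  (forall j, inLp m p (F j)) -> (forall j, approx_trig (F j)) ->
  inLp m p (fun z => \sum_(j <- s) F j z) /\
  approx_trig (fun z => \sum_(j <- s) F j z).
Proof.
move=> iF TF; elim: s => [|j s [IH1 IH2]].
  rewrite (_ : (fun z => _) = fun=> 0); last first.
    by apply/funext => z; rewrite big_nil.
  have T0 := span_zero setT : trig (fun _ : torus R => 0).
  by split; [exact: trig_inLp|exact: approx_self].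
rewrite (_ : (fun z => _) = fun z => F j z + \sum_(j <- s) F j z); last first.
  by apply/funext => z; rewrite big_cons.
by split; [exact: inLpD (iF j) IH1|exact: approx_trigD (iF j) IH1 (TF j) IH2].
Qed.

Lemma approx_trig_ge0 (r : torus R -> R) : measurable_fun setT r ->
  (forall z, 0 <= r z) -> inLp m p (fun z => (r z)%:C%C) ->
  approx_trig (fun z => (r z)%:C%C).
Proof.
move=> mr r0 [mrc ri].
have mEr : measurable_fun setT (EFin \o r) by exact/measurable_EFinP.
pose s := nnsfun_approx measurableT mEr.
have E0 z : [set: torus R] z -> (0 <= (EFin \o r) z)%E by move=> _; rewrite lee_fin.
have scv z : s n z @[n --> \oo] --> r z.
  have /fine_cvg := cvg_nnsfun_approx measurableT mEr E0 (I : setT z).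
  exact.
have snd z n k : (n <= k)%N -> s n z <= s k z.
  by move=> nk; have /lefP := nd_nnsfun_approx measurableT mEr nk; exact.
have sr n z : s n z <= r z.
  rewrite -(cvg_lim _ (scv z))//; apply: nondecreasing_cvgn_le.
    by move=> a b; exact: snd.
  by apply/cvg_ex; exists (r z); exact: scv.
have s0 n z : 0 <= s n z by exact: fun_ge0.
have Ts n : inLp m p (fun z => (s n z)%:C%C) /\ approx_trig (fun z => (s n z)%:C%C).
  pose F (y : R) z : R[i] := y%:C%C * cindic (s n @^-1` [set y]) z.
  rewrite (_ : (fun z => _) =
      fun z => \sum_(y <- finmap.enum_fset (fset_set (range (s n)))) F y z); last first.
    apply/funext => z; rewrite [s n z]fimfunE fsbig_finite//= rmorph_sum.
    by apply: eq_bigr => y _; rewrite /F /cindic rmorphM.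
  have my y : measurable (s n @^-1` [set y]).
    have ms : measurable_fun setT (s n) by exact: measurable_funP.
    by rewrite -[X in measurable X]setTI; apply: ms => //; exact: measurable_set1.
  have iy y : inLp m p (cindic (s n @^-1` [set y])) by exact: inLp_cindic.
  apply: approx_trig_sum => y; first exact: inLpZ.
  by apply: approx_trigZ => //; have [] := trig_setT (my y).
apply: (approx_lim p0 trig_inLp _ (fun n => (Ts n).1) (fun n => (Ts n).2)); first by split.
apply: (pdist_dct p0 (fun n => (Ts n).1) _ ri); first by split.
- move=> n z; apply: powR_le => //; first exact: cabs_ge0.
  rewrite -rmorphB !cabs_real ler0_norm ?subr_le0// ger0_norm//.
  by have := s0 n z; lra.
- apply: aeW => z; have /subr_cvg0/cvg_norm := scv z; rewrite normr0.
  suff -> : (fun n => cabs ((s n z)%:C%C - (r z)%:C%C)) = (fun n => `|s n z - r z|) by [].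
  by apply/funext => n; rewrite -cabs_real rmorphB.
Qed.

Lemma approx_trig_real (r : torus R -> R) : measurable_fun setT r ->
  inLp m p (fun z => (r z)%:C%C) -> approx_trig (fun z => (r z)%:C%C).
Proof.
move=> mr ri; have [_ ri'] := ri.
pose u z := `|r z|; pose v z := u z + r z.
have mu : measurable_fun setT u by exact: measurableT_comp.
have mv : measurable_fun setT v by exact: measurable_funD.
have v0 z : 0 <= v z by rewrite /v /u -lerBlDr sub0r -normrN ler_norm.
have iu : inLp m p (fun z => (u z)%:C%C).
  by apply: (inLp_le (cmeas_real mu) _ ri') => z; rewrite !cabs_real normr_id.
have iv : inLp m p (fun z => (v z)%:C%C).
  rewrite (_ : (fun z => _) = fun z => (u z)%:C%C + (r z)%:C%C); first exact: inLpD.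
  by apply/funext => z; rewrite rmorphD.
rewrite (_ : (fun z => _) = fun z => (v z)%:C%C + (-1) * (u z)%:C%C); last first.
  by apply/funext => z; rewrite mulN1r -complexB /v addrC addKr.
apply: approx_trigD iv (inLpZ p0 (-1) iu) (approx_trig_ge0 mv v0 iv) _.
exact: approx_trigZ iu (approx_trig_ge0 mu (fun z => normr_ge0 _) iu).
Qed.

(** From indicators to simple functions, then to nonnegative, real and complex
    functions. *)
Lemma trig_dense f : inLp m p f -> approx_trig f.
Proof.
move=> [[mr mi] fi].
have ir : inLp m p (fun z => (complex.Re (f z))%:C%C).
  apply: (inLp_le (cmeas_real mr) _ fi) => z; apply: powR_le => //.
    exact: cabs_ge0.
  by rewrite cabs_real cabs_Re.
have ii : inLp m p (fun z => (complex.Im (f z))%:C%C).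
  apply: (inLp_le (cmeas_real mi) _ fi) => z; apply: powR_le => //.
    exact: cabs_ge0.
  by rewrite cabs_real cabs_Im.
rewrite (_ : f = fun z => (complex.Re (f z))%:C%C + 'i%C * (complex.Im (f z))%:C%C); last first.
  by apply/funext => z; rewrite -complexE.
apply: approx_trigD ir (inLpZ p0 'i%C ii) (approx_trig_real mr ir) _.
exact: approx_trigZ ii (approx_trig_real mi ii).
Qed.

End trig_dense.

(** * Fejer kernels *)

Section fejer.
Context {R : realType}.
Variables (m : probability (torus R) R) (hm : is_haar m).
Local Notation integ f := (m.-integrable setT (EFin \o f)).
Local Notation int f := (Rintegral m setT f).
Implicit Types (x : R[i]) (L : nat -> nat).

Definition geom l x : R[i] := \sum_(0 <= j < l) x ^+ j.

(** The Fejer kernel of the circle, written as a square to make its positivity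
    visible. *)
Definition kappa l x : R := l%:R^-1 * cabs (geom l x) ^+ 2.

Definition fejer L n (z : torus R) : R := \prod_(0 <= i < n) kappa (L i) (coord i z).

Lemma kappa_ge0 l x : 0 <= kappa l x.
Proof. by rewrite mulr_ge0 ?invr_ge0 ?sqr_ge0. Qed.

Lemma fejer_ge0 L n z : 0 <= fejer L n z.
Proof. by apply: prodr_ge0 => i _; exact: kappa_ge0. Qed.

Lemma kappa1 x : kappa 1 x = 1.
Proof. by rewrite /kappa /geom big_nat1 expr0 cabs1 invr1 mul1r expr1n. Qed.

(** The expanded square shows the frequencies of the kernel. *)
Lemma kappaE l x : cabs x = 1 ->
  (kappa l x)%:C%C = (l%:R^-1)%:C%C *
    \sum_(0 <= j < l) \sum_(0 <= k < l) x ^ (j%:Z - k%:Z).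
Proof.
move=> x1; have x0 := cabs1_neq0 x1.
have xc : x^*%C = x^-1.
  by apply: (mulfI x0); rewrite mul_conj x1 expr1n divff.
rewrite /kappa rmorphM; congr (_ * _).
transitivity (geom l x * (geom l x)^*%C); first by rewrite mul_conj.
rewrite /geom rmorph_sum big_distrl /=; apply: eq_bigr => j _.
rewrite big_distrr /=; apply: eq_bigr => k _.
by rewrite rmorphXn /= xc expfzDr// -exprnN exprVn.
Qed.

Definition below n : set (nat -> ssrint.int) := [set a | forall i, (n <= i)%N -> a i = 0].

Definition delta n (k : ssrint.int) : nat -> ssrint.int := fun i => if i == n then k else 0.

Lemma coord_expz n (k : ssrint.int) : (fun z : torus R => coord n z ^ k) = chi n.+1 (delta n k).
Proof.
apply/funext => z; rewrite /chi big_nat_recr//= {2}/delta eqxx big_nat big1 ?mul1r// => j.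
by move=> /andP[_ jn]; rewrite /delta ltn_eqF// expr0z.
Qed.

Lemma supp_delta n (k : ssrint.int) : supp_below n.+1 (delta n k).
Proof. by move=> i ni; rewrite /delta gtn_eqF. Qed.

Lemma span_coord_expz P n (k : ssrint.int) : P (delta n k) ->
  span P (fun z : torus R => coord n z ^ k).
Proof. by move=> Pk; rewrite coord_expz; exact: span_chi (@supp_delta n k) Pk. Qed.

Lemma cint_mul_coord n f (k : ssrint.int) : span (below n) f -> k != 0 ->
  cint m (fun z => f z * coord n z ^ k) = 0.
Proof.
move=> Bf k0.
apply: (@cint_span0 _ _ hm [set a | a n != 0]) => [a an|]; first by exists n.
apply: (spanM (Q := [set delta n k]) _ Bf); last exact: span_coord_expz.
by move=> a _ Ba -> /=; rewrite Ba// add0r /delta eqxx.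
Qed.

Lemma fejer_span L n : span (below n) (fun z => (fejer L n z)%:C%C).
Proof.
elim: n => [|n IH].
  apply: (eq_span (f := fun=> 1)); first by move=> z; rewrite /fejer big_nil.
  by apply: span_cst => i.
apply: (eq_span (f := fun z => (fejer L n z)%:C%C * ((L n)%:R^-1)%:C%C *
    \sum_(0 <= j < L n) \sum_(0 <= k < L n) coord n z ^ (j%:Z - k%:Z))).
  move=> z; rewrite -mulrA -kappaE ?cabs_coord// /fejer big_nat_recr//=.
  by rewrite [in RHS]complexM.
apply: (spanM (P := below n) (Q := below n.+1)).
- by move=> a b Ba Bb i ni; rewrite Ba ?Bb// ltnW.
- apply: (eq_span (f := fun z => ((L n)%:R^-1)%:C%C * (fejer L n z)%:C%C)) => [z|].
    by rewrite mulrC.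
  exact: spanZ.
apply: span_sum => j; apply: span_sum => k.
by apply: span_coord_expz => i ni; exact: supp_delta.
Qed.

Lemma fejer_trig L n : trig (fun z => (fejer L n z)%:C%C).
Proof. by apply: span_sub (fejer_span L n). Qed.

Lemma integ_fejer L n : integ (fejer L n).
Proof. by have [] := cinteg_span m (fejer_trig L n). Qed.

Lemma cint_real (f : torus R -> R) : cint m (fun z => (f z)%:C%C) = (int f)%:C%C.
Proof. by rewrite /cint/= int_cst. Qed.

(** Only the constant term of the last factor survives integration. *)
Lemma int_fejer L n : (forall i, (0 < L i)%N) -> int (fejer L n) = 1.
Proof.
move=> L0; elim: n => [|n IH].
  have -> : fejer L 0 = fun=> 1 by apply/funext => z; rewrite /fejer big_nil.
  exact: int_cst.
apply: (@complexI R); rewrite -cint_real.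
pose l := L n; have l0 : l%:R != 0 :> R by rewrite pnatr_eq0 -lt0n L0.
pose G j k (z : torus R) := (fejer L n z)%:C%C * coord n z ^ (j%:Z - k%:Z).
have iG j k : cinteg m (G j k).
  apply: (cinteg_span m (P := setT)).
  by apply: (trigM (fejer_trig L n)); exact: span_coord_expz.
have cG j k : cint m (G j k) = (j == k)%:R.
  have [->|jk] := eqVneq j k.
    rewrite (_ : G k k = fun z => (fejer L n z)%:C%C) ?cint_real ?IH//.
    by apply/funext => z; rewrite /G subrr expr0z mulr1.
  by rewrite cint_mul_coord// ?subr_eq0//; exact: fejer_span.
rewrite (_ : (fun z => _) = fun z => (l%:R^-1)%:C%C *
    \sum_(0 <= j < l) \sum_(0 <= k < l) G j k z); last first.
  apply/funext => z; rewrite /fejer big_nat_recr//= complexM kappaE ?cabs_coord//.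
  rewrite mulrCA; congr (_ * _); rewrite big_distrr; apply: eq_bigr => j _.
  by rewrite big_distrr.
have iS j : cinteg m (fun z => \sum_(0 <= k < l) G j k z) by exact: cinteg_sum.
rewrite cintZ; last exact: cinteg_sum.
rewrite cint_sum//.
under eq_big_nat => j /andP[_ jl].
  rewrite cint_sum//; under eq_bigr do rewrite cG.
  rewrite (bigD1_seq j) ?mem_index_iota ?iota_uniq//= eqxx big1 ?addr0; last first.
    by move=> k kj; rewrite eq_sym (negPf kj).
  over.
rewrite big_const_nat subn0 iter_addr_0 -(rmorph_nat (real_complex R)) -rmorphM.
by rewrite mulVf// rmorph1.
Qed.

(** The geometric sum telescopes against [x - 1]. *)
Lemma cabs_geom_1B l x : cabs x = 1 -> cabs (x - 1) ^+ 2 * kappa l x <= 4 / l%:R.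
Proof.
move=> x1; rewrite /kappa mulrCA -exprMn -cabsM /geom big_mkord -subrX1 mulrC.
rewrite ler_wpM2r ?invr_ge0//.
have : cabs (x ^+ l - 1) <= 2.
  by rewrite (le_trans (cabsD _ _))// cabsN cabs1 cabsX x1 expr1n.
have := cabs_ge0 (x ^+ l - 1); set c := cabs _ => c0 c2.
by rewrite (_ : 4 = 2 ^+ 2) ?lerXn2r// ?nnegrE//; ring.
Qed.

(** Replacing [L i] by [1] removes the factor in the variable [i]. *)
Lemma int_fejer_coord L n i : (forall i, (0 < L i)%N) -> (i < n)%N ->
  int (fun z => fejer L n z * cabs (coord i z - 1) ^+ 2) <= 4 / (L i)%:R.
Proof.
move=> L0 ilt; pose L' j := if j == i then 1%N else L j.
have L'0 j : (0 < L' j)%N by rewrite /L'; case: ifP.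
have mc : measurable_fun setT (fun z : torus R => cabs (coord i z - 1) ^+ 2).
  apply: measurable_funX; apply/cmeas_cabs/cmeasB; [exact: cmeas_coord|exact: cmeas_cst].
have le z : fejer L n z * cabs (coord i z - 1) ^+ 2 <= 4 / (L i)%:R * fejer L' n z.
  rewrite /fejer (bigD1_seq i) ?mem_index_iota ?iota_uniq//=.
  rewrite [in leRHS](bigD1_seq i) ?mem_index_iota ?iota_uniq//=.
  rewrite {1}/L' eqxx kappa1 mul1r.
  rewrite [in leRHS](eq_bigr (fun j => kappa (L j) (coord j z))); last first.
    by move=> j ji; rewrite /L' (negPf ji).
  rewrite mulrAC; apply: ler_wpM2r; first by apply: prodr_ge0 => j _; exact: kappa_ge0.
  by rewrite mulrC cabs_geom_1B// cabs_coord.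
rewrite -[leRHS]mulr1 -[X in _ <= _ * X](int_fejer n L'0) -intZ; last exact: integ_fejer.
apply: le_int; [|by apply: integZ; exact: integ_fejer|exact: le].
apply: integ_le (integZ (4 / (L i)%:R) (integ_fejer L' n)).
  by apply: measurable_funM => //; exact: integ_meas (integ_fejer L n).
by move=> z; rewrite ger0_norm ?mulr_ge0 ?fejer_ge0 ?cabs_ge0 ?le.
Qed.

Lemma cabs_expz_1B x (k : ssrint.int) : cabs x = 1 -> cabs (x ^ k - 1) <= `|k|%N%:R * cabs (x - 1).
Proof.
move=> x1; have H n : cabs (x ^+ n - 1) <= n%:R * cabs (x - 1).
  elim: n => [|n IH]; first by rewrite expr0 subrr cabs0 mul0r.
  rewrite exprS (_ : x * x ^+ n - 1 = x * (x ^+ n - 1) + (x - 1)); last by ring.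
  by rewrite (le_trans (cabsD _ _))// cabsM x1 mul1r -natr1 mulrDl mul1r lerD2r.
case: k => k; first exact: H.
have x0 := cabs1_neq0 x1.
have -> : `|Negz k|%N = k.+1 by [].
rewrite NegzE -exprnN.
have -> : x ^- k.+1 - 1 = - (x ^- k.+1 * (x ^+ k.+1 - 1)).
  by rewrite mulrBr mulVf ?expf_neq0// mulr1 opprB.
by rewrite cabsN cabsM cabsV cabsX x1 expr1n invr1 mul1r; exact: H.
Qed.

Definition fejer_seq n : torus R -> R := fejer (fun=> n.+1) n.

Lemma integ_fejerM n (f : torus R -> R) (B : R) : measurable_fun setT f ->
  (forall z, `|f z| <= B) -> integ (fun z => fejer_seq n z * f z).
Proof.
move=> mf fB; apply: integ_le (integZ B (integ_fejer (fun=> n.+1) n)).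
  by apply: measurable_funM => //; exact: integ_meas (integ_fejer _ n).
by move=> z; rewrite normrM ger0_norm ?fejer_ge0// mulrC ler_wpM2r ?fejer_ge0.
Qed.

Let mcoord i : measurable_fun setT (fun z : torus R => cabs (coord i z - 1)).
Proof. by apply/cmeas_cabs/cmeasB; [exact: cmeas_coord|exact: cmeas_cst]. Qed.

Let coordB2 i (z : torus R) : `|cabs (coord i z - 1)| <= 2.
Proof.
by rewrite ger0_norm ?cabs_ge0// (le_trans (cabsD _ _))// cabsN cabs1 cabs_coord.
Qed.

(** The kernels concentrate near the unit in each coordinate: by
    [int_fejer_coord] the second moments tend to [0]. *)
Lemma fejer_seq_coord i (e : R) : 0 < e -> \forall n \near \oo,
  int (fun z => fejer_seq n z * cabs (coord i z - 1)) <= e.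
Proof.
move=> e0; pose h := e / 2; have h0 : 0 < h by rewrite divr_gt0.
near=> n.
have ni : (i < n)%N by near: n; exact: nbhs_infty_gt.
have nh : 4 / (h * h) <= n%:R by near: n; exact: nbhs_infty_ger.
pose c (z : torus R) := cabs (coord i z - 1).
have mc2 : measurable_fun setT (fun z => c z ^+ 2).
  exact: (measurable_funX 2 (mcoord i)).
have ic2 : integ (fun z => fejer_seq n z * c z ^+ 2).
  apply: (@integ_fejerM _ _ 4) => // z.
  rewrite ger0_norm ?sqr_ge0// (_ : 4 = 2 ^+ 2); last by ring.
  have c2 : c z <= 2 by rewrite (le_trans (ler_norm _))// coordB2.
  by rewrite lerXn2r ?nnegrE ?cabs_ge0.
have iF := integ_fejer (fun=> n.+1) n.
have := int_fejer_coord (L := fun=> n.+1) (fun=> ltn0Sn n) ni.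
rewrite -/(fejer_seq n) => I2.
(* The first moment is bounded by [c <= h + h^-1 * c ^+ 2]. *)
apply: (@le_trans _ _ (int (fun z => h * fejer_seq n z +
    h^-1 * (fejer_seq n z * c z ^+ 2)))).
  apply: le_int.
  - by apply: (@integ_fejerM _ _ 2) => // z; exact: coordB2.
  - by apply: integD; exact: integZ.
  - move=> z; rewrite (_ : h * _ + _ = fejer_seq n z * (h + h^-1 * c z ^+ 2)); last by ring.
    apply: ler_wpM2l; first exact: fejer_ge0.
    have : 0 <= h^-1 * (c z - h) ^+ 2 by rewrite mulr_ge0 ?sqr_ge0// invr_ge0 ltW.
    have -> : h^-1 * (c z - h) ^+ 2 = h^-1 * c z ^+ 2 - 2 * c z + h.
      by field; rewrite gt_eqF.
    by have := cabs_ge0 (coord i z - 1); rewrite -/(c z); lra.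
rewrite intD; [|exact: integZ|exact: integZ].
rewrite !intZ// int_fejer// mulr1.
apply: (@le_trans _ _ (h + h^-1 * (4 / n.+1%:R))).
  by rewrite lerD2l ler_pM2l ?invr_gt0.
have : h^-1 * (4 / n.+1%:R) <= h.
  rewrite mulrA ler_pdivrMr//; move: nh; rewrite ler_pdivrMr ?mulr_gt0// => nh.
  rewrite -(ler_pM2l h0) mulrA divff ?gt_eqF// mul1r -natr1.
  have hh : 0 <= h * h by rewrite mulr_ge0// ltW.
  lra.
have -> : e = h + h by rewrite /h; field.
by rewrite lerD2l.
Unshelve. all: by end_near. Qed.

(** A character is Lipschitz in each of its coordinates. *)
Lemma fejer_seq_chi N a (e : R) : 0 < e -> \forall n \near \oo,
  int (fun z => fejer_seq n z * cabs (chi N a z - 1)) <= e.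
Proof.
move: e; elim: N => [|N IH] e e0.
  apply: nearW => n; rewrite (_ : (fun z => _) = fun=> 0) ?int_cst ?ltW//.
  by apply/funext => z; rewrite /chi big_nil subrr cabs0 mulr0.
have e20 : 0 < e / 2 by rewrite divr_gt0.
pose k : R := `|a N|%N%:R + 1; have k0 : 0 < k by rewrite ltr_wpDl.
have ek : 0 < e / 2 / k by rewrite divr_gt0.
have mchi M : measurable_fun setT (fun z : torus R => cabs (chi M a z - 1)).
  by apply/cmeas_cabs/cmeasB; [exact: cmeas_chi|exact: cmeas_cst].
have bchi M (z : torus R) : `|cabs (chi M a z - 1)| <= 2.
  by rewrite ger0_norm ?cabs_ge0// (le_trans (cabsD _ _))// cabsN cabs1 cabs_chi.
near=> n.
have h1 : int (fun z => fejer_seq n z * cabs (chi N a z - 1)) <= e / 2.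
  by near: n; exact: IH.
have h2 : int (fun z => fejer_seq n z * cabs (coord N z - 1)) <= e / 2 / k.
  by near: n; exact: fejer_seq_coord.
have i1 := integ_fejerM n (mchi N) (bchi N).
have i2 := integ_fejerM n (mcoord N) (@coordB2 N).
apply: (@le_trans _ _ (int (fun z => fejer_seq n z * cabs (chi N a z - 1) +
    k * (fejer_seq n z * cabs (coord N z - 1))))).
  apply: le_int => //; [exact: integ_fejerM (mchi _) (bchi _)|by apply: integD => //; exact: integZ|].
  move=> z; rewrite mulrCA -mulrDr; apply: ler_wpM2l; first exact: fejer_ge0.
  rewrite /chi big_nat_recr//= -/(chi N a z).
  have -> : chi N a z * coord N z ^ a N - 1 =
    (chi N a z - 1) + chi N a z * (coord N z ^ a N - 1) by ring.
  rewrite (le_trans (cabsD _ _))// lerD2l cabsM cabs_chi mul1r.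
  rewrite (le_trans (cabs_expz_1B _ _)) ?cabs_coord//.
  by rewrite ler_wpM2r ?cabs_ge0// lerDl.
rewrite intD//; last exact: integZ.
rewrite intZ// (_ : e = e / 2 + k * (e / 2 / k)); last by field; rewrite gt_eqF.
by rewrite lerD// ler_pM2l.
Unshelve. all: by end_near. Qed.

End fejer.

(** * Approximation by polynomials with frequencies in the spectrum *)

Section convolution.
Context {R : realType}.
Variables (m : probability (torus R) R) (hm : is_haar m).
Variables (p : R) (p1 : 1 < p).
Local Notation integ f := (m.-integrable setT (EFin \o f)).
Local Notation int f := (Rintegral m setT f).
Implicit Types (f g h t : torus R -> R[i]) (F : torus R -> R).

Let p0 : 0 < p. Proof. exact: lt_trans ltr01 p1. Qed.

(** Young's inequality, in the form giving Jensen's inequality for [powR]. *)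
Lemma young_powR (u a : R) : 0 <= u -> 0 <= a ->
  u `^ (p - 1) * a <= p^-1 * a `^ p + (1 - p^-1) * u `^ p.
Proof.
move=> u0 a0; pose q := p / (p - 1).
have pB : 0 < p - 1 by rewrite subr_gt0.
have q0 : 0 < q by rewrite divr_gt0.
have pq : p^-1 + q^-1 = 1 by rewrite /q invf_div; field; rewrite gt_eqF.
have := @conjugate_powR R a (u `^ (p - 1)) p q a0 (powR_ge0 _ _) p0 q0 pq.
rewrite -powRrM (_ : (p - 1) * q = p); last by rewrite /q; field; rewrite gt_eqF.
rewrite (_ : 1 - p^-1 = q^-1); last by rewrite -pq addrC addKr.
by rewrite mulrC [p^-1 * _]mulrC [q^-1 * _]mulrC.
Qed.

Lemma powRB1M (u : R) : 0 <= u -> u `^ (p - 1) * u = u `^ p.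
Proof.
move=> u0; have [->|un0] := eqVneq u 0; first by rewrite mulr0 powR0// gt_eqF.
by rewrite -{2}(powRr1 u0) -powRD ?subrK//; exact/implyP.
Qed.

(** Jensen's inequality for the probability density [F]: integrate
    [young_powR] with [u] the mean of [r]. *)
Lemma int_powR_le (r F : torus R -> R) : (forall z, 0 <= r z) ->
  (forall z, 0 <= F z) -> integ F -> int F = 1 ->
  integ (fun z => F z * r z) -> integ (fun z => F z * r z `^ p) ->
  (int (fun z => F z * r z)) `^ p <= int (fun z => F z * r z `^ p).
Proof.
move=> r0 F0 Fi F1 i1 ip; set u := int (fun z => F z * r z).
have u0 : 0 <= u by apply: int_ge0 => z; rewrite mulr_ge0.
have : int (fun z => u `^ (p - 1) * (F z * r z)) <=
    int (fun z => p^-1 * (F z * r z `^ p) + ((1 - p^-1) * u `^ p) * F z).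
  apply: le_int; [exact: integZ|by apply: integD; exact: integZ|] => z.
  rewrite (_ : u `^ (p - 1) * _ = F z * (u `^ (p - 1) * r z)); last by ring.
  apply: le_trans (ler_wpM2l (F0 z) (young_powR u0 (r0 z))) _.
  by apply: eq_ler; ring.
rewrite intD; [|exact: integZ|exact: integZ].
rewrite !intZ// F1 mulr1 -/u.
rewrite (powRB1M u0); set X := int _ => H.
have : p^-1 * u `^ p <= p^-1 * X by lra.
by rewrite ler_pM2l// invr_gt0.
Qed.

Definition conv F h z : R[i] :=
  cint m (fun w => (F w)%:C%C * h (torus_mul z w)).

Lemma cinteg_bndM f h : cmeas f -> (exists B, forall z, cabs (f z) <= B) ->
  cinteg m h -> cinteg m (fun z => f z * h z).
Proof.
move=> mf [B fB] hi.
apply: (@cinteg_le _ _ _ _ _ (fun z => B * cabs (h z))).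
- by apply: cmeasM => //; exact: cinteg_meas hi.
- by move=> z; rewrite cabsM ler_wpM2r ?cabs_ge0.
- by apply: integZ; exact: cinteg_cabs.
Qed.

(** By invariance of the measure, a character gives the opposite character
    multiplied by a Fourier coefficient of [h]. *)
Lemma translate_span (Q : set (nat -> ssrint.int)) t h : cinteg m h ->
  (forall N a, supp_below N a -> ~ Q (fun i => - a i) ->
    cint m (fun w => chi N a w * h w) = 0) ->
  trig t -> span Q (fun z => cint m (fun w => t w * h (torus_mul z w))).
Proof.
move=> hi hQ; elim=> [|c N a s sa _ Ts IH].
  apply: eq_span (span_zero Q) => z; rewrite -[LHS](cint_cst m); apply: eq_cint => w.
  by rewrite mul0r.
have ichi : cinteg m (fun w => chi N a w * h w).
  apply: cinteg_bndM => //; first exact: cmeas_chi.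
  by exists 1 => z; rewrite cabs_chi.
have its z : cinteg m (fun w => s w * h (torus_mul z w)).
  apply: (cinteg_bndM (cmeas_span Ts)); last exact: cinteg_mul.
  by have [B _ sB] := span_bounded Ts; exists B.
pose e := c * cint m (fun w => chi N a w * h w).
apply: (eq_span (f := fun z => e * chi N (fun i => - a i) z +
    cint m (fun w => s w * h (torus_mul z w)))).
  move=> z; have iz := cinteg_mul hm z ichi.
  have -> : e = c * cint m (fun w => chi N a (torus_mul z w) * h (torus_mul z w)).
    by rewrite /e -(cint_mul hm z ichi).
  rewrite mulrAC -cintZ// -cintD//; last exact: cintegZ.
  apply: eq_cint => w; rewrite mulrDl; congr (_ + _).
  rewrite chi_mul -chi_conj.
  rewrite -[RHS]mulrA; transitivity (c * (chi N a z * (chi N a z)^*%C) * (chi N a w * h (torus_mul z w))).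
    by ring.
  by rewrite mul_conj cabs_chi expr1n mulr1 mulrA.
apply: spanD => //; have [Qa|nQa] := pselect (Q (fun i => - a i)).
  apply/spanZ/span_chi => // i Ni; rewrite sa// oppr0.
apply: eq_span (span_zero Q) => z; by rewrite /e hQ// mulr0 mul0r.
Qed.

Section kernel.
Variables (F : torus R -> R) (F0 : forall z, 0 <= F z).
Hypothesis TF : trig (fun z => (F z)%:C%C).

Let bF : exists B, forall z, cabs ((F z)%:C%C : R[i]) <= B.
Proof. by have [B _ FB] := span_bounded TF; exists B. Qed.

Let mF : cmeas (fun z => (F z)%:C%C : R[i]).
Proof. exact: cmeas_span TF. Qed.

Lemma cinteg_conv h z : cinteg m h ->
  cinteg m (fun w => (F w)%:C%C * h (torus_mul z w)).
Proof. by move=> hi; apply: (cinteg_bndM mF bF); exact: cinteg_mul. Qed.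

Lemma convB g h z : cinteg m g -> cinteg m h ->
  conv F (fun w => g w - h w) z = conv F g z - conv F h z.
Proof.
move=> gi hi; rewrite /conv -cintB; [|exact: cinteg_conv|exact: cinteg_conv].
by apply: eq_cint => w; rewrite mulrBr.
Qed.

Lemma conv_span (Q : set (nat -> ssrint.int)) h : cinteg m h ->
  (forall N a, supp_below N a -> ~ Q (fun i => - a i) ->
    cint m (fun w => chi N a w * h w) = 0) ->
  span Q (conv F h).
Proof. by move=> hi hQ; exact: (translate_span hi hQ TF). Qed.

Lemma conv_trig h : cinteg m h -> trig (conv F h).
Proof. by move=> hi; apply: conv_span => // N a _; case. Qed.

Hypothesis F1 : int F = 1.

Let iF : integ F.
Proof. by have [] := cinteg_span m TF. Qed.

Let mjoint h : cmeas h ->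
  measurable_fun setT (fun zw : torus R * torus R =>
    (F zw.2 * cabs (h (torus_mul zw.1 zw.2)) `^ p)%:E).
Proof.
move=> mh; apply/measurable_EFinP; apply: measurable_funM.
  by apply: measurableT_comp; [have [] := mF|exact: measurable_snd].
have mhp := meas_cabs_powR p mh.
apply: (eq_measurable_fun
  ((fun z => cabs (h z) `^ p) \o (fun zw : torus R * torus R => torus_mul zw.2 zw.1))).
  by move=> zw _ /=; rewrite torus_mulC.
exact: measurableT_comp mhp (@measurable_torus_mul2 R).
Qed.

(** Jensen's inequality under the integral sign, then Tonelli's theorem and the
    invariance of the measure. *)
Lemma conv_contraction h : cinteg m h -> inLp m p h ->
  int (fun z => cabs (conv F h z) `^ p) <= int (fun z => cabs (h z) `^ p).
Proof.
move=> hi [mh hp].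
have Tc := conv_trig hi.
have icp : integ (fun z => cabs (conv F h z) `^ p).
  by have [] := trig_inLp m p0 Tc.
pose G (zw : torus R * torus R) := (F zw.2 * cabs (h (torus_mul zw.1 zw.2)) `^ p)%:E.
have G0 zw : (0 <= G zw)%E by rewrite lee_fin mulr_ge0// powR_ge0.
have mG z : measurable_fun setT (fun w => G (z, w)).
  exact: (measurable_fun_pair2 z (mjoint mh)).
have pt z : ((cabs (conv F h z) `^ p)%:E <= \int[m]_w G (z, w))%E.
  have [fin|] := ltP (\int[m]_w G (z, w))%E (+oo)%E; last by rewrite leye_eq => /eqP ->; rewrite leey.
  have iG : integ (fun w => F w * cabs (h (torus_mul z w)) `^ p).
    apply: integ_ge0 fin; first by apply/measurable_EFinP; exact: mG z.
    by move=> w; rewrite mulr_ge0// powR_ge0.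
  have i1 := cinteg_conv z hi.
  have iFh : integ (fun w => F w * cabs (h (torus_mul z w))).
    have := cinteg_cabs i1; congr (m.-integrable setT (EFin \o _)).
    by apply/funext => w; rewrite cabsM cabs_real ger0_norm.
  rewrite (int_EFin (f := fun w => F w * cabs (h (torus_mul z w)) `^ p))// lee_fin.
  apply: le_trans (int_powR_le (r := fun w => cabs (h (torus_mul z w))) _ F0 iF F1 iFh iG).
    apply: powR_le => //; first exact: cabs_ge0.
    apply: le_trans (cabs_cint_le i1) _.
    by apply: eq_ler; congr Rintegral;
      apply/funext => w; rewrite cabsM cabs_real ger0_norm.
  by move=> w; exact: cabs_ge0.
rewrite -lee_fin -(int_EFin icp).
apply: (@le_trans _ _ (\int[m]_z \int[m]_w G (z, w))%E).
  apply: ge0_le_integral => //.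
  - by move=> z _; rewrite lee_fin powR_ge0.
  - by apply/measurable_EFinP; exact: integ_meas icp.
  - exact: (measurable_fun_fubini_tonelli_F (m2 := m) G (mjoint mh) G0).
rewrite fubini_tonelli//; last exact: mjoint.
have mhp : measurable_fun setT (fun z => (cabs (h z) `^ p)%:E).
  by apply/measurable_EFinP; exact: meas_cabs_powR.
have E w : (\int[m]_z G (z, w) = (F w)%:E * (int (fun z => cabs (h z) `^ p))%:E)%E.
  transitivity (\int[m]_z ((F w)%:E * (cabs (h (torus_mul w z)) `^ p)%:E))%E.
    by apply: eq_integral => z _; rewrite /G/= torus_mulC EFinM.
  have mhw : measurable_fun setT (fun z => (cabs (h (torus_mul w z)) `^ p)%:E).
    exact: (measurableT_comp mhp (measurable_torus_mul w)).
  have hw0 z : setT z -> (0 <= (cabs (h (torus_mul w z)) `^ p)%:E)%E.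
    by move=> _; rewrite lee_fin powR_ge0.
  rewrite (ge0_integralZl_EFin m measurableT hw0 mhw (F0 w)).
  have hp0 z : (0 <= (cabs (h z) `^ p)%:E)%E by rewrite lee_fin powR_ge0.
  by have /= -> := ge0_integral_mul hm w mhp hp0; rewrite (int_EFin hp).
under eq_integral do rewrite E.
rewrite ge0_integralZr//.
- by rewrite int_EFin// F1 mul1e.
- by apply/measurable_EFinP; exact: integ_meas iF.
- by move=> z _; rewrite lee_fin.
- by rewrite lee_fin int_ge0// => z; exact: powR_ge0.
Qed.

End kernel.

Local Notation fejer_seq := (@fejer_seq R).

(** A character is multiplied by a scalar that tends to [1] by
    [fejer_seq_chi]. *)
Lemma conv_fejer_trig t : trig t -> forall e : R, 0 < e ->
  \forall n \near \oo, forall z, cabs (conv (fejer_seq n) t z - t z) <= e.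
Proof.
elim=> [|c N a s sa _ Ts IH] e e0.
  apply: nearW => n z; rewrite /conv (eq_cint m (g := fun=> 0)); last first.
    by move=> w; rewrite mulr0.
  by rewrite cint_cst subrr cabs0 ltW.
have e20 : 0 < e / 2 by rewrite divr_gt0.
pose k := cabs c + 1; have k0 : 0 < k by rewrite ltr_wpDl ?cabs_ge0.
have ek : 0 < e / 2 / k by rewrite divr_gt0.
near=> n.
have h1 z : cabs (conv (fejer_seq n) s z - s z) <= e / 2.
  by move: z; near: n; exact: IH.
have h2 : int (fun z => fejer_seq n z * cabs (chi N a z - 1)) <= e / 2 / k.
  by near: n; exact: fejer_seq_chi.
move=> z; have TF := fejer_trig (fun=> n.+1) n : trig (fun z => (fejer_seq n z)%:C%C).
have ichi := cinteg_chi m N a.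
have is1 := cinteg_span m Ts.
have mf1 : cmeas (fun w : torus R => chi N a w - 1).
  by apply: cmeasB; [exact: cmeas_chi|exact: cmeas_cst].
have if1 : cinteg m (fun w => (fejer_seq n w)%:C%C * (chi N a w - 1)).
  apply: (cinteg_bndM (cmeas_span TF)).
    by have [B _ HB] := span_bounded TF; exists B.
  by apply: (@cinteg_bnd _ _ _ _ _ 2) => // w;
    rewrite (le_trans (cabsD _ _))// cabsN cabs1 cabs_chi.
have E : conv (fejer_seq n) (fun z => c * chi N a z + s z) z - (c * chi N a z + s z) =
    c * chi N a z * cint m (fun w => (fejer_seq n w)%:C%C * (chi N a w - 1)) +
    (conv (fejer_seq n) s z - s z).
  have iF : cinteg m (fun z => (fejer_seq n z)%:C%C) := cinteg_span m TF.
  have F1 : cint m (fun z => (fejer_seq n z)%:C%C) = 1.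
    by rewrite cint_real int_fejer.
  have iFc : cinteg m (fun w => (c * chi N a z) * ((fejer_seq n w)%:C%C * (chi N a w - 1))).
    exact: cintegZ.
  rewrite /conv -cintZ// (eq_cint m (g := fun w =>
    (c * chi N a z) * ((fejer_seq n w)%:C%C * (chi N a w - 1)) +
    ((c * chi N a z) * (fejer_seq n w)%:C%C +
    (fejer_seq n w)%:C%C * s (torus_mul z w)))); last first.
    by move=> w; rewrite chi_mul; ring.
  have iFs := cinteg_conv TF z is1.
  rewrite cintD//; last by apply: cintegD => //; exact: cintegZ.
  rewrite cintD//; last exact: cintegZ.
  by rewrite [cint m (fun w => c * chi N a z * (fejer_seq n w)%:C%C)]cintZ// F1; ring.
rewrite E (le_trans (cabsD _ _))// [e]splitr lerD//.
rewrite !cabsM cabs_chi mulr1.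
have le : cabs (cint m (fun w => (fejer_seq n w)%:C%C * (chi N a w - 1))) <= e / 2 / k.
  apply: le_trans h2; apply: le_trans (cabs_cint_le if1) _.
  apply: eq_ler; congr Rintegral.
  by apply/funext => w; rewrite cabsM cabs_real ger0_norm// fejer_ge0.
apply: (@le_trans _ _ (k * (e / 2 / k))).
  by apply: ler_pM; rewrite ?cabs_ge0// lerDl.
by rewrite mulrC divfK// gt_eqF.
Unshelve. all: by end_near. Qed.

(** Convolutions with Fejer kernels have their frequencies in the spectrum of
    [h]. They converge on trigonometric polynomials, which are dense, and they
    are contractions of $L^p$, so they converge to [h]. *)
Lemma spectral_approx (Q : set (nat -> ssrint.int)) h :
  cinteg m h -> inLp m p h ->
  (forall N a, supp_below N a -> ~ Q (fun i => - a i) ->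
    cint m (fun w => chi N a w * h w) = 0) ->
  approx m p (span Q) h.
Proof.
move=> hi hp hQ e e0.
pose K : R := 2 `^ p; have K0 : 0 < K by exact: powR_gt0.
pose D := K * (1 + K * (1 + 1)).
have D0 : 0 < D by rewrite mulr_gt0// addr_gt0// mulr_gt0.
pose e1 := e / D; have e10 : 0 < e1 by rewrite divr_gt0.
have [t Tt ht] := trig_dense p0 hp e10.
pose e2 := e1 `^ p^-1; have e20 : 0 < e2 by exact: powR_gt0.
have [n _ nE] := conv_fejer_trig Tt e20.
have {nE}cvt := nE n (leqnn n).
pose F := fejer_seq n.
have TF := fejer_trig (fun=> n.+1) n : trig (fun z => (F z)%:C%C).
have F0 : forall z, 0 <= F z by move=> z; exact: fejer_ge0.
have F1 : int F = 1 by exact: int_fejer.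
have ti := cinteg_span m Tt; have tp := trig_inLp m p0 Tt.
have cti := trig_inLp m p0 (conv_trig TF ti).
have chi' := trig_inLp m p0 (conv_trig TF hi).
exists (conv F h); first exact: conv_span.
apply: le_trans (pdist_tri p0 hp tp chi') _.
apply: (@le_trans _ _ (K * (e1 + K * (e1 + e1)))); last first.
  have -> : e = D * e1 by rewrite mulrC divfK// gt_eqF.
  by apply: eq_ler; rewrite /D; ring.
rewrite (ler_pM2l K0); apply: lerD; first exact: ht.
apply: le_trans (pdist_tri p0 tp cti chi') _.
rewrite (ler_pM2l K0); apply: lerD.
- rewrite -(int_cst m e1); apply: le_int.
  + exact: integ_pdist.
  + exact: integ_cst.
  + move=> z; rewrite cabsB.
    rewrite -[leRHS](powRr1 (ltW e10)) -(mulVf (lt0r_neq0 p0)) powRrM.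
    by apply: (powR_le p0); [exact: cabs_ge0|exact: cvt].
- have th : inLp m p (fun z => t z - h z) by exact: inLpB.
  have thi : cinteg m (fun z => t z - h z) by exact: cintegB.
  apply: le_trans (_ : pdist m p t h <= _); last by rewrite pdistC.
  apply: le_trans (conv_contraction F0 TF F1 thi th).
  apply: eq_ler; congr Rintegral; apply/funext => z.
  by rewrite convB.
Qed.

End convolution.

(** * Lexicographic half-spaces and analytic polynomials *)

Section half_spaces.
Implicit Types a b : nat -> ssrint.int.

Definition lex_pos a := exists n, 0 < a n /\ forall j, (j < n)%N -> a j = 0.

(** Coordinate [i] is compared first, so that every exponent positive at [i]
    belongs to the half-space. *)
Definition lex_half i : set (nat -> ssrint.int) :=
  [set a | 0 < a i \/ a i = 0 /\ lex_pos a].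

Lemma lex_posD a b : lex_pos a -> lex_pos b -> lex_pos (fun i => a i + b i).
Proof.
move=> [n [an a0]] [k [bk b0]]; exists (minn n k).
split=> [|j]; last by rewrite ltn_min => /andP[jn jk]; rewrite a0// b0// addr0.
have [nk|kn|nk] := ltngtP n k.
- by rewrite b0// addr0.
- by rewrite a0// add0r.
- by rewrite addr_gt0// -?nk// nk.
Qed.

Lemma half_space_lex i : half_space (lex_half i).
Proof.
split.
- move=> a b [ai|[ai La]] [bi|[bi Lb]].
  + by left; rewrite addr_gt0.
  + by left; rewrite bi addr0.
  + by left; rewrite ai add0r.
  + by right; rewrite ai bi addr0; split => //; exact: lex_posD.
- move=> a [ai|[_ [n [an _]]]]; first by exists i; rewrite gt_eqF.
  by exists n; rewrite gt_eqF.
- move=> N a sa.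
  have [ai|ai|ai] := ltgtP (a i) 0.
  + by apply: Or33; left; rewrite oppr_gt0.
  + by apply: Or32; left.
  have [a0|/existsNP ex] := pselect (forall j, a j = 0); first exact: Or31.
  have {}ex : exists j, a j != 0 by case: ex => j /eqP; exists j.
  pose n := ex_minn ex.
  have an : a n != 0 by rewrite /n; case: ex_minnP.
  have a0 j : (j < n)%N -> a j = 0.
    rewrite /n; case: ex_minnP => k _ kmin jk; apply/eqP.
    by apply: contraLR jk => aj; rewrite -leqNgt kmin.
  case: (ltgtP (a n) 0) an => // an _.
  + apply: Or33; right; rewrite ai oppr0; split => //.
    by exists n; rewrite oppr_gt0; split => // j jn; rewrite a0// oppr0.
  + by apply: Or32; right; split => //; exists n.
Qed.

Definition nonneg : set (nat -> ssrint.int) := [set a | forall i, 0 <= a i].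

Definition nonneg_neq0 : set (nat -> ssrint.int) :=
  [set a | nonneg a /\ exists i, a i != 0].

Lemma nonneg_neq0_lex i : nonneg_neq0 `<=` lex_half i.
Proof.
move=> a [a0 ex]; have := a0 i; rewrite le_eqVlt => /orP[/eqP ai|]; last by left.
right; split => //; pose n := ex_minn ex.
have an : a n != 0 by rewrite /n; case: ex_minnP.
exists n; split=> [|j]; first by rewrite lt_def an a0.
rewrite /n; case: ex_minnP => k _ kmin jk; apply/eqP.
by apply: contraLR jk => aj; rewrite -leqNgt kmin.
Qed.

End half_spaces.

Section analytic_polynomials.
Context {R : realType}.
Variables (m : probability (torus R) R) (hm : is_haar m).
Implicit Types (f g : torus R -> R[i]).

Definition mexp n (k : mpoly.multinom n) (i : nat) : ssrint.int :=
  if insub i is Some j then Posz (mpoly.fun_of_multinom k j) else 0.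

Lemma mexp_supp n (k : mpoly.multinom n) : supp_below n (mexp k).
Proof. by move=> i ni; rewrite /mexp insubF// ltnNge ni. Qed.

Lemma poly_funE n (q : mpoly.mpoly n R[i]) z : poly_fun q z =
  \sum_(k <- mpoly.msupp q) mpoly.mcoeff k q * chi n (mexp k) z.
Proof.
rewrite /poly_fun mpoly.mevalE; apply: eq_bigr => k _; congr (_ * _).
rewrite /chi big_mkord; apply: eq_bigr => i _.
by rewrite /mexp valK.
Qed.

Lemma span_analytic f : analytic_poly f -> span nonneg f.
Proof.
move=> [n [q ->]]; apply: eq_span (fun z => esym (poly_funE q z)) _.
apply: span_sum => k; apply/spanZ/span_chi; first exact: mexp_supp.
by move=> i; rewrite /mexp; case: insubP.
Qed.

(** Every nonconstant monomial has integral [0]. *)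
Lemma cint_poly_fun n (q : mpoly.mpoly n R[i]) :
  cint m (poly_fun q) = mpoly.meval (fun=> 0) q.
Proof.
rewrite (eq_cint m (poly_funE q)) mpoly.mevalE cint_sum; last first.
  by move=> k; apply/cintegZ/cinteg_chi.
apply: eq_bigr => k _; rewrite cintZ; last exact: cinteg_chi.
congr (_ * _); have [k0|/existsNP[i /eqP ki]] :=
    pselect (forall i, mpoly.fun_of_multinom k i = 0%N).
  rewrite (eq_cint m (g := fun=> 1)) ?cint_cst; last first.
    by move=> z; apply: chi0 => i; rewrite /mexp; case: insubP => // j _ _; rewrite k0.
  by rewrite big1// => i _; rewrite k0 expr0.
rewrite (cint_chi0 hm (@mexp_supp n k)); last first.
  by exists i; rewrite /mexp valK.
by rewrite (bigD1 i)//= expr0n (negPf ki) mul0r.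
Qed.

Lemma poly_fun_widen n k (q : mpoly.mpoly n R[i]) : (n <= k)%N ->
  exists q' : mpoly.mpoly k R[i], poly_fun q = poly_fun q'.
Proof.
move=> nk; exists (mpoly.comp_mpoly
  [tuple mpoly.mpolyX R[i] (mpoly.mnm1 (widen_ord nk i)) | i < n] q).
apply/funext => z; rewrite /poly_fun mpoly.comp_mpoly_meval.
congr (mpoly.meval _ q); apply/funext => i.
by rewrite tnth_mktuple mpoly.mevalXU.
Qed.

Lemma analytic_span f : span nonneg f -> analytic_poly f.
Proof.
elim=> [|c N a g sa a0 _ [n [q ->]]].
  by exists 0%N, 0; apply/funext => z; rewrite /poly_fun mpoly.meval0.
pose mon := mpoly.mpolyX R[i] (mpoly.Multinom [tuple `|a i|%N | i < N]).
have [q1 E1] := poly_fun_widen (c *: mon) (leq_maxl N n).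
have [q2 E2] := poly_fun_widen q (leq_maxr N n).
exists (maxn N n), (q1 + q2); apply/funext => z.
rewrite {2}/poly_fun mpoly.mevalD -/(poly_fun q1 z) -/(poly_fun q2 z) -E1 -E2.
congr (_ + _); rewrite /poly_fun mpoly.mevalZ; congr (_ * _).
rewrite mpoly.mevalX /chi big_mkord; apply: eq_bigr => i _.
by rewrite mpoly.mnmE -[in LHS](gez0_abs (a0 i)).
Qed.

Lemma analytic_polyE : @analytic_poly R = span nonneg.
Proof. by apply/seteqP; split=> f; [exact: span_analytic|exact: analytic_span]. Qed.

Lemma nonneg_split f : span nonneg f -> exists2 g, span nonneg_neq0 g &
  forall z, f z = cint m f + g z.
Proof.
move=> Nf; have [c [g Ng E]] : exists c, exists2 g, span nonneg_neq0 g &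
    forall z, f z = c + g z.
  elim: Nf => [|c N a h sa a0 _ [c' [g Ng E]]].
    by exists 0, (fun=> 0) => [|z]; [exact: span_zero|rewrite addr0].
  have [az|/existsNP ex] := pselect (forall j, a j = 0).
    by exists (c + c'), g => // z; rewrite chi0// mulr1 E addrA.
  exists c', (fun z => c * chi N a z + g z) => [|z]; last by rewrite E addrCA.
  apply: span_cons => //; split => //.
  by case: ex => j /eqP; exists j.
exists g => // z; rewrite E; congr (_ + _).
rewrite (_ : f = fun z => c + g z); last exact/funext.
rewrite cintD; [|exact: cinteg_cst|exact: cinteg_span Ng].
by rewrite cint_cst (cint_span0 hm _ Ng) ?addr0// => a [].
Qed.

Lemma span_nonnegM f g : span nonneg f -> span nonneg g ->
  span nonneg (fun z => f z * g z).
Proof.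
by move=> Nf Ng; apply: (spanM _ Nf Ng) => a b a0 b0 i; rewrite addr_ge0// ?a0 ?b0.
Qed.

(** A product with a polynomial without constant term has no constant term
    either. *)
Lemma cint_nonnegM f g : span nonneg f -> span nonneg g ->
  cint m (fun z => f z * g z) = cint m f * cint m g.
Proof.
move=> Nf Ng; have [f0 Nf0 fE] := nonneg_split Nf.
have gi := cinteg_span m Ng.
have N0 : span nonneg_neq0 (fun z => f0 z * g z).
  apply: (spanM _ Nf0 Ng) => a b [a0 [i ai]] b0; split.
    by move=> j; rewrite addr_ge0.
  by exists i; rewrite gt_eqF// ltr_pwDl// lt_def ai a0.
rewrite (eq_cint m (g := fun z => cint m f * g z + f0 z * g z)); last first.
  by move=> z; rewrite [in LHS]fE mulrDl.
rewrite cintD; [|exact: cintegZ|exact: cinteg_span N0].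
by rewrite cintZ// (cint_span0 hm _ N0) ?addr0// => a [].
Qed.

Lemma analytic_poly0P f : analytic_poly0 f <-> span nonneg f /\ cint m f = 0.
Proof.
split=> [[n [q [q0 ->]]]|[/analytic_span[n [q ->]] q0]].
  by rewrite cint_poly_fun; split => //; apply: span_analytic; exists n, q.
by exists n, q; rewrite -cint_poly_fun.
Qed.

Lemma span_analytic0 f : analytic_poly0 f -> span nonneg_neq0 f.
Proof.
move=> /analytic_poly0P[Nf f0]; have [g Ng E] := nonneg_split Nf.
by apply: eq_span Ng => z; rewrite E f0 add0r.
Qed.

End analytic_polynomials.

(** * The Hardy space and its cyclic vectors *)

Section closures.
Context {d : measure_display} {T : measurableType d} {R : realType}.
Variables (m : probability T R) (p : R) (p0 : 0 < p).
Implicit Types (f g : T -> R[i]) (S : set (T -> R[i])).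
Local Notation int f := (Rintegral m setT f).

Lemma integral_cabs_powR f :
  (\int[m]_x `|(EFin \o (fun x => cabs (f x))) x| `^ p =
   \int[m]_x (cabs (f x) `^ p)%:E)%E.
Proof.
apply: eq_integral => x _.
by rewrite /comp abse_EFin poweR_EFin ger0_norm ?cabs_ge0.
Qed.

Lemma cLnormE f : inLp m p f ->
  cLnorm m p f = ((int (fun x => cabs (f x) `^ p)) `^ p^-1)%:E.
Proof.
move=> [mf fi]; rewrite /cLnorm Lnorm.unlock.
by rewrite integral_cabs_powR (int_EFin fi) poweR_EFin.
Qed.

Lemma cLpE f : cLp m p f <-> inLp m p f.
Proof.
split=> [[m1 m2 Nf]|fi]; last first.
  by split; [exact: fi.1.1|exact: fi.1.2|rewrite (cLnormE fi) ltry].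
split; first by split.
apply: integ_ge0; [exact: meas_cabs_powR|by move=> x; exact: powR_ge0|].
rewrite -integral_cabs_powR -powR_Lnorm ?gt_eqF//.
exact: poweR_lty.
Qed.

Lemma Lp_closureP S f : S `<=` inLp m p ->
  Lp_closure m p S f <-> inLp m p f /\ approx m p S f.
Proof.
move=> Si; split=> [[/cLpE fi H]|[fi H]].
- split=> // e e0; have e'0 : 0 < e `^ p^-1 by rewrite powR_gt0.
  have [g Sg] := H _ e'0; move=> H1; exists g => //; move: H1.
  have fg := inLpB p0 fi (Si _ Sg).
  rewrite (cLnormE fg) lte_fin => lt; rewrite leNgt; apply/negP => /ltW le.
  move: lt; rewrite ltNge => /negP; apply.
  apply: ge0_ler_powR; [by rewrite invr_ge0 ltW| | |exact: le].
    by rewrite nnegrE ltW.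
  by rewrite nnegrE pdist_ge0.
- split; first exact/cLpE.
  move=> e e0; have [b b0 be] : exists2 b : R, 0 < b & b < e by exists (e / 2); lra.
  have [g Sg fg] := H _ (powR_gt0 p b0); exists g => //.
  rewrite (cLnormE (inLpB p0 fi (Si _ Sg))) lte_fin; apply: le_lt_trans be.
  rewrite -[leRHS](powRr1 (ltW b0)) -(mulfV (lt0r_neq0 p0)) powRrM.
  apply: ge0_ler_powR; [by rewrite invr_ge0 ltW| | |exact: fg].
    by rewrite nnegrE pdist_ge0.
  by rewrite nnegrE powR_ge0.
Qed.

End closures.

Section hardy_space.
Context {R : realType}.
Variables (m : probability (torus R) R) (hm : is_haar m) (p : R) (p1 : 1 < p).
Implicit Types (f g h q : torus R -> R[i]).
Local Notation int f := (Rintegral m setT f).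
Local Notation integ f := (m.-integrable setT (EFin \o f)).

Let p0 : 0 < p. Proof. exact: lt_trans ltr01 p1. Qed.

Lemma powR_ge_id (x : R) : 0 <= x -> x <= 1 + x `^ p.
Proof.
move=> x0; have [x1|x1] := lerP x 1; first by rewrite (le_trans x1)// lerDl powR_ge0.
rewrite -[leLHS](powRr1 x0); apply: (@le_trans _ _ (x `^ p)); last by rewrite lerDr.
by apply: ler_powR; exact: ltW.
Qed.

Lemma cinteg_inLp f : inLp m p f -> cinteg m f.
Proof.
move=> [mf fi]; apply: (@cinteg_le _ _ _ _ _ (fun z => 1 + cabs (f z) `^ p)) => //.
  by move=> z; exact: powR_ge_id (cabs_ge0 _).
by apply: integD => //; exact: integ_cst.
Qed.

(** From [x <= c * (1 + (x / c) `^ p)], where [c] is half of [e]. *)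
Lemma L1_le_pdist (e : R) : 0 < e -> exists2 b : R, 0 < b & forall f g,
  inLp m p f -> inLp m p g -> pdist m p f g <= b ->
  int (fun z => cabs (f z - g z)) <= e.
Proof.
move=> e0; pose c := e / 2; have c0 : 0 < c by rewrite divr_gt0.
exists (c `^ p) => [|f g fi gi fg]; first by rewrite powR_gt0.
have fgi := integ_pdist p0 fi gi.
pose k := c / c `^ p; have cp : 0 < c `^ p by rewrite powR_gt0.
apply: (@le_trans _ _ (int (fun z => c + k * cabs (f z - g z) `^ p))).
  apply: le_int.
  - by apply: cinteg_cabs; apply: cintegB; exact: cinteg_inLp.
  - by apply: integD; [exact: integ_cst|exact: integZ].
  - move=> z; set x := cabs _; have x0 : 0 <= x by exact: cabs_ge0.
    have xc : x `^ p = c `^ p * (x / c) `^ p.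
      by rewrite -(powRM p (ltW c0) (divr_ge0 x0 (ltW c0))) [c * _]mulrC divfK// gt_eqF.
    have -> : c + k * x `^ p = c * (1 + (x / c) `^ p).
      by rewrite xc /k; field; rewrite gt_eqF.
    rewrite -ler_pdivrMl// mulrC; apply: powR_ge_id.
    by rewrite divr_ge0// ltW.
rewrite intD; [|exact: integ_cst|exact: integZ].
rewrite int_cst intZ//.
have : k * pdist m p f g <= k * c `^ p by rewrite ler_pM2l// divr_gt0.
rewrite /k divfK ?gt_eqF// -/k /pdist /c; lra.
Qed.

Lemma hardyP f : hardy m p f <-> inLp m p f /\ approx m p (span nonneg) f.
Proof.
rewrite /hardy analytic_polyE; apply: (Lp_closureP p0) => g Ng.
by apply: (trig_inLp m p0); apply: span_sub Ng.
Qed.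

Definition multiples h : set (torus R -> R[i]) :=
  [set (fun z => q z * h z) | q in span nonneg].

Lemma span_mul_inLp P q h : span P q -> inLp m p h ->
  inLp m p (fun z => q z * h z).
Proof.
move=> Nq hi; have [B _ qB] := span_bounded Nq.
exact: (inLpM p0 (cmeas_span Nq) qB hi).
Qed.

Lemma invariant_spanP h f : inLp m p h ->
  invariant_span m p h f <-> inLp m p f /\ approx m p (multiples h) f.
Proof.
move=> hi; rewrite /invariant_span analytic_polyE; apply: (Lp_closureP p0).
by move=> _ [q Nq <-]; exact: span_mul_inLp Nq hi.
Qed.

(** Approaching the constant [1] is enough, since every polynomial is a
    multiple of it and polynomials are dense. *)
Lemma cyclicP h : cyclic_vector m p h <->
  [/\ inLp m p h, approx m p (span nonneg) h & approx m p (multiples h) (fun=> 1)].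
Proof.
have N1 : span nonneg (fun _ : torus R => 1) by exact: span_cst.
have Lp1 : inLp m p (fun _ : torus R => 1).
  by apply: (trig_inLp m p0); exact: span_cst.
split=> [[/hardyP[hi Nh] E]|[hi Nh h1]].
  split; [exact: hi|exact: Nh|].
  suff /(invariant_spanP _ hi)[] : invariant_span m p h (fun=> 1) by [].
  by rewrite E; apply/hardyP; split; [exact: Lp1|exact: approx_self].
have Mi : multiples h `<=` inLp m p by move=> _ [q Nq <-]; exact: span_mul_inLp Nq hi.
have Ni : span nonneg `<=` inLp m p.
  by move=> q Nq; apply: (trig_inLp m p0); apply: span_sub Nq.
split; first exact/hardyP.
apply/seteqP; split=> f.
- move=> /(invariant_spanP _ hi)[fi Mf]; apply/hardyP; split; first exact: fi.
  apply: (approx_trans p0 Ni fi) => e e0; have [_ [q Nq <-] fq] := Mf _ e0.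
  exists (fun z => q z * h z); split; [exact: span_mul_inLp Nq hi| |exact: fq].
  have [B B0 qB] := span_bounded Nq => e' e'0.
  have Bp : 0 < B `^ p by rewrite powR_gt0.
  have [g Ng hg] := Nh _ (divr_gt0 e'0 Bp).
  exists (fun z => q z * g z); first exact: span_nonnegM.
  apply: le_trans (pdistM p0 (cmeas_span Nq) qB hi (Ni _ Ng)) _.
  by rewrite mulrC -ler_pdivlMr.
- move=> /hardyP[fi Nf]; apply/(invariant_spanP _ hi); split; first exact: fi.
  apply: (approx_trans p0 Mi fi) => e e0; have [q Nq fq] := Nf _ e0.
  exists q; split; [exact: Ni| |exact: fq].
  have [B B0 qB] := span_bounded Nq => e' e'0.
  have Bp : 0 < B `^ p by rewrite powR_gt0.
  have [_ [g Ng <-] hg] := h1 _ (divr_gt0 e'0 Bp).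
  exists (fun z => q z * g z * h z); first by exists (fun z => q z * g z) => //; exact: span_nonnegM.
  have := pdistM p0 (cmeas_span Nq) qB Lp1 (span_mul_inLp Ng hi).
  rewrite (_ : (fun z => q z * 1) = q); last by apply/funext => z; rewrite mulr1.
  rewrite (_ : (fun z => q z * (g z * h z)) = fun z => q z * g z * h z); last first.
    by apply/funext => z; rewrite mulrA.
  move=> /le_trans; apply; by rewrite mulrC -ler_pdivlMr.
Qed.

End hardy_space.

(** * Phases and convexity defects *)

Section phase.
Context {R : realType}.
Variables (p : R) (p1 : 1 < p).
Implicit Types a b : R[i].

Let p0 : 0 < p. Proof. exact: lt_trans ltr01 p1. Qed.

Definition phase a : R[i] := ((cabs a)^-1)%:C%C * a.

Lemma cabs_phase a : a != 0 -> cabs (phase a) = 1.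
Proof.
move=> a0; have ca := cabs_gt0 a0.
by rewrite cabsM cabs_real ger0_norm ?invr_ge0 ?cabs_ge0// mulVf// gt_eqF.
Qed.

Lemma cabs_phase_le1 a : cabs (phase a) <= 1.
Proof.
have [->|a0] := eqVneq a 0; first by rewrite /phase mulr0 cabs0.
by rewrite cabs_phase.
Qed.

Lemma phaseE a : a = (cabs a)%:C%C * phase a.
Proof.
have [->|a0] := eqVneq a 0; first by rewrite /phase !mulr0.
by rewrite /phase mulrA -complexM divff ?mul1r// gt_eqF// cabs_gt0.
Qed.

(** The polarisation identity, with moduli and phases separated. *)
Lemma phase_dist a b : a != 0 -> b != 0 ->
  cabs a * cabs b * cabs (phase a - phase b) ^+ 2 =
  (cabs a + cabs b) ^+ 2 - cabs (a + b) ^+ 2.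
Proof.
move=> a0 b0; have := cabs_phase b0; have := cabs_phase a0.
have -> : cabs (a + b) = cabs ((cabs a)%:C%C * phase a + (cabs b)%:C%C * phase b).
  by rewrite -!phaseE.
move: (cabs a) (cabs b) (phase a) (phase b) => al be u v u1 v1.
have {u1}u2 : complex.Re u ^+ 2 + complex.Im u ^+ 2 = 1 by rewrite -cabs_sqr u1 expr1n.
have {v1}v2 : complex.Re v ^+ 2 + complex.Im v ^+ 2 = 1 by rewrite -cabs_sqr v1 expr1n.
rewrite !cabs_sqr !ReD !ImD !ReN !ImN !ReM !ImM !mul0r !subr0 !addr0.
move: u2 v2; set x := complex.Re u; set y := complex.Im u.
set s := complex.Re v; set t := complex.Im v => u2 v2.
rewrite [complex.Re (al%:C)%C]/= [complex.Re (be%:C)%C]/=.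
have -> : (al * x + be * s) ^+ 2 + (al * y + be * t) ^+ 2 =
  al ^+ 2 * (x ^+ 2 + y ^+ 2) + be ^+ 2 * (s ^+ 2 + t ^+ 2) + 2 * al * be * (x * s + y * t).
  by ring.
have -> : (x - s) ^+ 2 + (y - t) ^+ 2 =
  (x ^+ 2 + y ^+ 2) + (s ^+ 2 + t ^+ 2) - 2 * (x * s + y * t) by ring.
by rewrite u2 v2; ring.
Qed.

(** The sum of [young_powR] at [x] and [y], with [u] their mean. *)
Lemma power_mean (x y : R) : 0 <= x -> 0 <= y ->
  ((x + y) / 2) `^ p <= (x `^ p + y `^ p) / 2.
Proof.
move=> x0 y0; set u := (x + y) / 2.
have u0 : 0 <= u by rewrite divr_ge0// addr_ge0.
have := young_powR p1 u0 x0; have := young_powR p1 u0 y0.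
have E : u `^ (p - 1) * x + u `^ (p - 1) * y = 2 * u `^ p.
  rewrite -mulrDr (_ : x + y = 2 * u); last by rewrite /u; field.
  by rewrite mulrCA (powRB1M p1 u0).
set X := x `^ p in E *; set Y := y `^ p in E *; set U := u `^ p in E *.
move=> H1 H2.
have : p^-1 * (2 * U) <= p^-1 * (X + Y) by rewrite mulrDr; lra.
by rewrite ler_pM2l ?invr_gt0//; lra.
Qed.

Lemma subr1_ln (x : R) : 0 < x -> 1 - x <= - ln x.
Proof.
move=> x0; have := @le_ln1Dx R (x - 1); rewrite (_ : 1 + (x - 1) = x); last by ring.
by move=> H; have := H ltac:(lra); lra.
Qed.

(** Both logarithms on the right are convexity defects: the power mean of
    [`|a|] and [`|b|] exceeds the modulus of the midpoint and the geometric
    mean. Small defects force equal phases. *)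
Lemma phase_le_defect a b : a != 0 -> b != 0 -> a + b != 0 ->
  cabs (phase a - phase b) ^+ 2 <=
  8 / p * ((ln ((cabs a `^ p + cabs b `^ p) / 2) - p * ln (cabs ((a + b) / 2))) +
           (ln ((cabs a `^ p + cabs b `^ p) / 2) - p / 2 * (ln (cabs a) + ln (cabs b)))).
Proof.
move=> a0 b0 ab0; have ca := cabs_gt0 a0; have cb := cabs_gt0 b0.
have dist := phase_dist a0 b0.
set D := cabs (phase a - phase b) in dist *.
have D0 : 0 <= D by exact: cabs_ge0.
have D2 : D <= 2.
  by rewrite (le_trans (cabsD _ _))// cabsN !cabs_phase.
have cm : cabs ((a + b) / 2) = cabs (a + b) / 2.
  by rewrite cabsM cabsV (_ : 2 = (2%:C)%C) ?cabs_real ?ger0_norm//; rewrite rmorph_nat.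
have cab := cabs_gt0 ab0.
rewrite cm; have pm := power_mean (ltW ca) (ltW cb).
set A := (cabs a `^ p + cabs b `^ p) / 2 in pm *.
have A0 : 0 < A by rewrite divr_gt0// addr_gt0// powR_gt0.
pose M := A `^ p^-1; have M0 : 0 < M by exact: powR_gt0.
have lM : ln A = p * ln M by rewrite ln_powR mulrA mulfV ?mul1r// gt_eqF.
have sM : (cabs a + cabs b) / 2 <= M.
  have s0 : 0 <= (cabs a + cabs b) / 2 by rewrite divr_ge0// addr_ge0// ltW.
  have sE : (((cabs a + cabs b) / 2) `^ p) `^ p^-1 = (cabs a + cabs b) / 2.
    by rewrite -powRrM mulfV ?powRr1// gt_eqF.
  rewrite -sE; apply: ge0_ler_powR; [by rewrite invr_ge0 ltW| | |exact: pm].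
    by rewrite nnegrE powR_ge0.
  by rewrite nnegrE ltW.
move: dist D0 D2 ca cb cab sM; set x := cabs a; set y := cabs b; set s := cabs (a + b).
move=> dist D0 D2 x0 y0 s0 sM.
pose X := (s / 2 / M) ^+ 2; have X0 : 0 < X by rewrite exprn_gt0// !divr_gt0.
pose Y := x * y / M ^+ 2; have Y0 : 0 < Y by rewrite divr_gt0 ?mulr_gt0// exprn_gt0.
have lX : - ln X = 2 / p * (ln A - p * ln (s / 2)).
  rewrite /X lnXn ?divr_gt0// ln_div ?posrE ?divr_gt0// lM.
  by field; rewrite gt_eqF.
have lY : - ln Y = 2 / p * (ln A - p / 2 * (ln x + ln y)).
  rewrite /Y ln_div ?posrE ?mulr_gt0 ?exprn_gt0// lnM ?posrE// lnXn// lM.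
  by field; rewrite gt_eqF.
have hX := subr1_ln X0; have hY := subr1_ln Y0.
pose E := D ^+ 2 / 4.
have E0 : 0 <= E by rewrite divr_ge0// sqr_ge0.
have E1 : E <= 1.
  rewrite ler_pdivrMr// mul1r (_ : 4 = 2 ^+ 2); last by ring.
  by rewrite lerXn2r ?nnegrE.
have M20 : 0 < M ^+ 2 by rewrite exprn_gt0.
have sM2 : ((x + y) / 2) ^+ 2 <= M ^+ 2.
  by rewrite lerXn2r ?nnegrE// ?divr_ge0 ?addr_ge0// ltW.
have YE : Y * E <= 1 - X.
  rewrite /Y /E /X -(ler_pM2r M20).
  have -> : x * y / M ^+ 2 * (D ^+ 2 / 4) * M ^+ 2 = (x * y * D ^+ 2) / 4.
    by field; rewrite gt_eqF.
  have -> : (1 - (s / 2 / M) ^+ 2) * M ^+ 2 = M ^+ 2 - s ^+ 2 / 4.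
    by field; rewrite gt_eqF.
  move: sM2; have -> : ((x + y) / 2) ^+ 2 = (x + y) ^+ 2 / 4 by field.
  by rewrite dist; lra.
have Y1 : Y <= 1.
  rewrite ler_pdivrMr// mul1r; apply: le_trans sM2.
  have : 0 <= (x - y) ^+ 2 by exact: sqr_ge0.
  have -> : ((x + y) / 2) ^+ 2 = x * y + (x - y) ^+ 2 / 4 by field.
  lra.
have YE1 : (1 - Y) * E <= 1 - Y by rewrite ler_piMr// subr_ge0.
rewrite (_ : D ^+ 2 = 4 * E); last by rewrite /E; field.
have -> : 8 / p * ((ln A - p * ln (s / 2)) + (ln A - p / 2 * (ln x + ln y))) =
   4 * (- ln X + - ln Y) by rewrite lX lY; field; rewrite gt_eqF.
rewrite ler_pM2l//; lra.
Qed.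

(** By convexity [t `^ p] lies below its chord from [0] to [x + y]. *)
Lemma powR_superadd (x y : R) : 0 <= x -> 0 <= y -> x `^ p + y `^ p <= (x + y) `^ p.
Proof.
move=> x0 y0; have [s0|s0] := eqVneq (x + y) 0.
  have xy : x = 0 /\ y = 0 by lra.
  by rewrite s0 xy.1 xy.2 powR0 ?gt_eqF// addr0.
have sp : 0 < x + y by rewrite lt_def s0 addr_ge0.
have H t : 0 <= t -> t <= x + y -> t `^ p <= t / (x + y) * (x + y) `^ p.
  move=> t0 ts; have tq0 : 0 <= t / (x + y) by rewrite divr_ge0// ltW.
  have {1}-> : t = t / (x + y) * (x + y) by rewrite divfK.
  rewrite powRM ?(ltW sp)// ler_wpM2r ?powR_ge0// -(powRB1M p1 tq0).
  have tq1 : t / (x + y) <= 1 by rewrite ler_pdivrMr// mul1r.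
  rewrite ler_piMl//; apply: (@le_trans _ _ (1 `^ (p - 1))); last by rewrite powR1.
  by apply: ge0_ler_powR; rewrite ?nnegrE// subr_ge0 ltW.
have := H x x0; have := H y y0; rewrite lerDl lerDr => Hy Hx.
apply: (le_trans (lerD (Hx y0) (Hy x0))).
by rewrite -mulrDl -mulrDl divff// mul1r.
Qed.

Lemma powR_dist_le (x y : R) : 0 <= x -> 0 <= y -> `|x - y| `^ p <= `|x `^ p - y `^ p|.
Proof.
move=> x0 y0; wlog yx : x y x0 y0 / y <= x.
  move=> H; have /orP[yx|xy] := le_total y x; first exact: (H x y).
  by rewrite distrC [leRHS]distrC; exact: (H y x).
have xy : 0 <= x - y by rewrite subr_ge0.
have := powR_superadd xy y0; rewrite subrK => le.
rewrite ger0_norm// ger0_norm; first lra.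
by rewrite subr_ge0; exact: powR_le.
Qed.

(** With [r] the square root of [x], [x - 1 - ln x] is at least
    [(r - 1) ^+ 2], and [`|x - 1|] is at most [(r - 1) ^+ 2 + 2 * `|r - 1|]. *)
Lemma dist1_le_defect (x e : R) : 0 < x -> 0 < e ->
  `|x - 1| <= (1 + e^-1) * (x - 1 - ln x) + e.
Proof.
move=> x0 e0; pose r := Num.sqrt x.
have r0 : 0 < r by rewrite sqrtr_gt0.
have xE : x = r ^+ 2 by rewrite sqr_sqrtr// ltW.
have h1 : (r - 1) ^+ 2 <= x - 1 - ln x.
  rewrite {2}xE lnXn//; have := subr1_ln r0.
  rewrite xE (_ : (r - 1) ^+ 2 = r ^+ 2 - 2 * r + 1); last by ring.
  by rewrite -mulr_natl; lra.
have ei : 0 < e^-1 by rewrite invr_gt0.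
have h2 : 2 * `|r - 1| <= e^-1 * (r - 1) ^+ 2 + e.
  rewrite -real_normK ?num_real//; set w := `|_|.
  have : 0 <= e^-1 * (w - e) ^+ 2 by rewrite mulr_ge0 ?sqr_ge0// ltW.
  have -> : e^-1 * (w - e) ^+ 2 = e^-1 * w ^+ 2 - 2 * w + e by field; rewrite gt_eqF.
  lra.
have h3 : `|x - 1| <= (r - 1) ^+ 2 + 2 * `|r - 1|.
  have -> : x - 1 = (r - 1) ^+ 2 + 2 * (r - 1) by rewrite xE; ring.
  by rewrite (le_trans (ler_normD _ _))// ger0_norm ?sqr_ge0// normrM ger0_norm.
apply: (le_trans h3); apply: (@le_trans _ _ ((1 + e^-1) * (r - 1) ^+ 2 + e)).
  by rewrite mulrDl mul1r; lra.
by rewrite lerD2r ler_pM2l// addr_gt0.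
Qed.

End phase.

(** * Minima of the geometric mean *)

Section orthogonality.
Context {R : realType}.
Variables (m : probability (torus R) R).
Local Notation int f := (Rintegral m setT f).
Local Notation integ f := (m.-integrable setT (EFin \o f)).

(** The quadratic bound makes the error negligible after division by a small
    scale; the linear bound keeps it integrable. *)
Lemma ln_cabs_1D_le (v : R[i]) (r : R) : 0 < r -> r <= 1 ->
  2 * ln (cabs (1 + v) + r) <=
  2 * complex.Re v + Num.min (cabs v ^+ 2) (4 * cabs v) + r * (3 + 2 * cabs v).
Proof.
move=> r0 r1; have c0 := cabs_ge0 (1 + v); have v0 := cabs_ge0 v.
have le : cabs (1 + v) <= 1 + cabs v by have := cabsD 1 v; rewrite cabs1.
have sq : cabs (1 + v) ^+ 2 = 1 + 2 * complex.Re v + cabs v ^+ 2.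
  by rewrite !cabs_sqr ReD ImD/=; ring.
have re : - cabs v <= complex.Re v.
  by rewrite lerNl (le_trans _ (cabs_Re v))// -normrN ler_norm.
move: c0 v0 le sq re; set c := cabs (1 + v); set y := cabs v; set x := complex.Re v.
move=> c0 y0 le sq re; have u0 : 0 < c + r by lra.
have hA : 2 * ln (c + r) <= 2 * x + y ^+ 2 + r * (3 + 2 * y).
  have := subr1_ln (exprn_gt0 2 u0); rewrite lnXn// => H.
  have E : (c + r) ^+ 2 = 1 + 2 * x + y ^+ 2 + 2 * (r * c) + r ^+ 2 by rewrite -sq; ring.
  have rc : r * c <= r * (1 + y) by rewrite ler_pM2l.
  have rr : r ^+ 2 <= r by rewrite expr2 ler_piMr// ltW.
  by rewrite -mulr_natl in H; rewrite E in H; lra.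
have hB : 2 * ln (c + r) <= 2 * x + 4 * y + r * (3 + 2 * y).
  have := subr1_ln u0; have : 0 <= r * y by rewrite mulr_ge0// ltW.
  lra.
by rewrite minElt; case: ifP.
Qed.

(** The condition says that [0] minimises the geometric mean of
    [`|1 + t w|] over [t >= 0]; its derivative at [0] is [Re (cint w)]. *)
Lemma Re_cint_ge0 (w : torus R -> R[i]) : cinteg m w ->
  (forall t r : R, 0 < t -> 0 < r ->
    0 <= int (fun z => ln (cabs (1 + t%:C%C * w z) + r))) ->
  0 <= complex.Re (cint m w).
Proof.
move=> wi H; have [Rwi _] := wi; have ci := cinteg_cabs wi.
have mc := integ_meas ci.
pose g (t : R) z := Num.min (t * cabs (w z) ^+ 2) (4 * cabs (w z)).
have g0 t z : 0 < t -> 0 <= g t z.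
  by move=> t0; rewrite le_min !mulr_ge0 ?cabs_ge0 ?sqr_ge0// ltW.
have mg t : measurable_fun setT (g t).
  apply: measurable_minr; apply: measurable_funM => //; exact: measurable_funX.
have gle t z : 0 < t -> `|g t z| <= 4 * cabs (w z).
  by move=> t0; rewrite ger0_norm ?g0// ge_min lexx orbT.
have gi t : 0 < t -> integ (g t).
  by move=> t0; apply: integ_le (mg t) _ (integZ 4 ci) => z; exact: gle.
pose I1 := int (fun z => complex.Re (w z)); pose Ic := int (fun z => cabs (w z)).
have Ic0 : 0 <= Ic by apply: int_ge0 => z; exact: cabs_ge0.
have key t : 0 < t -> 0 <= 2 * I1 + int (g t).
  move=> t0; rewrite -(pmulr_rge0 _ t0); apply/ler_addgt0Pr => e e0.
  have c0 : 0 < 3 + 2 * t * Ic by rewrite ltr_wpDr// !mulr_ge0// ltW.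
  pose r := Num.min 1 (e / (3 + 2 * t * Ic)).
  have r0 : 0 < r by rewrite lt_min ltr01 divr_gt0.
  have r1 : r <= 1 by rewrite ge_min lexx.
  have re : r * (3 + 2 * t * Ic) <= e.
    by rewrite -ler_pdivlMr// ge_min lexx orbT.
  have itw : cinteg m (fun z => t%:C%C * w z) by exact: cintegZ.
  have i1tw : cinteg m (fun z => 1 + t%:C%C * w z).
    by apply: cintegD => //; exact: cinteg_cst.
  have il : integ (fun z => ln (cabs (1 + t%:C%C * w z) + r)).
    by apply: integ_lnD => //; [move=> z; exact: cabs_ge0|exact: cinteg_cabs].
  have ib : integ (fun z => (2 * t * complex.Re (w z) + t * g t z) +
      (r * 3 + r * 2 * t * cabs (w z))).
    apply: integD; apply: integD; [exact: integZ|by apply: integZ; exact: gi|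
      exact: integ_cst|exact: integZ].
  have : int (fun z => 2 * ln (cabs (1 + t%:C%C * w z) + r)) <=
    int (fun z => (2 * t * complex.Re (w z) + t * g t z) + (r * 3 + r * 2 * t * cabs (w z))).
    apply: le_int; [exact: integZ|exact: ib|] => z.
    have := ln_cabs_1D_le (t%:C%C * w z) r0 r1.
    rewrite ReM /= mul0r subr0 cabsM cabs_real (ger0_norm (ltW t0)).
    have -> : Num.min ((t * cabs (w z)) ^+ 2) (4 * (t * cabs (w z))) = t * g t z.
      rewrite /g minr_pMr ?(ltW t0)//; congr Num.min; ring.
    by move=> /le_trans; apply; apply: eq_ler; ring.
  have := H t r t0 r0; rewrite intZ//.
  rewrite intD; [|by apply: integD; [exact: integZ|by apply: integZ; exact: gi]
                 |by apply: integD; [exact: integ_cst|exact: integZ]].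
  rewrite intD; [|exact: integZ|by apply: integZ; exact: gi].
  rewrite intD; [|exact: integ_cst|exact: integZ].
  rewrite int_cst !intZ//; last exact: gi.
  rewrite -/I1 -/Ic; move: (int (g t)) (int _) => G I0 I00 le.
  by move: re; rewrite !mulrDr !mulrA; lra.
have cv : int (g n.+1%:R^-1) @[n --> \oo] --> (0 : R).
  rewrite -(int_cst m 0); apply: (dct _ _ _ _ (integZ 4 ci)).
  - by move=> n; exact: mg.
  - exact: measurable_cst.
  - apply: aeW => z; have cvh : n.+1%:R^-1 * cabs (w z) ^+ 2 @[n --> \oo] --> (0 : R).
      rewrite -[X in _ --> X](mul0r (cabs (w z) ^+ 2)).
      by apply: cvgMl; exact: cvg_harmonic.
    apply: (squeeze_cvgr _ (cvg_cst 0) cvh); apply: nearW => n.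
    by rewrite g0 ?invr_gt0//= ge_min lexx.
  - by move=> n z; apply: gle; rewrite invr_gt0.
have : 0 <= 2 * I1 + 0.
  have cv2 : 2 * I1 + int (g n.+1%:R^-1) @[n --> \oo] --> 2 * I1 + 0.
    by apply: cvgD => //; exact: cvg_cst.
  rewrite -(cvg_lim _ cv2)//; apply: limr_ge; first by apply/cvg_ex; eexists; exact: cv2.
  by apply: nearW => n; apply: key; rewrite invr_gt0.
by rewrite addr0 pmulr_rge0.
Qed.

End orthogonality.

(** * Almost everywhere limits *)

Section almost_sure_limits.
Context {d : measure_display} {T : measurableType d} {R : realType}.
Variable m : probability T R.
Local Notation integ f := (m.-integrable setT (EFin \o f)).
Local Notation int f := (Rintegral m setT f).

Lemma cvg_bounded_variation (u : nat -> R) (B : R) :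
  (forall n, \sum_(0 <= k < n) `|u k - u k.+1| <= B) -> cvgn u.
Proof.
move=> uB; have : cvgn (series (fun k => u k.+1 - u k)).
  apply: normed_cvg; apply: nondecreasing_is_cvgn.
    apply/nondecreasing_seqP => n; pose v k := `|u k.+1 - u k|.
    suff H : series v n <= series v n.+1 by exact: H.
    by rewrite seriesSr lerDl normr_ge0.
  exists B => _ [n _ <-]; apply: le_trans (uB n).
  by rewrite /series/=; apply: ler_sum => k _; rewrite distrC.
move=> /cvg_ex[l cvl]; apply/cvg_ex; exists (l + u 0).
have E : (fun n => series (fun k => u k.+1 - u k) n + u 0) = u.
  by apply/funext => n; rewrite /series/= telescope_sumr// subrK.
by rewrite -[X in X x @[x --> _]]E; apply: cvgD cvl (cvg_cst _).
Qed.

(** The sums of distances are almost everywhere bounded by [levi]; the upper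
    limits of the real and imaginary parts provide a measurable limit. *)
Lemma ae_cvg_of_sum_dist (u : nat -> T -> R[i]) (B C : R) :
  (forall k, cmeas (u k)) -> (forall k x, cabs (u k x) <= B) ->
  (forall n, \sum_(0 <= k < n) int (fun x => cabs (u k x - u k.+1 x)) <= C) ->
  exists2 v : T -> R[i], cmeas v &
    {ae m, forall x, cabs (u k x - v x) @[k --> \oo] --> (0 : R)}.
Proof.
move=> mu uB uC; pose f k x := cabs (u k x - u k.+1 x).
have fi k : integ (f k).
  apply: (@integ_bnd _ _ _ _ _ (B + B)); first by apply/cmeas_cabs/cmeasB.
  move=> x; rewrite ger0_norm ?cabs_ge0// (le_trans (cabsD _ _))// cabsN.
  exact: lerD.
have [G [_ _ fG]] := levi fi (fun k x => cabs_ge0 _) uC.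
have cv (F : R[i] -> R) x : (forall a b, `|F a - F b| <= cabs (a - b)) ->
    (forall n, \sum_(0 <= k < n) f k x <= G x) -> cvgn (fun k => F (u k x)).
  move=> Fle Gx; apply: (@cvg_bounded_variation _ (G x)) => n.
  by apply: le_trans (Gx n); apply: ler_sum => k _; exact: Fle.
have ms (F : R[i] -> R) : (forall a, `|F a| <= cabs a) ->
    (forall k, measurable_fun setT (fun x => F (u k x))) ->
    measurable_fun setT (fun x => limn_sup (fun k => F (u k x))).
  move=> Fle mF; have FB k x : `|F (u k x)| <= B by exact: le_trans (Fle _) (uB k x).
  apply: (@measurable_fun_limn_sup _ _ _ setT (fun k x => F (u k x))) => // x _.
    by exists B => _ [k _ <-]; exact: le_trans (ler_norm _) (FB k x).
  by exists (- B) => _ [k _ <-]; rewrite lerNl (le_trans _ (FB k x))// -normrN ler_norm.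
exists (fun x => Complex (limn_sup (fun k => complex.Re (u k x)))
                         (limn_sup (fun k => complex.Im (u k x)))).
  split.
    by apply: (ms (@complex.Re R) (@cabs_Re R)) => k; have [] := mu k.
  by apply: (ms (@complex.Im R) (@cabs_Im R)) => k; have [] := mu k.
apply: filterS fG => x Gx.
have cvF (F : R[i] -> R) : (forall a b, `|F a - F b| <= cabs (a - b)) ->
    `|F (u k x) - limn_sup (fun k => F (u k x))| @[k --> \oo] --> (0 : R).
  move=> Fle; have cF := cv F x Fle Gx; rewrite (cvg_limn_supE cF).
  rewrite -[X in _ --> X](normr0 R); apply: cvg_norm.
  rewrite -[X in _ --> X](subrr (limn (fun k => F (u k x)))).
  by apply: cvgB; [exact: cF|exact: cvg_cst].
have cvR := cvF (@complex.Re R) ltac:(by move=> a b; rewrite -ReN -ReD; exact: cabs_Re).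
have cvI := cvF (@complex.Im R) ltac:(by move=> a b; rewrite -ImN -ImD; exact: cabs_Im).
have cvRI : `|complex.Re (u k x) - limn_sup (fun k => complex.Re (u k x))| +
    `|complex.Im (u k x) - limn_sup (fun k => complex.Im (u k x))|
    @[k --> \oo] --> (0 : R).
  by rewrite -[X in _ --> X](addr0 (0 : R)); exact: cvgD cvR cvI.
apply: (squeeze_cvgr _ (cvg_cst (0 : R)) cvRI); apply: nearW => k.
rewrite cabs_ge0/= (le_trans (cabs_le _))//.
by rewrite ReD ImD ReN ImN.
Qed.

End almost_sure_limits.

(** * The Szego infimum for a positive weight *)

Section extremal_arithmetic.
Context {R : realFieldType}.

Lemma norm_ln_le (A l x y c : R) : 0 <= A -> l <= A - 1 -> x - c <= l -> 0 <= c ->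
  0 <= y -> - y <= x -> `|l| <= A + c + y.
Proof. by move=> *; rewrite ler_norml; lra. Qed.

Lemma mean_le (a b s : R) : a <= s -> b <= s -> 2^-1 * (a + b) <= s.
Proof. by move=> *; lra. Qed.

Lemma defect_le (w e l c : R) : w <= 1 + e -> c <= l -> w - 1 - (l - c) <= e.
Proof. by move=> *; lra. Qed.

Lemma twice_defect_le (a b c e : R) : a <= e -> 0 <= b -> 0 <= c ->
  a - b + (a - c) <= e + e.
Proof. by move=> *; lra. Qed.

End extremal_arithmetic.

Section szego.
Context {R : realType}.
Variables (m : probability (torus R) R) (hm : is_haar m) (p : R) (p1 : 1 < p).
Local Notation int f := (Rintegral m setT f).
Local Notation integ f := (m.-integrable setT (EFin \o f)).
Implicit Types (f g h q : torus R -> R[i]).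

Let p0 : 0 < p. Proof. exact: lt_trans ltr01 p1. Qed.

Variables (K : torus R -> R) (K0 : forall z, 0 < K z).
Hypotheses (Ki : integ K) (lKi : integ (fun z => ln (K z))).

Let L := int (fun z => ln (K z)).

(** The integrand of the Szego infimum at [- q]. *)
Definition weighted q z := cabs (1 + q z) `^ p * K z.

Lemma weighted_ge0 q z : 0 <= weighted q z.
Proof. by rewrite mulr_ge0 ?powR_ge0 ?ltW. Qed.

Lemma integ_weighted P q : span P q -> integ (weighted q).
Proof.
move=> Pq; have [B B0 qB] := span_bounded Pq.
have mq : cmeas (fun z => 1 + q z) by apply: cmeasD; [exact: cmeas_cst|exact: cmeas_span Pq].
apply: integ_le (integZ ((1 + B) `^ p) Ki).
  apply: measurable_funM; last exact: integ_meas Ki.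
  exact: meas_cabs_powR.
move=> z; rewrite ger0_norm ?weighted_ge0//.
rewrite ler_wpM2r ?(ltW (K0 z))//; apply: powR_le => //; first exact: cabs_ge0.
by rewrite (le_trans (cabsD _ _))// cabs1 lerD2l.
Qed.

Lemma ln_weighted q z : 0 < cabs (1 + q z) ->
  ln (weighted q z) = p * ln (cabs (1 + q z)) + ln (K z).
Proof. by move=> q0; rewrite /weighted lnM ?posrE ?powR_gt0// ln_powR. Qed.

Lemma ln_weighted_ge P q : half_space P -> span P q ->
  [/\ {ae m, forall z, 0 < weighted q z}, integ (fun z => ln (weighted q z)) &
      L <= int (fun z => ln (weighted q z))].
Proof.
move=> hP Pq; have [g0 lgi lg0] := jensen hm hP Pq.
have li : integ (fun z => p * ln (cabs (1 + q z)) + ln (K z)).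
  by apply: integD => //; exact: integZ.
have mw : measurable_fun setT (fun z => ln (weighted q z)).
  apply: (measurableT_comp (@measurable_ln R)).
  exact: integ_meas (integ_weighted Pq).
have E : {ae m, forall z, p * ln (cabs (1 + q z)) + ln (K z) = ln (weighted q z)}.
  by apply: filterS g0 => z gz; rewrite ln_weighted.
split.
- by apply: filterS g0 => z gz; rewrite mulr_gt0// powR_gt0.
- exact: integ_ae li mw E.
- rewrite -(eq_int_ae (integ_meas li) mw E) intD//; last exact: integZ.
  by rewrite intZ// lerDr mulr_ge0// ltW.
Qed.

(** By concavity of the logarithm: the factor [`|1 + q|] only increases the
    geometric mean [expR L] of the weight. *)
Lemma szego_ge P q : half_space P -> span P q -> expR L <= int (weighted q).
Proof.
move=> hP Pq; have [w0 lwi Lle] := ln_weighted_ge hP Pq.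
apply/ler_addgt0Pr => e e0.
have we : 0 < int (weighted q) + e by rewrite ltr_wpDl// int_ge0// => z; exact: weighted_ge0.
rewrite -[leRHS]lnK ?posrE// ler_expR (le_trans Lle)//.
by apply: int_ln_le => //; [exact: integ_weighted Pq|rewrite lerDl ltW].
Qed.

(** [jensen] for [1 + q], where [f] is [1 + q] up to the factor [cint m f]. *)
Lemma cint_nonneg_gt0 f : span nonneg f -> cint m f != 0 ->
  [/\ {ae m, forall z, 0 < cabs (f z)}, integ (fun z => ln (cabs (f z))) &
      ln (cabs (cint m f)) <= int (fun z => ln (cabs (f z)))].
Proof.
move=> Nf c0; have [g Ng fE] := nonneg_split hm Nf; set c := cint m f in c0 fE *.
have Pq : span (lex_half 0) (fun z => c^-1 * g z).
  by apply/spanZ/(span_sub _ Ng); exact: nonneg_neq0_lex.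
have [g0 lgi lg0] := jensen hm (half_space_lex 0) Pq.
have cp : 0 < cabs c by exact: cabs_gt0.
have E z : f z = c * (1 + c^-1 * g z) by rewrite fE mulrDr mulr1 mulVKf.
have li : integ (fun z => ln (cabs c) + ln (cabs (1 + c^-1 * g z))).
  by apply: integD => //; exact: integ_cst.
have mf : measurable_fun setT (fun z => ln (cabs (f z))).
  apply: (measurableT_comp (@measurable_ln R)).
  by apply/cmeas_cabs/(cmeas_span Nf).
have El : {ae m, forall z, ln (cabs c) + ln (cabs (1 + c^-1 * g z)) = ln (cabs (f z))}.
  by apply: filterS g0 => z gz; rewrite E cabsM lnM ?posrE.
split.
- by apply: filterS g0 => z gz; rewrite E cabsM mulr_gt0.
- exact: integ_ae li mf El.
- rewrite -(eq_int_ae (integ_meas li) mf El) intD//; last exact: integ_cst.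
  by rewrite int_cst lerDl.
Qed.

Let rootK z := K z `^ p^-1.

Let rootK_gt0 z : 0 < rootK z. Proof. exact: powR_gt0. Qed.

Let rootKP z : rootK z `^ p = K z.
Proof. by rewrite -powRrM mulVf ?gt_eqF// powRr1// ltW. Qed.

Let integ_rootK : integ rootK.
Proof.
apply: (integ_le (g := fun z => 1 + K z)).
- by apply: (measurableT_comp (measurable_powR p^-1)); exact: integ_meas Ki.
- move=> z; rewrite (ger0_norm (ltW (rootK_gt0 z))) -rootKP.
  exact: (powR_ge_id p1 (ltW (rootK_gt0 z))).
- by apply: integD => //; exact: integ_cst.
Qed.

Let ln_rootK z : ln (rootK z) = p^-1 * ln (K z). Proof. by rewrite ln_powR. Qed.

Let integ_ln_rootK : integ (fun z => ln (rootK z)).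
Proof. by apply: eq_integ (integZ p^-1 lKi) => z; rewrite ln_rootK. Qed.

Let int_ln_rootK : int (fun z => ln (rootK z)) = p^-1 * L.
Proof. by rewrite -intZ//; apply: eq_int => z; rewrite ln_rootK. Qed.

(** Jensen's inequality for the Hardy space, by upper semicontinuity. *)
Lemma cabs_cint_hardy h : inLp m p h -> approx m p (span nonneg) h ->
  {ae m, forall z, K z = cabs (h z) `^ p} -> cabs (cint m h) `^ p <= expR L.
Proof.
move=> hi Nh KE; have hc := cinteg_inLp p1 hi.
have [->|c0] := eqVneq (cint m h) 0; first by rewrite cabs0 powR0 ?gt_eqF// expR_ge0.
have cp := cabs_gt0 c0; set c := cabs (cint m h) in cp *.
suff : ln c <= int (fun z => ln (rootK z)).
  rewrite int_ln_rootK => lec; rewrite -[c `^ p]lnK ?posrE ?powR_gt0// ler_expR ln_powR.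
  by rewrite -ler_pdivlMl.
apply: int_ln_ge => // r r0; apply: int_ln_usc => //; first by move=> z; exact: ltW.
move=> e e0; pose d := Num.min e (c * (1 - expR (- e))).
have d0 : 0 < d.
  rewrite lt_min e0 mulr_gt0// subr_gt0 -expR0 ltr_expR; lra.
have [b b0 Hb] := L1_le_pdist m p1 d0.
have [f Nf hf] := Nh _ b0.
have fi : inLp m p f by apply: (trig_inLp m p0); exact: span_sub Nf.
have hf1 := Hb _ _ hi fi hf.
have fc := cinteg_span m Nf.
have cd : c - d <= cabs (cint m f).
  have := cabs_cint_le (cintegB hc fc); rewrite cintB// => le1.
  have := cabsD_sub (cint m h) (cint m f); rewrite -/c; lra.
have ce : c * expR (- e) <= cabs (cint m f).
  apply: le_trans cd; have : d <= c * (1 - expR (- e)) by rewrite ge_min lexx orbT.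
  lra.
have cf0 : cint m f != 0.
  by apply/eqP => cf; move: ce; rewrite cf cabs0 leNgt mulr_gt0// expR_gt0.
have [fp lfi lef] := cint_nonneg_gt0 Nf cf0.
exists (fun z => cabs (f z)); split => //.
- by move=> z; exact: cabs_ge0.
- exact: cinteg_cabs.
split.
- apply: (@le_trans _ _ d); last by rewrite ge_min lexx.
  apply: le_trans hf1; apply: le_int_ae.
  + by apply: integ_norm; apply: integB => //; exact: cinteg_cabs.
  + by apply: cinteg_cabs; exact: cintegB.
  + apply: filterS KE => z Kz; have -> : rootK z = cabs (h z).
      by rewrite /rootK Kz -powRrM mulfV ?gt_eqF// powRr1// cabs_ge0.
    by rewrite distrC cabs_dist.
- apply: le_trans lef.
  have -> : ln c - e = ln (c * expR (- e)) by rewrite lnM ?posrE ?expR_gt0// expRK.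
  by rewrite ler_ln ?posrE ?mulr_gt0 ?expR_gt0// cabs_gt0.
Qed.

(** [cint_nonnegM] extends by density, since convergence in $L^p$ implies
    convergence of integrals against bounded functions. *)
Lemma cint_mul_hardy q h : inLp m p h -> approx m p (span nonneg) h ->
  span nonneg q -> cint m (fun z => q z * h z) = cint m q * cint m h.
Proof.
move=> hi Nh Nq; have [B B0 qB] := span_bounded Nq.
have hc := cinteg_inLp p1 hi; have qc := cinteg_span m Nq.
apply/eqP; rewrite -subr_eq0; apply/eqP/cabs_eq0/eqP.
rewrite eq_le cabs_ge0 andbT; apply/ler_addgt0Pr => e e0; rewrite add0r.
pose c := cabs (cint m q); have c0 : 0 <= c by exact: cabs_ge0.
have Bc : 0 < B + c by rewrite ltr_wpDr.
have [b b0 Hb] := L1_le_pdist m p1 (divr_gt0 e0 Bc).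
have [f Nf hf] := Nh _ b0.
have fi : inLp m p f by apply: (trig_inLp m p0); exact: span_sub Nf.
have hf1 := Hb _ _ hi fi hf; have fc := cinteg_span m Nf.
set I1 := int _ in hf1.
have qhc : cinteg m (fun z => q z * h z) := cinteg_inLp p1 (span_mul_inLp p1 Nq hi).
have qfc : cinteg m (fun z => q z * f z) := cinteg_inLp p1 (span_mul_inLp p1 Nq fi).
have -> : cint m (fun z => q z * h z) - cint m q * cint m h =
    (cint m (fun z => q z * h z) - cint m (fun z => q z * f z)) +
    cint m q * (cint m f - cint m h).
  by rewrite (cint_nonnegM hm Nq Nf); ring.
rewrite (le_trans (cabsD _ _))// cabsM -/c.
have i1 := cinteg_cabs (cintegB hc fc).
have le1 : cabs (cint m f - cint m h) <= I1.
  by rewrite cabsB -cintB//; apply: cabs_cint_le; exact: cintegB.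
have le2 : cabs (cint m (fun z => q z * h z) - cint m (fun z => q z * f z)) <= B * I1.
  rewrite -cintB//; apply: le_trans (cabs_cint_le (cintegB qhc qfc)) _.
  rewrite -intZ//; apply: le_int; [exact: cinteg_cabs (cintegB qhc qfc)|exact: integZ|] => z.
  by rewrite -mulrBr cabsM ler_wpM2r// cabs_ge0.
apply: (@le_trans _ _ ((B + c) * I1)); last by rewrite mulrC -ler_pdivlMr.
by rewrite mulrDl lerD// ler_wpM2l.
Qed.

(** Two cases: [y <= x] bounds [1 + y] by [expR x], and [x <= y] bounds [1] by
    [x^-1 * y]. *)
Lemma powR1D_le (x y : R) : 0 < x -> 0 <= y ->
  (1 + y) `^ p <= expR (p * x) + (1 + x^-1) `^ p * y `^ p.
Proof.
move=> x0 y0; have [yx|xy] := lerP y x.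
  rewrite -[leLHS]addr0 lerD ?mulr_ge0 ?powR_ge0//.
  rewrite mulrC expRM; apply: powR_le => //; first exact: addr_ge0.
  by rewrite (le_trans _ (expR_ge1Dx x))// lerD2l.
rewrite -powRM ?addr_ge0 ?invr_ge0 ?(ltW x0)// -[leLHS]add0r lerD ?expR_ge0//.
apply: powR_le => //; first exact: addr_ge0.
rewrite mulrDl mul1r addrC lerD2l mulrC ler_pdivlMr// mul1r; exact: ltW.
Qed.

(** Multiples [r h] near [1] give competitors [r / cint r] whose weighted norm
    is near [`|cint h| `^ p], as [cint r * cint h = cint (r h)]. *)
Lemma szego_le_of_cyclic h (e : R) : cyclic_vector m p h ->
  {ae m, forall z, K z = cabs (h z) `^ p} -> 0 < e ->
  exists2 q, span nonneg_neq0 q & int (weighted q) <= expR L + e.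
Proof.
move=> /(cyclicP m p1)[hi Nh h1] KE e0; have hc := cinteg_inLp p1 hi.
pose c := cabs (cint m h); have c0 : 0 <= c by exact: cabs_ge0.
have cL : c `^ p <= expR L by exact: cabs_cint_hardy.
(* The losses below multiply to [expR ((3 * p + 1) * x)], and [x <= 1 / 2]
   gives [1 <= (1 - x) * expR (2 * x)]. *)
pose x := Num.min 2^-1 ((ln (expR L + e) - L) / (3 * p + 1)).
have Le : 0 < expR L + e by rewrite addr_gt0// expR_gt0.
have p31 : 0 < 3 * p + 1 by rewrite addr_gt0// mulr_gt0.
have x0 : 0 < x.
  rewrite lt_min invr_gt0 ltr0n/= divr_gt0// subr_gt0.
  by rewrite -[ltLHS]expRK ltr_ln ?posrE ?expR_gt0// ltrDl.
have x2 : x <= 2^-1 by rewrite ge_min lexx.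
have xL : L + (3 * p + 1) * x <= ln (expR L + e).
  have : x <= (ln (expR L + e) - L) / (3 * p + 1) by rewrite ge_min lexx orbT.
  by rewrite ler_pdivlMr//; lra.
have [b b0 Hb] := L1_le_pdist m p1 x0.
pose D := (1 + x^-1) `^ p.
have D0 : 0 < D by rewrite powR_gt0// addr_gt0// invr_gt0.
have d0 : 0 < Num.min b (x / D) by rewrite lt_min b0 divr_gt0.
have [_ [r Nr <-] rh] := h1 _ d0.
have Lp1 : inLp m p (fun _ : torus R => 1) by apply: (trig_inLp m p0); exact: span_cst.
have rhi : inLp m p (fun z => r z * h z) := span_mul_inLp p1 Nr hi.
have rhc := cinteg_inLp p1 rhi.
have rc1 : cabs (1 - cint m r * cint m h) <= x.
  rewrite -(cint_mul_hardy hi Nh Nr) -{1}(cint_cst m 1) -cintB//; last exact: cinteg_cst.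
  apply: le_trans (cabs_cint_le (cintegB (cinteg_cst m 1) rhc)) _.
  by apply: (Hb _ _ Lp1 rhi); apply: le_trans rh _; rewrite ge_min lexx.
have crc : 1 - x <= cabs (cint m r) * c.
  have := cabsD_sub 1 (cint m r * cint m h); rewrite cabs1 cabsM -/c; lra.
set a := cint m r in rc1 crc *.
have ac0 : 0 < cabs a * c by apply: lt_le_trans crc; lra.
have a0 : 0 < cabs a by rewrite lt_def cabs_ge0 andbT; apply: contraTneq ac0 => ->; rewrite mul0r ltxx.
have aN0 : a != 0 by apply: contraTneq a0 => ->; rewrite cabs0 ltxx.
have [g Ng rE] := nonneg_split hm Nr.
exists (fun z => a^-1 * g z); first exact: spanZ.
have wE z : weighted (fun z => a^-1 * g z) z = (cabs a `^ p)^-1 * (cabs (r z) `^ p * K z).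
  have -> : r z = a * (1 + a^-1 * g z) by rewrite rE mulrDr mulr1 mulVKf.
  rewrite /weighted cabsM powRM ?cabs_ge0// !mulrA mulVf ?mul1r// gt_eqF//.
  by rewrite powR_gt0.
have rip := integ_pdist p0 Lp1 rhi.
have rKi : integ (fun z => cabs (r z) `^ p * K z).
  have [B B0 rB] := span_bounded Nr.
  apply: integ_le (integZ (B `^ p) Ki).
    apply: measurable_funM; last exact: integ_meas Ki.
    by apply: meas_cabs_powR; exact: cmeas_span Nr.
  move=> z; rewrite ger0_norm ?mulr_ge0 ?powR_ge0 ?(ltW (K0 z))//.
  by rewrite ler_wpM2r ?(ltW (K0 z))//; apply: powR_le => //; exact: cabs_ge0.
have bnd : int (fun z => cabs (r z) `^ p * K z) <= expR ((p + 1) * x).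
  apply: (@le_trans _ _ (int (fun z => expR (p * x) + D * cabs (1 - r z * h z) `^ p))).
    apply: le_int_ae => //; first by apply: integD; [exact: integ_cst|exact: integZ].
    apply: filterS KE => z ->; rewrite -powRM ?cabs_ge0// -cabsM.
    apply: le_trans (powR1D_le x0 (cabs_ge0 _)).
    apply: powR_le => //; first exact: cabs_ge0.
    by have := cabsD_sub (r z * h z) 1; rewrite cabs1 cabsB.
  rewrite intD; [|exact: integ_cst|exact: integZ].
  rewrite int_cst intZ//.
  have : D * pdist m p (fun=> 1) (fun z => r z * h z) <= x.
    rewrite mulrC -ler_pdivlMr//; apply: le_trans rh _.
    by rewrite ge_min lexx orbT.
  rewrite /pdist => Dx; apply: le_trans (lerD (lexx _) Dx) _.
  rewrite mulrDl mul1r expRD; have px : 1 <= expR (p * x).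
    by rewrite -expR0 ler_expR mulr_ge0// ltW.
  have : expR (p * x) * (1 + x) <= expR (p * x) * expR x.
    by rewrite ler_wpM2l ?expR_ge0// expR_ge1Dx.
  have : x <= expR (p * x) * x by rewrite ler_peMl// ltW.
  rewrite mulrDr mulr1; lra.
rewrite (_ : weighted _ = fun z => (cabs a `^ p)^-1 * (cabs (r z) `^ p * K z)); last exact/funext.
rewrite intZ//.
have ac1 : 1 <= cabs a * c * expR (2 * x).
  have : (cabs a * c) * (1 + 2 * x) <= cabs a * c * expR (2 * x).
    by rewrite ler_wpM2l ?expR_ge1Dx// ltW.
  have : (1 - x) * (1 + 2 * x) <= cabs a * c * (1 + 2 * x).
    by rewrite ler_wpM2r// addr_ge0// mulr_ge0// ltW.
  have : x * x <= x * 2^-1 by rewrite ler_pM2l.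
  lra.
have acp : 1 <= cabs a `^ p * (c `^ p * expR (2 * x * p)).
  have := powR_le p0 ler01 ac1; rewrite powR1.
  rewrite (powRM p (mulr_ge0 (cabs_ge0 a) c0) (expR_ge0 _)).
  by rewrite (powRM p (cabs_ge0 a) c0) -expRM mulrA.
apply: (@le_trans _ _ ((c `^ p * expR (2 * x * p)) * expR ((p + 1) * x))).
  apply: ler_pM => //; [by rewrite invr_ge0 powR_ge0| |].
    by apply: int_ge0 => z; rewrite mulr_ge0 ?powR_ge0// ltW.
  by rewrite -[leLHS]mul1r ler_pdivrMr ?powR_gt0// mulrC.
apply: (@le_trans _ _ (expR L * expR (2 * x * p) * expR ((p + 1) * x))).
  by rewrite !ler_wpM2r ?expR_ge0.
rewrite -!expRD -[leRHS]lnK ?posrE// ler_expR.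
by move: xL; rewrite [(3 * p + 1) * x](_ : _ = 2 * x * p + (p + 1) * x) ?addrA//; ring.
Qed.

Lemma cmeas_phase f : cmeas f -> cmeas (fun z => phase (f z)).
Proof.
move=> mf; apply: cmeasM => //; apply: cmeas_real.
have mc := cmeas_cabs mf.
rewrite (_ : (fun z => _) = fun z => (cabs (f z)) `^ (- 1)); last first.
  by apply/funext => z; rewrite powR_inv1// cabs_ge0.
exact: (measurableT_comp (measurable_powR (-1)) mc).
Qed.

(** The defects of [phase_le_defect] have small integrals: the logarithm of the
    power mean integrates to at most [e] by concavity, and the logarithms of
    [`|1 + q|], [`|1 + q'|] and of the midpoint have nonnegative integrals by
    [jensen]. *)
Lemma phase_cauchy P q q' (e : R) : half_space P -> span P q -> span P q' ->
  0 < e -> int (weighted q) <= expR L * (1 + e) ->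
  int (weighted q') <= expR L * (1 + e) ->
  int (fun z => cabs (phase (1 + q z) - phase (1 + q' z)) ^+ 2) <= 16 / p * e.
Proof.
move=> hP Pq Pq' e0 Eq Eq'.
pose q2 z := 2^-1 * (q z + q' z).
have Pq2 : span P q2 by apply/spanZ/spanD.
have [g0 lg lg0] := jensen hm hP Pq; have [g'0 lg' lg'0] := jensen hm hP Pq'.
have [g20 lg2 lg20] := jensen hm hP Pq2.
pose A z := (cabs (1 + q z) `^ p + cabs (1 + q' z) `^ p) / 2.
have mq (s : torus R -> R[i]) : span P s -> cmeas (fun z => 1 + s z).
  by move=> Ps; apply: cmeasD; [exact: cmeas_cst|exact: cmeas_span Ps].
have ip (s : torus R -> R[i]) : span P s -> integ (fun z => cabs (1 + s z) `^ p).
  move=> Ps; have [B B0 sB] := span_bounded Ps.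
  apply: (@integ_bnd _ _ _ _ _ ((1 + B) `^ p)).
    by apply: meas_cabs_powR; exact: mq.
  move=> z; rewrite ger0_norm ?powR_ge0//; apply: powR_le => //; first exact: cabs_ge0.
  by rewrite (le_trans (cabsD _ _))// cabs1 lerD2l.
have Ai : integ A.
  apply: eq_integ (integZ 2^-1 (integD (ip _ Pq) (ip _ Pq'))) => z.
  by rewrite mulrC.
have A0 z : 0 <= A z by rewrite divr_ge0// addr_ge0// powR_ge0.
have Ap : {ae m, forall z, 0 < A z}.
  by apply: filterS g0 => z gz; rewrite divr_gt0// ltr_wpDr ?powR_ge0// powR_gt0.
have mlA : measurable_fun setT (fun z => ln (A z)).
  exact: (measurableT_comp (@measurable_ln R) (integ_meas Ai)).
have lA : integ (fun z => ln (A z)).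
  apply: (integ_le_ae (g := fun z => (A z + ln 2) + p * `|ln (cabs (1 + q z))|) mlA).
    apply: filterS2 g0 Ap => z gz Az /=.
    have up : ln (A z) <= A z - 1 by rewrite -lerN2 opprB; exact: subr1_ln.
    have lo : p * ln (cabs (1 + q z)) - ln 2 <= ln (A z).
      have gp : 0 < cabs (1 + q z) `^ p / 2 by rewrite divr_gt0// powR_gt0.
      rewrite -ln_powR -ln_div ?posrE ?powR_gt0// ler_ln ?posrE//.
      by rewrite ler_pM2r ?invr_gt0// lerDl powR_ge0.
    have l2 : 0 <= ln 2 :> R by rewrite ln_ge0// ler1n.
    have pn : 0 <= p * `|ln (cabs (1 + q z))| by rewrite mulr_ge0// ltW.
    have h1 : - (p * `|ln (cabs (1 + q z))|) <= p * ln (cabs (1 + q z)).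
      by rewrite -mulrN ler_pM2l// lerNl -normrN ler_norm.
    exact: norm_ln_le (A0 z) up lo l2 pn h1.
  apply: integD; last by apply: integZ; exact: integ_norm.
  by apply: integD => //; exact: integ_cst.
have Ale : int (fun z => ln (A z)) <= e.
  have iAK : integ (fun z => A z * K z).
    have iw := integD (integ_weighted Pq) (integ_weighted Pq').
    by apply: eq_integ (integZ 2^-1 iw) => z; rewrite /A /weighted; field.
  have AKle : int (fun z => A z * K z) <= expR L * (1 + e).
    rewrite (eq_int m (g := fun z => 2^-1 * (weighted q z + weighted q' z))); last first.
      by move=> z; rewrite /A /weighted; field.
    have iw := integ_weighted Pq; have iw' := integ_weighted Pq'.
    rewrite intZ ?intD//; last exact: integD.
    exact: mean_le Eq Eq'.
  have lAK : {ae m, forall z, ln (A z) + ln (K z) = ln (A z * K z)}.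
    by apply: filterS Ap => z Az; rewrite lnM ?posrE.
  have mAK : measurable_fun setT (fun z => ln (A z * K z)).
    exact: (measurableT_comp (@measurable_ln R) (integ_meas iAK)).
  have ilAK := integ_ae (integD lA lKi) mAK lAK.
  have S0 : 0 < expR L * (1 + e) by rewrite mulr_gt0 ?expR_gt0// addr_gt0.
  have AKp : {ae m, forall z, 0 < A z * K z}.
    by apply: filterS Ap => z Az; rewrite mulr_gt0.
  have := int_ln_le S0 AKp iAK ilAK AKle.
  rewrite -(eq_int_ae (integ_meas (integD lA lKi)) mAK lAK) intD// -/L.
  rewrite lnM ?posrE ?expR_gt0 ?addr_gt0// expRK.
  have le1 : ln (1 + e) <= e by apply: le_ln1Dx; rewrite (lt_trans _ e0)// ltrN10.
  by rewrite addrC lerD2l => /le_trans; apply.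
pose D z := 8 / p * ((ln (A z) - p * ln (cabs (1 + q2 z))) +
  (ln (A z) - p / 2 * (ln (cabs (1 + q z)) + ln (cabs (1 + q' z))))).
have i1 : integ (fun z => ln (A z) - p * ln (cabs (1 + q2 z))).
  by apply: integB => //; exact: integZ.
have i2 : integ (fun z => ln (A z) - p / 2 * (ln (cabs (1 + q z)) + ln (cabs (1 + q' z)))).
  by apply: integB => //; apply: integZ; exact: integD.
have iD : integ D by apply: integZ; exact: integD.
have mph (s : torus R -> R[i]) : span P s -> cmeas (fun z => phase (1 + s z)).
  by move=> Ps; exact: (@cmeas_phase (fun z => 1 + s z) (mq _ Ps)).
have le4 (a b : R[i]) : cabs (phase a - phase b) ^+ 2 <= 4.
  rewrite (_ : 4 = 2 ^+ 2); last by ring.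
  rewrite lerXn2r ?nnegrE ?cabs_ge0// (le_trans (cabsD _ _))// cabsN.
  by rewrite (_ : 2 = 1 + 1)// lerD// cabs_phase_le1.
apply: (@le_trans _ _ (int D)).
  apply: le_int_ae => //.
    apply: (@integ_bnd _ _ _ _ _ 4).
      by apply: measurable_funX; apply/cmeas_cabs/cmeasB; exact: mph.
    by move=> z; rewrite ger0_norm ?sqr_ge0.
  near=> z; have gz : 0 < cabs (1 + q z) by near: z; exact: g0.
  have g'z : 0 < cabs (1 + q' z) by near: z; exact: g'0.
  have g2z : 0 < cabs (1 + q2 z) by near: z; exact: g20.
  have nz (a : R[i]) : 0 < cabs a -> a != 0.
    by move=> ca; apply: contraTneq ca => ->; rewrite cabs0 ltxx.
  have E2 : ((1 + q z) + (1 + q' z)) / 2 = 1 + q2 z by rewrite /q2; field.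
  have := phase_le_defect p1 (nz _ gz) (nz _ g'z) _; rewrite E2; apply.
  apply: contraTneq g2z => ab0; by rewrite -E2 ab0 mul0r cabs0 ltxx.
rewrite intZ; last exact: integD.
rewrite intD// intB ?intZ//; [|exact: integZ].
rewrite intB//; last by apply: integZ; exact: integD.
rewrite intZ; last exact: integD.
rewrite intD// (_ : 16 / p * e = 8 / p * (e + e)); last by field; rewrite gt_eqF.
rewrite ler_pM2l ?divr_gt0//.
have le1 : 0 <= p * int (fun z => ln (cabs (1 + q2 z))) by rewrite mulr_ge0// ltW.
have le2 : 0 <= p / 2 * (int (fun z => ln (cabs (1 + q z))) + int (fun z => ln (cabs (1 + q' z)))).
  by rewrite mulr_ge0 ?addr_ge0// divr_ge0// ltW.
exact: twice_defect_le Ale le1 le2.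
Unshelve. all: by end_near. Qed.

(** [dist1_le_defect] at [weighted q z / expR L], a positive function of
    integral at most [1 + e] whose logarithm has nonnegative integral. *)
Lemma weighted_near_cst P q (e b : R) : half_space P -> span P q -> 0 < b ->
  int (weighted q) <= expR L * (1 + e) ->
  int (fun z => `|weighted q z / expR L - 1|) <= (1 + b^-1) * e + b.
Proof.
move=> hP Pq b0 Eq; have [w0 lwi Lle] := ln_weighted_ge hP Pq.
have wi := integ_weighted Pq.
have sp : 0 < expR L by exact: expR_gt0.
have iv : integ (fun z => (expR L)^-1 * weighted q z) by exact: integZ.
have i1 : integ (fun z => ((expR L)^-1 * weighted q z - 1) - (ln (weighted q z) - L)).
  by apply: integB; apply: integB => //; exact: integ_cst.
have i2 : integ (fun z => (1 + b^-1) *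
    (((expR L)^-1 * weighted q z - 1) - (ln (weighted q z) - L)) + b).
  by apply: integD; [exact: integZ|exact: integ_cst].
apply: (@le_trans _ _ (int (fun z => (1 + b^-1) *
    (((expR L)^-1 * weighted q z - 1) - (ln (weighted q z) - L)) + b))).
  apply: le_int_ae => //.
    apply: integ_norm; apply: integB; last exact: integ_cst.
    by apply: eq_integ iv => z; rewrite mulrC.
  apply: filterS w0 => z wz.
  have := dist1_le_defect (divr_gt0 wz sp) b0.
  by rewrite ln_div ?posrE// expRK mulrC.
rewrite intD ?int_cst//; [|exact: integZ|exact: integ_cst].
rewrite lerD2r intZ//.
have b1 : 0 < 1 + b^-1 by rewrite addr_gt0// invr_gt0.
rewrite ler_pM2l// intB; [|by apply: integB => //; exact: integ_cst|by apply: integB => //; exact: integ_cst].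
rewrite !intB//; [|exact: integ_cst|exact: integ_cst].
rewrite !int_cst intZ//.
have wle : (expR L)^-1 * int (weighted q) <= 1 + e by rewrite ler_pdivrMl.
exact: defect_le wle Lle.
Qed.


Lemma sum_geometric (n : nat) : \sum_(0 <= k < n) (4^-1 ^+ k : R) <= 2.
Proof.
suff : \sum_(0 <= k < n) (4^-1 ^+ k : R) <= 2 - 2 * 4^-1 ^+ n.
  by move=> /le_trans; apply; rewrite lerBlDr lerDl mulr_ge0// exprn_ge0.
elim: n => [|n IH]; first by rewrite big_nil expr0 mulr1 subrr.
rewrite big_nat_recr//= exprSr.
have : 0 <= 4^-1 ^+ n :> R by rewrite exprn_ge0.
lra.
Qed.

(** By [phase_cauchy] the squared distances of consecutive phases decrease like
    $16^{-k}$, hence the distances like $4^{-k}$. *)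
Lemma phase_limit P (q : nat -> torus R -> R[i]) : half_space P ->
  (forall k, span P (q k)) ->
  (forall k, int (weighted (q k)) <= expR L * (1 + 16^-1 ^+ k)) ->
  exists theta : torus R -> R[i], [/\ cmeas theta, forall z, cabs (theta z) <= 1,
    {ae m, forall z, cabs (theta z) = 1} &
    {ae m, forall z, cabs (phase (1 + q k z) - theta z) @[k --> \oo] --> (0 : R)}].
Proof.
move=> hP Pq Eq; pose u k z := phase (1 + q k z).
have mu k : cmeas (u k).
  apply: (@cmeas_phase (fun z => 1 + q k z)); apply: cmeasD; first exact: cmeas_cst.
  exact: cmeas_span (Pq k).
have u1 k z : cabs (u k z) <= 1 by exact: cabs_phase_le1.
have fi k : integ (fun z => cabs (u k z - u k.+1 z) ^+ 2).
  apply: (@integ_bnd _ _ _ _ _ (2 ^+ 2)).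
    by apply: measurable_funX; apply/cmeas_cabs/cmeasB.
  move=> z; rewrite ger0_norm ?sqr_ge0// lerXn2r ?nnegrE ?cabs_ge0//.
  by rewrite (le_trans (cabsD _ _))// cabsN (_ : 2 = 1 + 1)// lerD.
have fle k : int (fun z => cabs (u k z - u k.+1 z)) <= (1 + 16 / p) * 4^-1 ^+ k.
  pose a : R := 4^-1 ^+ k; have a0 : 0 < a by rewrite exprn_gt0.
  have aa : 16^-1 ^+ k = a * a.
    by rewrite /a -exprMn; congr (_ ^+ _); rewrite -invfM -natrM.
  have e0 : 0 < 16^-1 ^+ k :> R by rewrite exprn_gt0.
  have Ek1 : int (weighted (q k.+1)) <= expR L * (1 + 16^-1 ^+ k).
    apply: le_trans (Eq _) _; rewrite ler_pM2l ?expR_gt0// lerD2l exprS.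
    by rewrite ler_piMl ?(ltW e0)// invf_le1// ler1n.
  have H := phase_cauchy hP (Pq k) (Pq k.+1) e0 (Eq k) Ek1.
  (* [x <= a + a^-1 * x ^+ 2], both terms being of order [a = 4^-1 ^+ k]. *)
  apply: (@le_trans _ _ (int (fun z => a + a^-1 * cabs (u k z - u k.+1 z) ^+ 2))).
    apply: le_int.
    - apply: (@integ_bnd _ _ _ _ _ 2); first by apply/cmeas_cabs/cmeasB.
      move=> z; rewrite ger0_norm ?cabs_ge0// (le_trans (cabsD _ _))//.
      by rewrite cabsN (_ : 2 = 1 + 1)// lerD.
    - by apply: integD; [exact: integ_cst|exact: integZ].
    - move=> z; move: (cabs _) (cabs_ge0 (u k z - u k.+1 z)) => x x0.
      have [xa|/ltW ax] := lerP x a.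
        by rewrite (le_trans xa)// lerDl mulr_ge0 ?sqr_ge0// invr_ge0 ltW.
      rewrite (@le_trans _ _ (a^-1 * x ^+ 2))//; last by rewrite lerDr ltW.
      by rewrite ler_pdivlMl// expr2 ler_wpM2r.
  rewrite intD; [|exact: integ_cst|exact: integZ].
  rewrite int_cst intZ// mulrDl mul1r lerD2l ler_pdivrMl//.
  by apply: le_trans H _; rewrite aa mulrCA.
have c0 : 0 <= 1 + 16 / p by rewrite addr_ge0// divr_ge0// ltW.
have sum_le n : \sum_(0 <= k < n) int (fun z => cabs (u k z - u k.+1 z)) <= (1 + 16 / p) * 2.
  apply: (@le_trans _ _ (\sum_(0 <= k < n) (1 + 16 / p) * 4^-1 ^+ k)).
    by apply: ler_sum => k _; exact: fle.
  by rewrite -mulr_sumr ler_wpM2l// sum_geometric.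
have [v mv cv] := ae_cvg_of_sum_dist mu u1 sum_le.
have u1ae : {ae m, forall z, forall k, cabs (u k z) = 1}.
  apply: ae_foralln => k; have [g0 _ _] := jensen hm hP (Pq k).
  apply: filterS g0 => z gz; apply: cabs_phase.
  by apply: contraTneq gz => ->; rewrite cabs0 ltxx.
have v1 : {ae m, forall z, cabs (v z) = 1}.
  apply: filterS2 u1ae cv => z uz cvz.
  have cvh : `|1 - cabs (v z)| @[k --> \oo] --> (0 : R).
    apply: (squeeze_cvgr _ (cvg_cst (0 : R)) cvz); apply: nearW => k.
    by rewrite normr_ge0 -(uz k) cabs_dist.
  have /eqP : `|1 - cabs (v z)| = 0.
    by rewrite -(cvg_lim _ cvh)//; apply/esym/cvg_lim => //; exact: cvg_cst.
  by rewrite normr_eq0 subr_eq0 => /eqP.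
have vE : {ae m, forall z, phase (v z) = v z}.
  by apply: filterS v1 => z vz; rewrite /phase vz invr1 mul1r.
(* Passing to the phase of [v] makes the bound by [1] hold everywhere. *)
exists (fun z => phase (v z)); split.
- exact: cmeas_phase.
- by move=> z; exact: cabs_phase_le1.
- by apply: filterS2 v1 vE => z vz ->.
- by apply: filterS2 cv vE => z cvz ->.
Qed.


Section extremal_function.
Let s : R := expR L.
Let c : R := s `^ p^-1.

Let s0 : 0 < s. Proof. exact: expR_gt0. Qed.
Let c0 : 0 < c. Proof. exact: powR_gt0. Qed.
Let powRVK (x : R) : 0 <= x -> (x `^ p^-1) `^ p = x.
Proof. by move=> x0; rewrite -powRrM mulVf ?powRr1// gt_eqF. Qed.

Variables (q : nat -> torus R -> R[i]) (theta : torus R -> R[i]).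
Hypotheses (Nq : forall k, span nonneg_neq0 (q k))
  (qle : forall k, int (weighted (q k)) <= s * (1 + 16^-1 ^+ k))
  (mtheta : cmeas theta) (theta_le1 : forall z, cabs (theta z) <= 1)
  (theta1 : {ae m, forall z, cabs (theta z) = 1})
  (theta_cvg : {ae m, forall z,
    cabs (phase (1 + q k z) - theta z) @[k --> \oo] --> (0 : R)}).

(** Its modulus is the $p$-th root of the weight, and its phase cancels the
    limit of the phases of [1 + q k]. *)
Definition extremal z : R[i] := (K z `^ p^-1)%:C%C * (theta z)^*%C.
Local Notation h := extremal.

Let mh : cmeas h.
Proof. by apply: cmeasM; [apply: cmeas_real (integ_meas integ_rootK)|exact: cmeas_conj]. Qed.

Let cabs_hE z : cabs (h z) = K z `^ p^-1 * cabs (theta z).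
Proof. by rewrite /h cabsM cabs_real ger0_norm ?powR_ge0// cabs_conj. Qed.

Lemma cabs_extremal : {ae m, forall z, K z = cabs (h z) `^ p}.
Proof.
by apply: filterS theta1 => z tz; rewrite cabs_hE tz mulr1 powRVK// ltW.
Qed.

Lemma inLp_extremal : inLp m p h.
Proof.
apply: (inLp_le mh _ Ki) => z; rewrite -[leRHS]powRVK ?(ltW (K0 z))//.
apply: (powR_le p0); first exact: cabs_ge0.
by rewrite cabs_hE ler_piMr// powR_ge0.
Qed.

Let mg k : cmeas (fun z => 1 + q k z).
Proof. by apply: cmeasD; [exact: cmeas_cst|exact: cmeas_span (Nq k)]. Qed.

Let Pg k : span nonneg (fun z => 1 + q k z).
Proof.
apply: spanD; first exact: span_cst.
by apply: span_sub (Nq k) => a [].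
Qed.

Let ci : inLp m p (fun _ : torus R => c%:C%C).
Proof. by apply: (inLp_bnd m p0 (cmeas_cst _)) => z; exact: lexx. Qed.

Let gi k : inLp m p (fun z => (1 + q k z) * h z).
Proof. exact: (span_mul_inLp p1 (Pg k) inLp_extremal). Qed.

(** Write [1 + q k z] as modulus times phase and multiply by [theta z], of
    modulus [1]: the difference of the moduli and the difference of the phases
    separate. *)
Lemma extremal_dist k z : cabs (theta z) = 1 ->
  cabs ((1 + q k z) * h z - c%:C%C) `^ p <=
  2 `^ p * (s * `|weighted (q k) z / s - 1| + s * cabs (phase (1 + q k z) - theta z) `^ p).
Proof.
move=> tz; pose r := cabs (1 + q k z) * K z `^ p^-1.
have r0 : 0 <= r by rewrite mulr_ge0 ?cabs_ge0// powR_ge0.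
have rp : r `^ p = weighted (q k) z.
  by rewrite /r powRM ?cabs_ge0 ?powR_ge0// powRVK// ltW.
set u := phase (1 + q k z).
have u1 : cabs u <= 1 by exact: cabs_phase_le1.
have E : (1 + q k z) * h z - c%:C%C = (r%:C%C * u - c%:C%C * theta z) * (theta z)^*%C.
  rewrite mulrBl -[c%:C%C * _ * _]mulrA mul_conj tz expr1n mulr1; congr (_ - _).
  by rewrite /r complexM [in LHS](phaseE (1 + q k z)) /h -/u; ring.
rewrite E cabsM cabs_conj tz mulr1.
have -> : r%:C%C * u - c%:C%C * theta z = (r - c)%:C%C * u + c%:C%C * (u - theta z).
  by rewrite complexB; ring.
have le1 : cabs ((r - c)%:C%C * u + c%:C%C * (u - theta z)) <=
    `|r - c| + c * cabs (u - theta z).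
  rewrite (le_trans (cabsD _ _))// (cabsM _ u) (cabsM _ (u - _)) !cabs_real (ger0_norm (ltW c0)).
  by rewrite lerD2r ler_piMr.
apply: (le_trans (powR_le p0 (cabs_ge0 _) le1)).
have ct0 : 0 <= c * cabs (u - theta z) by rewrite mulr_ge0 ?cabs_ge0// ltW.
apply: (le_trans (powRD_le p0 (normr_ge0 _) ct0)).
rewrite ler_pM2l ?powR_gt0// powRM ?cabs_ge0 ?(ltW c0)// (powRVK (ltW s0)) lerD2r.
apply: (le_trans (powR_dist_le p1 r0 (ltW c0))).
rewrite rp (powRVK (ltW s0)) -{2}(ger0_norm (ltW s0)) -normrM mulrBr mulr1.
by rewrite mulrCA divff ?mulr1// gt_eqF.
Qed.

Lemma extremal_cvg : pdist m p (fun z => (1 + q k z) * h z) (fun=> c%:C%C)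
  @[k --> \oo] --> (0 : R).
Proof.
pose u k z := phase (1 + q k z).
have mu k : cmeas (u k) by exact: cmeas_phase.
have ui k : inLp m p (u k) by apply: (inLp_bnd m p0 (mu k)) => z; exact: cabs_phase_le1.
have ti : inLp m p theta by exact: (inLp_bnd m p0 mtheta theta_le1).
have cvt : pdist m p (u k) theta @[k --> \oo] --> (0 : R).
  apply: (pdist_dct p0 ui ti (integ_cst m (2 `^ p)) _ theta_cvg) => k z.
  apply: (powR_le p0); first exact: cabs_ge0.
  rewrite (le_trans (cabsD _ _))// cabsN (_ : 2 = 1 + 1)// lerD//.
  exact: cabs_phase_le1.
have cv4 : 4^-1 ^+ k @[k --> \oo] --> (0 : R).
  by apply: cvg_expr; rewrite ger0_norm// invf_lt1// ltr1n.
have cvs : 2 `^ p * (s * (3 * 4^-1 ^+ k) + s * pdist m p (u k) theta) @[k --> \oo] --> (0 : R).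
  have -> : 0 = 2 `^ p * (s * (3 * 0) + s * 0) :> R by ring.
  by apply: cvgMr; apply: cvgD; apply: cvgMr => //; exact: cvgMr.
apply: (squeeze_cvgr _ (cvg_cst (0 : R)) cvs); apply: nearW => k.
rewrite pdist_ge0/=.
have [_ lwi _] := ln_weighted_ge (half_space_lex 0)
  (span_sub (@nonneg_neq0_lex 0) (Nq k)).
have iw := integ_weighted (Nq k).
have iw1 : integ (fun z => `|weighted (q k) z / s - 1|).
  apply: integ_norm; apply: integB; last exact: integ_cst.
  by apply: eq_integ (integZ s^-1 iw) => z; rewrite mulrC.
have it := integ_pdist p0 (ui k) ti.
apply: (@le_trans _ _ (int (fun z => 2 `^ p * (s * `|weighted (q k) z / s - 1| +
    s * cabs (phase (1 + q k z) - theta z) `^ p)))).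
  apply: le_int_ae.
  - exact: (integ_pdist p0 (gi k) ci).
  - by apply: integZ; apply: integD; exact: integZ.
  - by apply: filterS theta1 => z; exact: extremal_dist.
rewrite intZ; last by apply: integD; exact: integZ.
rewrite ler_pM2l ?powR_gt0// intD; [|exact: integZ|exact: integZ].
rewrite !intZ// lerD2r ler_pM2l//.
pose a : R := 4^-1 ^+ k; have a0 : 0 < a by rewrite exprn_gt0.
have aa : 16^-1 ^+ k = a * a.
  by rewrite /a -exprMn; congr (_ ^+ _); rewrite -invfM -natrM.
have a1 : a <= 1 by rewrite exprn_ile1// invf_le1// ler1n.
apply: (le_trans (weighted_near_cst (half_space_lex 0)
  (span_sub (@nonneg_neq0_lex 0) (Nq k)) a0 (qle k))).
rewrite aa -/a mulrDl mul1r mulKf ?gt_eqF//.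
have : a * a <= a by rewrite ler_piMl// ltW.
lra.
Qed.

(** The functions [1 + t f h] are limits in $L^1$ of [(1 + q') h / c] with [q']
    in the half-space of index [i], whose geometric means are at least [1] by
    [ln_weighted_ge]; upper semicontinuity and [Re_cint_ge0] conclude. *)
Lemma span_lex_extremal_ge0 i f : span (lex_half i) f ->
  0 <= complex.Re (cint m (fun z => f z * h z)).
Proof.
move=> Pf; have hi := inLp_extremal.
have fhi : inLp m p (fun z => f z * h z) := span_mul_inLp p1 Pf hi.
have fhc := cinteg_inLp p1 fhi.
apply: (Re_cint_ge0 fhc) => t r t0 r0.
have cwi : cinteg m (fun z => 1 + t%:C%C * (f z * h z)).
  by apply: cintegD; [exact: cinteg_cst|exact: (cintegZ _ fhc)].
apply: (int_ln_usc r0 (fun z => cabs_ge0 _) (cinteg_cabs cwi)) => e e0.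
have ce0 : 0 < c * e by rewrite mulr_gt0.
have [b b0 Hb] := L1_le_pdist m p1 ce0.
have /cvgrPdist_lt/(_ _ b0) [N _ /(_ N (leqnn N))] := extremal_cvg.
rewrite /= sub0r normrN ger0_norm ?pdist_ge0// => /ltW dN.
have L1N := Hb _ _ (gi N) ci dN.
pose q' z := q N z + (t * c)%:C%C * f z.
have Pq' : span (lex_half i) q'.
  by apply: spanD; [exact: span_sub (@nonneg_neq0_lex i) (Nq N)|exact: spanZ].
have [w0 lwi lwL] := ln_weighted_ge (half_space_lex i) Pq'.
have iw := integ_weighted Pq'.
pose G z := c^-1 * weighted q' z `^ p^-1.
have ci0 : 0 < c^-1 by rewrite invr_gt0.
have GE : {ae m, forall z, G z = c^-1 * cabs ((1 + q' z) * h z)}.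
  apply: filterS theta1 => z tz; rewrite /G /weighted powRM ?powR_ge0 ?(ltW (K0 z))//.
  rewrite -powRrM mulfV ?gt_eqF// powRr1 ?cabs_ge0//.
  by rewrite cabsM cabs_hE tz mulr1.
have mG : measurable_fun setT G.
  apply: measurable_funM => //.
  by apply: (measurableT_comp (measurable_powR p^-1)); exact: integ_meas iw.
have q'h : inLp m p (fun z => (1 + q' z) * h z).
  have -> : (fun z => (1 + q' z) * h z) =
      fun z => (1 + q N z) * h z + (t * c)%:C%C * (f z * h z).
    by apply/funext => z; rewrite /q'; ring.
  by apply: (inLpD p0) => //; exact: (inLpZ p0).
have q'hc := cinteg_inLp p1 q'h.
have iG : integ G.
  apply: (integ_ae (integZ c^-1 (cinteg_cabs q'hc)) mG).
  by apply: filterS GE => z ->.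
have lc : ln c = p^-1 * L by rewrite /c ln_powR /s expRK.
have lG : {ae m, forall z, p^-1 * ln (weighted q' z) - ln c = ln (G z)}.
  apply: filterS w0 => z wz.
  by rewrite /G [RHS]lnM ?posrE ?powR_gt0// lnV ?posrE// ln_powR addrC.
have mlG : measurable_fun setT (fun z => ln (G z)).
  exact: (measurableT_comp (@measurable_ln R) mG).
have ilw : integ (fun z => p^-1 * ln (weighted q' z) - ln c).
  by apply: integB; [exact: integZ|exact: integ_cst].
exists G; split.
- by move=> z; rewrite mulr_ge0 ?powR_ge0// ltW.
- by apply: filterS w0 => z wz; rewrite mulr_gt0// powR_gt0.
- exact: iG.
- exact: integ_ae ilw mlG lG.
split; last first.
  rewrite -(eq_int_ae (integ_meas ilw) mlG lG) intB; [|exact: integZ|exact: integ_cst].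
  rewrite int_cst intZ// lc -mulrBr sub0r.
  by rewrite (@le_trans _ _ 0) ?oppr_le0 ?(ltW e0)// mulr_ge0 ?subr_ge0// invr_ge0 ltW.
have i1 := cinteg_cabs (cintegB (cinteg_inLp p1 (gi N)) (cinteg_inLp p1 ci)).
apply: (@le_trans _ _ (int (fun z => c^-1 * cabs ((1 + q N z) * h z - c%:C%C)))).
  apply: le_int_ae.
  - by apply: integ_norm; apply: integB; [exact: iG|exact: cinteg_cabs].
  - exact: integZ.
  - apply: filterS GE => z ->.
    have -> : c^-1 * cabs ((1 + q' z) * h z) = cabs ((c^-1)%:C%C * ((1 + q' z) * h z)).
      by rewrite [RHS]cabsM cabs_real (ger0_norm (ltW ci0)).
    apply: (le_trans (cabs_dist _ _)).
    have cc : (c^-1)%:C%C * c%:C%C = 1 :> R[i] by rewrite -complexM mulVf// gt_eqF.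
    have -> : (c^-1)%:C%C * ((1 + q' z) * h z) - (1 + t%:C%C * (f z * h z)) =
        (c^-1)%:C%C * ((1 + q N z) * h z - c%:C%C).
      have E0 : t%:C%C * (f z * h z) = (c^-1)%:C%C * c%:C%C * (t%:C%C * (f z * h z)).
        by rewrite cc mul1r.
      by rewrite mulrBr cc E0 /q' complexM; ring.
    by rewrite cabsM cabs_real (ger0_norm (ltW ci0)).
by rewrite intZ// ler_pdivrMl.
Qed.

(** Rotating [f] turns a one-sided bound on the real part into vanishing. *)
Lemma cint_lex_extremal i f : span (lex_half i) f ->
  cint m (fun z => f z * h z) = 0.
Proof.
move=> Pf; have [w w1 wE] := rotation (cint m (fun z => f z * h z)).
have := span_lex_extremal_ge0 (spanZ (- w) Pf).
rewrite (eq_cint m (g := fun z => - w * (f z * h z))); last by move=> z; rewrite -[LHS]mulrA.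
rewrite cintZ; last exact: (cinteg_inLp p1 (span_mul_inLp p1 Pf inLp_extremal)).
rewrite mulNr wE ReN /= oppr_ge0 => le0.
by apply: cabs_eq0; apply/eqP; rewrite eq_le le0 cabs_ge0.
Qed.

Lemma cyclic_extremal : cyclic_vector m p h.
Proof.
have hi := inLp_extremal; apply/(cyclicP m p1); split; first exact: hi.
  apply: (spectral_approx hm p1 (cinteg_inLp p1 hi) hi) => N a sa na.
  have [i ai] : exists i, 0 < a i.
    apply: contrapT => no; apply: na => i; rewrite oppr_ge0 leNgt.
    by apply/negP => ai; apply: no; exists i.
  by apply: (@cint_lex_extremal i); apply: span_chi sa _; left.
move=> e e0; have cp0 : 0 < c `^ p by exact: powR_gt0.
have /cvgrPdist_lt/(_ _ (mulr_gt0 cp0 e0)) [N _ /(_ N (leqnn N))] := extremal_cvg.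
rewrite /= sub0r normrN ger0_norm ?pdist_ge0// => /ltW dN.
have cc : (c^-1)%:C%C * c%:C%C = 1 :> R[i] by rewrite -complexM mulVf// gt_eqF.
exists (fun z => (c^-1)%:C%C * (1 + q N z) * h z).
  by exists (fun z => (c^-1)%:C%C * (1 + q N z)); first exact: spanZ.
have := pdistZ p0 (c^-1)%:C%C ci (gi N).
rewrite (_ : (fun _ => (c^-1)%:C%C * c%:C%C) = fun _ : torus R => 1); last first.
  by apply/funext => z; exact: cc.
rewrite (_ : (fun z => (c^-1)%:C%C * ((1 + q N z) * h z)) =
  fun z => (c^-1)%:C%C * (1 + q N z) * h z); last by apply/funext => z; rewrite mulrA.
move=> /le_trans; apply; rewrite pdistC cabs_real ger0_norm ?invr_ge0 ?(ltW c0)//.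
apply: (@le_trans _ _ ((c^-1) `^ p * (c `^ p * e))).
  by rewrite ler_pM2l// powR_gt0// invr_gt0.
by rewrite mulrA -powRM ?invr_ge0 ?(ltW c0)// mulVf ?gt_eqF// powR1 mul1r.
Qed.

End extremal_function.

Lemma cyclic_of_szego_le :
  (forall e : R, 0 < e ->
    exists2 q, span nonneg_neq0 q & int (weighted q) <= expR L + e) ->
  exists2 h, cyclic_vector m p h & {ae m, forall z, K z = cabs (h z) `^ p}.
Proof.
move=> H; have ex k : exists q, span nonneg_neq0 q /\
    int (weighted q) <= expR L * (1 + 16^-1 ^+ k).
  have e0 : 0 < expR L * 16^-1 ^+ k by rewrite mulr_gt0 ?expR_gt0// exprn_gt0.
  have [q Nq qle] := H _ e0; exists q; split; first exact: Nq.
  by rewrite mulrDr mulr1; exact: qle.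
have [q Hq] := choice ex.
have Nq k : span nonneg_neq0 (q k) by have [] := Hq k.
have qle k : int (weighted (q k)) <= expR L * (1 + 16^-1 ^+ k) by have [] := Hq k.
have [theta [mt t1 at1 cvt]] := phase_limit (half_space_lex 0)
  (fun k => span_sub (@nonneg_neq0_lex 0) (Nq k)) qle.
exists (extremal theta).
  exact: (cyclic_extremal Nq qle mt t1 at1 cvt).
exact: (cabs_extremal at1).
Qed.

Lemma szego_infE : szego_inf m p K = ereal_inf
  [set (int (weighted q))%:E | q in (span (R := R) nonneg_neq0)].
Proof.
have E (q : torus R -> R[i]) : span nonneg_neq0 q ->
    (\int[m]_z ((cabs (1 - (- q z)) `^ p) * K z)%:E)%E = (int (weighted q))%:E.
  move=> Nq; rewrite -(int_EFin (integ_weighted Nq)).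
  by apply: eq_integral => z _; rewrite opprK.
have span_opp (q : torus R -> R[i]) : span nonneg_neq0 q -> span nonneg_neq0 (fun z => - q z).
  by move=> Nq; apply: eq_span (spanZ (-1) Nq) => z; rewrite mulN1r.
congr ereal_inf; apply/seteqP; split=> _ [q qP <-].
- have Nq := span_opp _ (span_analytic0 hm qP).
  exists (fun z => - q z); first exact: Nq.
  by rewrite -(E _ Nq); apply: eq_integral => z _; rewrite opprK.
- exists (fun z => - q z); last exact: E.
  have Nq := span_opp _ qP; apply/(analytic_poly0P hm); split.
    by apply: span_sub Nq => a [].
  by apply: (cint_span0 hm _ Nq) => a [].
Qed.

Lemma szego_positive : szego_inf m p K = (expR L)%:E <->
  exists2 h, cyclic_vector m p h & {ae m, forall z, K z = cabs (h z) `^ p}.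
Proof.
rewrite szego_infE; set S := [set _ | _ in _]; split=> [SE|[h hc hK]].
  apply: cyclic_of_szego_le => e e0.
  have := @lb_ereal_inf_adherent _ S e e0; rewrite SE => /(_ isT)[_ [q Nq <-]].
  by rewrite -EFinD lte_fin => /ltW le; exists q.
apply/eqP; rewrite eq_le; apply/andP; split; last first.
  apply: le_ereal_inf_tmp => _ [q Nq <-]; rewrite lee_fin.
  exact: (szego_ge (half_space_lex 0) (span_sub (@nonneg_neq0_lex 0) Nq)).
apply/lee_addgt0Pr => e e0.
have [q Nq le] := szego_le_of_cyclic hc hK e0.
apply: (@le_trans _ _ (int (weighted q))%:E); last by rewrite -EFinD lee_fin.
by apply: ereal_inf_lbound; exists q.
Qed.

End szego.

(** * The characterisation *)

Section characterisation.
Context {R : realType}.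
Variables (m : probability (torus R) R) (hm : is_haar m) (p : R).

Lemma szego_inf_ae (K K' : torus R -> R) : measurable_fun setT K ->
  measurable_fun setT K' -> {ae m, forall z, K z = K' z} ->
  szego_inf m p K = szego_inf m p K'.
Proof.
move=> mK mK' KK'; congr ereal_inf.
have E (q : torus R -> R[i]) : analytic_poly0 q ->
    (\int[m]_z ((cabs (1 - q z) `^ p) * K z)%:E =
     \int[m]_z ((cabs (1 - q z) `^ p) * K' z)%:E)%E.
  move=> /(analytic_poly0P hm)[Nq _].
  have mq : measurable_fun setT (fun z => cabs (1 - q z) `^ p).
    apply: meas_cabs_powR; apply: cmeasB; first exact: cmeas_cst.
    exact: cmeas_span Nq.
  apply: ae_eq_integral => //.
  - by apply/measurable_EFinP; exact: measurable_funM.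
  - by apply/measurable_EFinP; exact: measurable_funM.
  - by apply: filterS KK' => z -> _.
by apply/seteqP; split=> _ [q qP <-]; exists q => //; rewrite E.
Qed.

End characterisation.

Theorem theorem3p1 (R : realType) (m : probability (torus R) R)
    (hm : is_haar m) (p : R) (hp : 1 < p) (K : torus R -> R)
    (K_ge0 : {ae m, forall z, 0 <= K z})
    (K_L1 : m.-integrable setT (EFin \o K))
    (* [lne] is the extended logarithm, with [lne 0 = -oo]; [ln 0 = 0]. *)
    (logK_L1 : m.-integrable setT (fun z => lne (K z)%:E))
    (K_norm1 : ('N[m]_1[EFin \o K])%E = 1%E) :
  szego_inf m p K = expeR (\int[m]_z lne (K z)%:E)%E <->
  exists2 h, cyclic_vector m p h & {ae m, forall z, K z = cabs (h z) `^ p}.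
Proof.
have mK := integ_meas K_L1.
have Kpos : {ae m, forall z, 0 < K z}.
  apply: filterS (integrable_ae measurableT logK_L1) => z /(_ Logic.I).
  by case: (ltP 0 (K z)) => // Kz; rewrite le0_lneNy// lee_fin.
(* A positive version of [K]; as [ln] vanishes on nonpositive numbers, it is
   [1] where [K] is not positive. *)
pose K' z := expR (ln (K z)).
have mK' : measurable_fun setT K'.
  exact: (measurableT_comp (@measurable_expR R)
    (measurableT_comp (@measurable_ln R) mK)).
have KK' : {ae m, forall z, K z = K' z}.
  by apply: filterS Kpos => z Kz; rewrite /K' lnK.
have K'0 z : 0 < K' z by exact: expR_gt0.
have K'i : m.-integrable setT (EFin \o K') := integ_ae K_L1 mK' KK'.
have lneE : {ae m, forall z, lne (K z)%:E = (ln (K z))%:E}.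
  by apply: filterS Kpos => z Kz; exact: lne_EFin.
have lK'E z : ln (K' z) = ln (K z) by rewrite /K' expRK.
have mlK' : measurable_fun setT (fun z => (ln (K' z))%:E).
  apply/measurable_EFinP; exact: (measurableT_comp (@measurable_ln R) mK').
have lK'i : m.-integrable setT (EFin \o (fun z => ln (K' z))).
  apply: (integrable_ae_eq logK_L1 mlK').
  by apply: filterS lneE => z ->; rewrite lK'E.
have -> : expeR (\int[m]_z lne (K z)%:E)%E =
    (expR (Rintegral m setT (fun z => ln (K' z))))%:E.
  rewrite -[RHS]/(expeR (Rintegral m setT (fun z => ln (K' z)))%:E).
  rewrite -(int_EFin lK'i); congr expeR; apply: ae_eq_integral => //.
  - exact: measurable_int logK_L1.
  - by apply: filterS lneE => z -> _; rewrite lK'E.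
rewrite (szego_inf_ae hm p mK mK' KK').
split=> [/(szego_positive hm hp K'0 K'i lK'i)[h hc hK]|[h hc hK]].
  by exists h => //; apply: filterS2 KK' hK => z -> .
apply/(szego_positive hm hp K'0 K'i lK'i); exists h => //.
by apply: filterS2 KK' hK => z <-.
Qed.
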